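(* We have $$\sum_{i,j,k\geq 0} \frac{q^{i^2+3j^2+4k^2-2ij+4jk+2j+4k}}{(q^4;q^4)_i(q^4;q^4)_j(q^4;q^4)_k} =\frac{J_{2,24}\,J_{24}^{9/2}\,J_{6,24}\,J_{10,24}}{J_{1,24}\,J_{4,24}^2\,J_{5,24}\,J_{7,24}\,J_{8,24}\,J_{11,24}\,J_{12,24}^{1/2}}.$$
   Context: Throughout $|q|<1$. Notation: $(a;q)_n=\prod_{k=0}^{n-1}(1-aq^k)$, $(a;q)_\infty=\prod_{k\ge0}(1-aq^k)$, $(a_1,\dots,a_r;q)_\infty=\prod_s(a_s;q)_\infty$; $J_m:=(q^m;q^m)_\infty$ and $J_{a,m}:=(q^a,q^{m-a},q^m;q^m)_\infty$. Half-integer powers denote the branch that is a power series in $q$ with constant term $1$; in particular $J_{24}^{9/2}/J_{12,24}^{1/2}=J_{24}^4/(q^{12};q^{24})_\infty$. *)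

(* Defs.v *)
From Stdlib Require Import Reals List ClassicalEpsilon.
From Coquelicot Require Import Coquelicot.

Open Scope C_scope.

(* (a;q)_n *)
Fixpoint qpoch (a q : C) (n : nat) : C :=
  match n with
  | O => 1
  | S m => qpoch a q m * (1 - a * q ^ m)
  end.

(* (a;q)_oo; the limit exists for |q| < 1, and [lim] is arbitrary otherwise *)
Definition qpoch_inf (a q : C) : C :=
  lim (T := C_CompleteNormedModule) (filtermap (qpoch a q) eventually).

Definition J (m : nat) (q : C) : C := qpoch_inf (q ^ m) (q ^ m).

(* J_{a,m}, for a <= m (the subtraction is truncated) *)
Definition Jt (a m : nat) (q : C) : C :=
  qpoch_inf (q ^ a) (q ^ m) * qpoch_inf (q ^ (m - a)) (q ^ m)
  * qpoch_inf (q ^ m) (q ^ m).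

(* [g] is, on the unit disc, a power series with constant term 1 whose square
   is [f ^ n]. *)
Definition is_half_power (f : C -> C) (n : nat) (g : C -> C) : Prop :=
  exists a : nat -> C,
    a O = 1 /\
    forall q : C, (Cmod q < 1)%R ->
      is_pseries a q (g q) /\ g q ^ 2 = f q ^ n.

(* f^{n/2}.  On the unit disc the branch is unique when it exists, since two
   power series with equal squares are equal up to sign. *)
Definition half_power (f : C -> C) (n : nat) : C -> C :=
  epsilon (inhabits f) (is_half_power f n).

(* Unconditional summation of a family indexed by [I]: convergence of the net
   of sums over finite subsets, encoded as duplicate-free lists. *)
Definition is_sum {I : Type} (f : I -> C) (s : C) : Prop :=
  forall eps : posreal, exists F : list I,
    forall G : list I, NoDup G -> incl F G ->
      (Cmod (fold_right Cplus 0 (map f G) - s) < eps)%R.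

(* Main.v *)
(* Put Q = q^4, 1/(Q)_n = 0 for n < 0, and let all sums run over Z.  Summing over i and k first writes
   the triple sum as sum_j w_j a_j t_j with w_j = (-1)^j q^(2j^2) / (Q)_j, where
   a_j = sum_i q^(i^2-2ij) / (Q)_i and the k-sum t_j solve the same second-order recurrence in j;
   so does b_j = (-1)^j a_j(-q), and t is a combination of a and b with theta constants as
   coefficients (connection formula).  The resulting sums over j of w a b and w a a converge only
   conditionally, but the recurrence shows that, up to a telescoping term, w_j y_j y'_j may be replaced
   by an average that makes everything absolutely convergent.  Summing that over j by Euler, and over
   i - i' at fixed i + i' by the q-binomial theorem, leaves an alternating single series, which a
   q-difference equation and a Slater-type identity (Bailey's lemma) turn into a theta function.  The
   triple sum is then a difference of two products of three theta functions; the lattice map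
   (n, n') -> (n + 3n' + 1, n - n') for x^2 + 3 y^2 collapses it to
   (-Q;Q)_oo / (Q;Q)_oo * sum_n q^(3n^2+2n), whose Jacobi product splits into residues mod 24.
   The half powers exist because a square root of an infinite product is the power series solving
   q a' = (c/2) a, where c is the logarithmic derivative of the product. *)

Require Import Defs.
From Stdlib Require Import Reals List Lra Lia ZArith Permutation Classical ClassicalEpsilon FunctionalExtensionality.
From Coquelicot Require Import Coquelicot.

Open Scope C_scope.

(** * Unconditional sums *)

(** The weight carries q^(2j^2), while a generic solution of the recurrence grows like q^(-j^2), so
    w_j y_j y'_j is merely bounded in general. Only t decays, like q^(j^2+2j), being the combination
    of a and b in which the growth cancels. Hence the telescoping is applied to the pair (a, t),
    where everything converges absolutely; t is expanded in a and b only afterwards, inside the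
    averaged sum, whose extra factor Q^j makes the separate pieces summable. Most recurrences are
    proved by certificates: a difference of summands is written as u(k) - u(k+1), and no boundary
    terms arise. Bases are written as squares, Q = P^2, so that Q^(k(k-1)/2) is P^(k^2-k) without
    division by 2. A sign s = 1 or -1 is carried along to treat a and b at once; the single-series
    identities are then used with P = s q^2. Negative powers force q <> 0, and q = 0 is settled
    separately at the end. *)

Definition lsum {I : Type} (f : I -> C) (l : list I) : C :=
  fold_right Cplus 0 (map f l).
Definition rsum {I : Type} (f : I -> R) (l : list I) : R :=
  fold_right Rplus 0%R (map f l).

Definition eq_dec_classic {I : Type} (x y : I) : {x = y} + {x <> y} :=
  excluded_middle_informative (x = y).

Definition rbounded {I : Type} (f : I -> R) (M : R) : Prop :=
  forall l, NoDup l -> (rsum f l <= M)%R.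
(** Absolute summability as a common bound for finite sums of moduli: comparison, reindexing and
    splitting into fibres become inequalities about lists. *)
Definition summable {I : Type} (f : I -> C) : Prop :=
  exists M, rbounded (fun x => Cmod (f x)) M.
Definition usum {I : Type} (f : I -> C) : C := epsilon (inhabits (0 : C)) (is_sum f).

Lemma lsum_app {I} (f : I -> C) l m : lsum f (l ++ m) = lsum f l + lsum f m.
Proof.
  unfold lsum; induction l as [|x l IH]; simpl; [ring|].
  rewrite IH; ring.
Qed.

Lemma rsum_app {I} (f : I -> R) l m : rsum f (l ++ m) = (rsum f l + rsum f m)%R.
Proof.
  unfold rsum; induction l as [|x l IH]; simpl; [ring|].
  rewrite IH; ring.
Qed.

Lemma lsum_perm {I} (f : I -> C) l m : Permutation l m -> lsum f l = lsum f m.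
Proof.
  unfold lsum; induction 1; simpl; [reflexivity|congruence|ring|congruence].
Qed.

Lemma rsum_perm {I} (f : I -> R) l m : Permutation l m -> rsum f l = rsum f m.
Proof.
  unfold rsum; induction 1; simpl; [reflexivity|congruence|ring|congruence].
Qed.

Lemma lsum_map {I J} (g : I -> J) (f : J -> C) l :
  lsum f (map g l) = lsum (fun x => f (g x)) l.
Proof. unfold lsum; now rewrite map_map. Qed.

Lemma rsum_map {I J} (g : I -> J) (f : J -> R) l :
  rsum f (map g l) = rsum (fun x => f (g x)) l.
Proof. unfold rsum; now rewrite map_map. Qed.

Lemma lsum_ext {I} (f g : I -> C) l :
  (forall x, In x l -> f x = g x) -> lsum f l = lsum g l.
Proof.
  unfold lsum; induction l as [|x l IH]; simpl; intros H; [reflexivity|].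
  rewrite H, IH; auto.
Qed.

Lemma rsum_le {I} (f g : I -> R) l :
  (forall x, In x l -> (f x <= g x)%R) -> (rsum f l <= rsum g l)%R.
Proof.
  unfold rsum; induction l as [|x l IH]; simpl; intros H; [lra|].
  apply Rplus_le_compat; auto.
Qed.

Lemma rsum_ext {I} (f g : I -> R) l :
  (forall x, In x l -> f x = g x) -> rsum f l = rsum g l.
Proof.
  unfold rsum; induction l as [|x l IH]; simpl; intros H; [reflexivity|].
  rewrite H, IH; auto.
Qed.

Lemma rsum_nonneg {I} (f : I -> R) l : (forall x, (0 <= f x)%R) -> (0 <= rsum f l)%R.
Proof.
  intros H; unfold rsum; induction l as [|x l IH]; simpl; [lra|].
  specialize (H x); lra.
Qed.

Lemma rsum_scal {I} (c : R) (f : I -> R) l :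
  rsum (fun x => (c * f x)%R) l = (c * rsum f l)%R.
Proof.
  unfold rsum; induction l as [|x l IH]; simpl; [ring|].
  rewrite IH; ring.
Qed.

Lemma rsum_plus {I} (f g : I -> R) l :
  rsum (fun x => (f x + g x)%R) l = (rsum f l + rsum g l)%R.
Proof.
  unfold rsum; induction l as [|x l IH]; simpl; [ring|].
  rewrite IH; ring.
Qed.

Lemma lsum_scal {I} (c : C) (f : I -> C) l : lsum (fun x => c * f x) l = c * lsum f l.
Proof.
  unfold lsum; induction l as [|x l IH]; simpl; [ring|].
  rewrite IH; ring.
Qed.

Lemma lsum_plus {I} (f g : I -> C) l :
  lsum (fun x => f x + g x) l = lsum f l + lsum g l.
Proof.
  unfold lsum; induction l as [|x l IH]; simpl; [ring|].
  rewrite IH; ring.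
Qed.

Lemma Cmod_lsum {I} (f : I -> C) l : (Cmod (lsum f l) <= rsum (fun x => Cmod (f x)) l)%R.
Proof.
  unfold lsum, rsum; induction l as [|x l IH]; simpl.
  - rewrite Cmod_0; lra.
  - eapply Rle_trans; [apply Cmod_triangle|]; lra.
Qed.

(** Putting F in front isolates the tail: a sum over G is the sum over F plus a sum over indices
    disjoint from F. *)
Lemma incl_split {I} (F G : list I) : NoDup F -> NoDup G -> incl F G ->
  exists H, Permutation G (F ++ H) /\ NoDup (F ++ H).
Proof.
  revert G; induction F as [|x F IH]; intros G NF NG HI.
  - exists G; split; auto.
  - inversion NF as [|? ? Hx NF']; subst.
    assert (HxG : In x G) by (apply HI; left; auto).
    destruct (in_split _ _ HxG) as [G1 [G2 ->]].
    assert (P := Permutation_middle G1 G2 x).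
    assert (N2 : NoDup (x :: G1 ++ G2)).
    { eapply Permutation_NoDup; [symmetry; exact P|assumption]. }
    inversion N2 as [|? ? Hx2 N2']; subst.
    destruct (IH (G1 ++ G2)) as [H [HP HN]]; auto.
    { intros y Hy. assert (Hy' : In y (G1 ++ x :: G2)) by (apply HI; right; auto).
      apply in_app_or in Hy'; apply in_or_app.
      destruct Hy' as [?|[->|?]]; auto; contradiction. }
    exists H; assert (Q : Permutation (G1 ++ x :: G2) ((x :: F) ++ H)).
    { etransitivity; [symmetry; exact P|]. simpl; now constructor. }
    split; [exact Q|]. eapply Permutation_NoDup; [exact Q|assumption].
Qed.

Lemma rsum_incl {I} (f : I -> R) (F G : list I) : (forall x, (0 <= f x)%R) ->
  NoDup F -> NoDup G -> incl F G -> (rsum f F <= rsum f G)%R.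
Proof.
  intros Hf NF NG HI. destruct (incl_split F G NF NG HI) as [H [HP _]].
  rewrite (rsum_perm _ _ _ HP), rsum_app.
  generalize (rsum_nonneg f H Hf); lra.
Qed.

Lemma is_sum_unique {I} (f : I -> C) s t : is_sum f s -> is_sum f t -> s = t.
Proof.
  intros Hs Ht.
  assert (E : Cmod (s - t) = 0%R).
  { apply Rle_antisym; [|apply Cmod_ge_0]. apply le_epsilon; intros e He.
    assert (He2 : (0 < e / 2)%R) by lra.
    destruct (Hs (mkposreal _ He2)) as [F1 H1], (Ht (mkposreal _ He2)) as [F2 H2].
    set (G := nodup eq_dec_classic (F1 ++ F2)).
    specialize (H1 G (NoDup_nodup _ _)); specialize (H2 G (NoDup_nodup _ _)); simpl in *.
    assert (I1 : incl F1 G) by (intros x Hx; apply nodup_In, in_or_app; auto).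
    assert (I2 : incl F2 G) by (intros x Hx; apply nodup_In, in_or_app; auto).
    specialize (H1 I1); specialize (H2 I2).
    set (u := fold_right Cplus 0 (map f G)) in *.
    replace (s - t) with (- (u - s) + (u - t)) by ring.
    eapply Rle_trans; [apply Cmod_triangle|]. rewrite Cmod_opp; lra. }
  apply Cmod_eq_0 in E.
  replace s with (s - t + t) by ring; rewrite E; ring.
Qed.

Lemma usum_eq {I} (f : I -> C) s : is_sum f s -> usum f = s.
Proof.
  intros H. apply (is_sum_unique f); [|assumption].
  unfold usum; apply epsilon_spec; exists s; assumption.
Qed.

Lemma is_sum_scal {I} (f : I -> C) c s : is_sum f s -> is_sum (fun x => c * f x) (c * s).
Proof.
  intros H eps.
  assert (K : (0 < Cmod c + 1)%R) by (generalize (Cmod_ge_0 c); lra).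
  assert (He : (0 < eps / (Cmod c + 1))%R) by (apply Rdiv_lt_0_compat; [apply eps|lra]).
  destruct (H (mkposreal _ He)) as [F HF]. exists F; intros G NG IG.
  specialize (HF G NG IG); simpl in HF.
  change (Cmod (lsum (fun x => (c * f x)%C) G - c * s) < eps)%R.
  rewrite lsum_scal. replace (c * lsum f G - c * s) with (c * (lsum f G - s)) by ring.
  rewrite Cmod_mult. change (Cmod (lsum f G - s) < eps / (Cmod c + 1))%R in HF.
  apply (Rmult_lt_compat_r (Cmod c + 1)) in HF; [|lra].
  replace (eps / (Cmod c + 1) * (Cmod c + 1))%R with (pos eps) in HF by (field; lra).
  generalize (Cmod_ge_0 (lsum f G - s)); nra.
Qed.

Lemma is_sum_plus {I} (f g : I -> C) s t :
  is_sum f s -> is_sum g t -> is_sum (fun x => f x + g x) (s + t).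
Proof.
  intros Hf Hg eps.
  assert (He : (0 < eps / 2)%R) by (generalize (cond_pos eps); lra).
  destruct (Hf (mkposreal _ He)) as [F1 H1], (Hg (mkposreal _ He)) as [F2 H2]; simpl in *.
  exists (F1 ++ F2); intros G NG IG. apply incl_app_inv in IG as [I1 I2].
  specialize (H1 G NG I1); specialize (H2 G NG I2).
  change (Cmod (lsum (fun x => (f x + g x)%C) G - (s + t)) < eps)%R.
  rewrite lsum_plus.
  replace (lsum f G + lsum g G - (s + t)) with ((lsum f G - s) + (lsum g G - t)) by ring.
  eapply Rle_lt_trans; [apply Cmod_triangle|].
  change (Cmod (lsum f G - s) < eps / 2)%R in H1.
  change (Cmod (lsum g G - t) < eps / 2)%R in H2. lra.
Qed.

(** The net of finite sums increases under inclusion, so its least upper bound is its limit. *)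
Lemma is_sum_nonneg {I} (f : I -> R) M : (forall x, (0 <= f x)%R) -> rbounded f M ->
  exists s : R, is_sum (fun x => RtoC (f x)) s.
Proof.
  intros Hf HM.
  destruct (completeness (fun y => exists l, NoDup l /\ y = rsum f l)) as [s [Hub Hlub]].
  - exists M; intros y [l [Nl ->]]; apply HM, Nl.
  - exists 0%R, nil; split; [constructor|reflexivity].
  - exists s; intros eps.
    assert (HF : exists F, NoDup F /\ (s - eps < rsum f F)%R).
    { apply NNPP; intros HN.
      assert (s <= s - eps)%R; [|generalize (cond_pos eps); lra].
      apply Hlub; intros y [l [Nl ->]].
      destruct (Rle_lt_dec (rsum f l) (s - eps)); auto.
      exfalso; apply HN; eauto. }
    destruct HF as [F [NF HF]]. exists F; intros G NG IG.
    assert (E : fold_right Cplus 0 (map (fun x => RtoC (f x)) G) = RtoC (rsum f G)).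
    { unfold rsum; clear; induction G as [|x G IH]; simpl; [reflexivity|].
      rewrite IH, RtoC_plus; reflexivity. }
    rewrite E, <- RtoC_minus, Cmod_R.
    assert (L1 := rsum_incl f F G Hf NF NG IG).
    assert (L2 : (rsum f G <= s)%R) by (apply Hub; eauto).
    rewrite Rabs_left1; lra.
Qed.

Lemma rbounded_le {I} (f g : I -> R) M :
  (forall x, (f x <= g x)%R) -> rbounded g M -> rbounded f M.
Proof.
  intros H HM l Nl. eapply Rle_trans; [apply rsum_le; intros; apply H|apply HM, Nl].
Qed.

(** Four nonnegative families suffice: the positive and negative parts of the real and imaginary
    parts, each dominated by the modulus. *)
Lemma summable_is_sum {I} (f : I -> C) : summable f -> is_sum f (usum f).
Proof.
  intros [M HM]. unfold usum; apply epsilon_spec.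
  assert (Hpart : forall g : I -> R, (forall x, Rabs (g x) <= Cmod (f x))%R ->
    exists s : C, is_sum (fun x => RtoC (g x)) s).
  { intros g Hg.
    destruct (is_sum_nonneg (fun x => Rmax (g x) 0) M) as [s Hs].
    { intros x; apply Rmax_r. }
    { eapply rbounded_le; [|exact HM]. intros x; apply Rmax_lub; [|apply Cmod_ge_0].
      eapply Rle_trans; [apply Rle_abs|apply Hg]. }
    destruct (is_sum_nonneg (fun x => Rmax (- g x) 0) M) as [t Ht].
    { intros x; apply Rmax_r. }
    { eapply rbounded_le; [|exact HM]. intros x; apply Rmax_lub; [|apply Cmod_ge_0].
      eapply Rle_trans; [apply Rle_abs|]. rewrite Rabs_Ropp; apply Hg. }
    exists (RtoC s + -1 * RtoC t).
    replace (fun x => RtoC (g x)) with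
      (fun x => RtoC (Rmax (g x) 0) + -1 * RtoC (Rmax (- g x) 0)).
    - apply is_sum_plus; [assumption|now apply is_sum_scal].
    - extensionality x. rewrite <- RtoC_mult, <- RtoC_plus. f_equal.
      unfold Rmax; destruct (Rle_dec (g x) 0), (Rle_dec (- g x) 0); lra. }
  destruct (Hpart (fun x => Re (f x))) as [s Hs]; [intros; apply re_le_Cmod|].
  destruct (Hpart (fun x => Im (f x))) as [t Ht].
  { intros x. eapply Rle_trans; [|apply Rmax_Cmod]. apply Rmax_r. }
  exists (s + Ci * t).
  replace f with (fun x => RtoC (Re (f x)) + Ci * RtoC (Im (f x))).
  - apply is_sum_plus; [assumption|now apply is_sum_scal].
  - extensionality x. destruct (f x) as [a b]. unfold Ci, RtoC, Cmult, Cplus; simpl.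
    f_equal; ring.
Qed.

Lemma summable_scal {I} (f : I -> C) c : summable f -> summable (fun x => c * f x).
Proof.
  intros [M HM]. exists (Cmod c * M)%R; intros l Nl.
  rewrite (rsum_ext _ (fun x => (Cmod c * Cmod (f x))%R)).
  - rewrite rsum_scal. apply Rmult_le_compat_l; [apply Cmod_ge_0|auto].
  - intros; apply Cmod_mult.
Qed.

Lemma summable_plus {I} (f g : I -> C) :
  summable f -> summable g -> summable (fun x => f x + g x).
Proof.
  intros [M HM] [N HN]. exists (M + N)%R; intros l Nl.
  eapply Rle_trans; [apply rsum_le; intros; apply Cmod_triangle|].
  rewrite rsum_plus. apply Rplus_le_compat; auto.
Qed.

Lemma summable_le {I} (f g : I -> C) :
  (forall x, Cmod (f x) <= Cmod (g x))%R -> summable g -> summable f.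
Proof.
  intros H [M HM]; exists M. eapply rbounded_le; [exact H|exact HM].
Qed.

Lemma usum_ext {I} (f g : I -> C) : (forall x, f x = g x) -> usum f = usum g.
Proof. intros H; f_equal; extensionality x; apply H. Qed.

Lemma summable_ext {I} (f g : I -> C) : (forall x, f x = g x) -> summable f -> summable g.
Proof. intros H; replace g with f; [auto|extensionality x; apply H]. Qed.

Lemma usum_scal {I} (f : I -> C) c : summable f -> usum (fun x => c * f x) = c * usum f.
Proof. intros H; apply usum_eq, is_sum_scal, summable_is_sum, H. Qed.

Lemma usum_plus {I} (f g : I -> C) : summable f -> summable g ->
  usum (fun x => f x + g x) = usum f + usum g.
Proof. intros; apply usum_eq, is_sum_plus; now apply summable_is_sum. Qed.

Lemma summable_minus {I} (f g : I -> C) :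
  summable f -> summable g -> summable (fun x => f x - g x).
Proof.
  intros Hf Hg. apply (summable_ext (fun x => f x + -1 * g x)); [intros; ring|].
  apply summable_plus; [assumption|now apply summable_scal].
Qed.

Lemma usum_minus {I} (f g : I -> C) : summable f -> summable g ->
  usum (fun x => f x - g x) = usum f - usum g.
Proof.
  intros Hf Hg. rewrite (usum_ext _ (fun x => f x + -1 * g x)); [|intros; ring].
  rewrite usum_plus, usum_scal; auto; [ring|now apply summable_scal].
Qed.

Lemma Cmod_usum_le {I} (f : I -> C) M :
  rbounded (fun x => Cmod (f x)) M -> (Cmod (usum f) <= M)%R.
Proof.
  intros HM. apply le_epsilon; intros e He.
  destruct (summable_is_sum f (ex_intro _ M HM) (mkposreal e He)) as [F HF].
  set (G := nodup eq_dec_classic F).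
  assert (H : (Cmod (lsum f G - usum f) < e)%R).
  { apply HF; [apply NoDup_nodup|]. intros x Hx; apply nodup_In, Hx. }
  replace (usum f) with (lsum f G + - (lsum f G - usum f)) by ring.
  eapply Rle_trans; [apply Cmod_triangle|]. rewrite Cmod_opp.
  assert (H2 := Cmod_lsum f G). assert (H3 := HM G (NoDup_nodup _ _)). simpl in *. lra.
Qed.

Lemma usum_zero {I} (f : I -> C) : (forall x, f x = 0) -> usum f = 0.
Proof.
  intros H. apply usum_eq. intros eps; exists nil; intros G _ _.
  change (Cmod (lsum f G - 0) < eps)%R.
  replace (lsum f G) with (0 : C).
  - replace (0 - 0 : C) with (0 : C) by ring. rewrite Cmod_0; apply eps.
  - unfold lsum; induction G as [|x G IH]; simpl; [reflexivity|].
    rewrite <- IH, H; ring.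
Qed.

(** * Reindexing along injections, iterated sums, products of sums *)

Lemma preimage_list {I J} (g : I -> J) (G : list J) :
  (forall x y, g x = g y -> x = y) -> NoDup G ->
  exists L M, Permutation G (map g L ++ M) /\ NoDup L /\
    forall y, In y M -> forall x, g x <> y.
Proof.
  intros Hg; induction 1 as [|y G Hy NG [L [M [HP [NL HM]]]]].
  - exists nil, nil; repeat split; [constructor|constructor|intros ? []].
  - destruct (excluded_middle_informative (exists x, g x = y)) as [[x <-]|Hn].
    + exists (x :: L), M; repeat split.
      * simpl; now constructor.
      * constructor; [|assumption]. intros Hx; apply Hy.
        eapply Permutation_in; [symmetry; exact HP|]. apply in_or_app; left.
        now apply in_map.
      * assumption.
    + exists L, (y :: M); repeat split.
      * etransitivity; [constructor; exact HP|]. apply Permutation_middle.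
      * assumption.
      * intros z [<-|Hz]; [|auto]. intros x Hx; apply Hn; eauto.
Qed.

Lemma lsum_zero {I} (f : I -> C) l : (forall x, In x l -> f x = 0) -> lsum f l = 0.
Proof.
  intros H; rewrite (lsum_ext f (fun _ => 0)) by assumption.
  unfold lsum; induction l as [|x l IH]; simpl; [reflexivity|].
  rewrite IH; [ring|]; intros; apply H; now right.
Qed.

(** As f vanishes off the image of g, a finite index set may be replaced by its preimage once its
    image part is permuted to the front. *)
Lemma is_sum_reindex {I J} (g : I -> J) (f : J -> C) s :
  (forall x y, g x = g y -> x = y) -> (forall y, (forall x, g x <> y) -> f y = 0) ->
  is_sum (fun x => f (g x)) s -> is_sum f s.
Proof.
  intros Hg H0 Hs eps. destruct (Hs eps) as [F HF].
  exists (map g F); intros G NG IG.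
  destruct (preimage_list g G Hg NG) as [L [M [HP [NL HM]]]].
  change (Cmod (lsum f G - s) < eps)%R.
  rewrite (lsum_perm _ _ _ HP), lsum_app, lsum_map, (lsum_zero f M) by auto.
  rewrite Cplus_0_r. apply HF; [assumption|].
  intros x Hx. assert (H1 : In (g x) G) by (apply IG, in_map, Hx).
  eapply Permutation_in in H1; [|exact HP]. apply in_app_or in H1 as [H1|H1].
  - apply in_map_iff in H1 as [x' [E Hx']]. apply Hg in E; now subst.
  - exfalso; eapply HM; eauto.
Qed.

Lemma summable_comp {I J} (g : I -> J) (f : J -> C) :
  (forall x y, g x = g y -> x = y) -> summable f -> summable (fun x => f (g x)).
Proof.
  intros Hg [M HM]; exists M; intros l Nl.
  rewrite <- (rsum_map g (fun y => Cmod (f y))). apply HM.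
  clear - Hg Nl. induction Nl; simpl; constructor; auto.
  intros H1; apply in_map_iff in H1 as [x' [E Hx']]. apply Hg in E; now subst.
Qed.

Lemma summable_reindex {I J} (g : I -> J) (f : J -> C) :
  (forall x y, g x = g y -> x = y) -> (forall y, (forall x, g x <> y) -> f y = 0) ->
  summable (fun x => f (g x)) -> summable f.
Proof.
  intros Hg H0 [M HM]; exists M; intros G NG.
  destruct (preimage_list g G Hg NG) as [L [N [HP [NL HN]]]].
  rewrite (rsum_perm _ _ _ HP), rsum_app, rsum_map.
  assert (E : rsum (fun x => Cmod (f x)) N = 0%R).
  { clear - H0 HN. unfold rsum. induction N as [|y N IH]; simpl; [reflexivity|].
    rewrite IH, H0, Cmod_0; [ring|apply HN; now left|]. intros; apply HN; now right. }
  rewrite E, Rplus_0_r. apply HM, NL.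
Qed.

Lemma usum_reindex {I J} (g : I -> J) (f : J -> C) :
  (forall x y, g x = g y -> x = y) -> (forall y, (forall x, g x <> y) -> f y = 0) ->
  summable f -> usum f = usum (fun x => f (g x)).
Proof.
  intros Hg H0 Hf. apply usum_eq, (is_sum_reindex g); auto.
  now apply summable_is_sum, summable_comp.
Qed.

Lemma usum_bij {I J} (g : I -> J) (h : J -> I) (f : J -> C) :
  (forall x, h (g x) = x) -> (forall y, g (h y) = y) ->
  summable f -> usum f = usum (fun x => f (g x)).
Proof.
  intros H1 H2 Hf. apply usum_reindex; [| |assumption].
  - intros x y E; rewrite <- (H1 x), <- (H1 y), E; reflexivity.
  - intros y Hy; exfalso; apply (Hy (h y)), H2.
Qed.

Lemma is_sum_list {I} (f : I -> C) s F (eps : posreal) : is_sum f s ->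
  exists G, NoDup G /\ incl F G /\ (Cmod (lsum f G - s) < eps)%R.
Proof.
  intros H; destruct (H eps) as [F' HF].
  exists (nodup eq_dec_classic (F ++ F')); split; [apply NoDup_nodup|]; split.
  - intros x Hx; apply nodup_In, in_or_app; auto.
  - apply HF; [apply NoDup_nodup|]. intros x Hx; apply nodup_In, in_or_app; auto.
Qed.

(** Fubini for nets. Over a finite set A of first coordinates a finite set of pairs is built that
    contains the part of F above A and nearly realises every fibre sum; each fibre uses half of the
    remaining error. *)
Lemma is_sum_fst {I J} (f : I * J -> C) s (S : I -> C) :
  is_sum f s -> (forall i, is_sum (fun j => f (i, j)) (S i)) -> is_sum S s.
Proof.
  intros Hf HS eps.
  assert (He : (0 < eps / 2)%R) by (generalize (cond_pos eps); lra).
  destruct (Hf (mkposreal _ He)) as [F HF]; simpl in HF.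
  exists (map fst F); intros A NA IA.
  assert (HG : forall A, NoDup A -> forall d, (0 < d)%R -> exists G, NoDup G /\
     (forall x, In x G -> In (fst x) A) /\
     (forall x, In x F -> In (fst x) A -> In x G) /\
     (Cmod (lsum f G - lsum S A) < d)%R).
  { clear A NA IA. intros A NA; induction NA as [|i A Hi NA IH]; intros d Hd.
    - exists nil; repeat split; simpl; try (constructor || tauto).
      unfold lsum; simpl. replace (0 - 0 : C) with (0 : C) by ring.
      rewrite Cmod_0; lra.
    - assert (Hd2 : (0 < d / 2)%R) by lra.
      destruct (IH _ Hd2) as [G [NG [G1 [G2 G3]]]].
      destruct (is_sum_list (fun j => f (i, j)) (S i)
        (map snd F) (mkposreal _ Hd2) (HS i)) as [L [NL [IL HL]]]; simpl in HL.
      exists (map (pair i) L ++ G); repeat split.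
      + apply NoDup_app; auto.
        * clear - NL; induction NL; simpl; constructor; auto.
          intros H1; apply in_map_iff in H1 as [x' [E Hx']]; inversion E; now subst.
        * intros x Hx Hx'. apply in_map_iff in Hx as [j [<- _]].
          apply G1 in Hx'; simpl in Hx'; contradiction.
      + intros x Hx. apply in_app_or in Hx as [Hx|Hx]; [left|right; auto].
        apply in_map_iff in Hx as [j [<- _]]; reflexivity.
      + intros [i' j] Hx [E|Hx']; apply in_or_app; simpl in *.
        * subst i'; left. apply in_map, IL. apply in_map_iff; exists (i, j); auto.
        * right; apply G2; auto.
      + rewrite lsum_app, lsum_map. change (lsum S (i :: A)) with (S i + lsum S A).
        match goal with |- (Cmod ?z < _)%R => replace z with
          ((lsum (fun j => f (i, j)) L - S i) + (lsum f G - lsum S A)) by ring end.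
        eapply Rle_lt_trans; [apply Cmod_triangle|]; lra. }
  destruct (HG A NA _ He) as [G [NG [_ [G2 G3]]]].
  assert (H1 : (Cmod (lsum f G - s) < eps / 2)%R).
  { apply HF; [assumption|]. intros x Hx. apply G2; [assumption|]. apply IA, in_map, Hx. }
  change (Cmod (lsum S A - s) < eps)%R.
  replace (lsum S A - s) with (- (lsum f G - lsum S A) + (lsum f G - s)) by ring.
  eapply Rle_lt_trans; [apply Cmod_triangle|]. rewrite Cmod_opp; lra.
Qed.

Lemma summable_slice {I J} (f : I * J -> C) i : summable f -> summable (fun j => f (i, j)).
Proof. apply summable_comp with (g := pair i). congruence. Qed.

Lemma is_sum_usum_fst {I J} (f : I * J -> C) : summable f ->
  is_sum (fun i => usum (fun j => f (i, j))) (usum f).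
Proof.
  intros H. apply (is_sum_fst f); [now apply summable_is_sum|].
  intros i; now apply summable_is_sum, summable_slice.
Qed.

Lemma usum_fst {I J} (f : I * J -> C) : summable f ->
  usum f = usum (fun i => usum (fun j => f (i, j))).
Proof. intros H; symmetry; apply usum_eq, is_sum_usum_fst, H. Qed.

(** The existential bound in [summable] can be taken to be the sum of the moduli itself; a definite
    bound per fibre is needed when the bounds are summed in turn. *)
Lemma usum_Cmod {I} (f : I -> C) : summable f ->
  rbounded (fun x => Cmod (f x)) (Re (usum (fun x => RtoC (Cmod (f x))))).
Proof.
  intros [M HM] l Nl. destruct (is_sum_nonneg (fun x => Cmod (f x)) M) as [s Hs];
    [intros; apply Cmod_ge_0|assumption|].
  rewrite (usum_eq _ _ Hs). simpl. apply le_epsilon; intros e He.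
  destruct (is_sum_list _ _ l (mkposreal e He) Hs) as [G [NG [IG HG]]]; simpl in HG.
  assert (E : lsum (fun x => RtoC (Cmod (f x))) G = RtoC (rsum (fun x => Cmod (f x)) G)).
  { unfold lsum, rsum; clear; induction G as [|x G IH]; simpl; [reflexivity|].
    rewrite IH, RtoC_plus; reflexivity. }
  rewrite E, <- RtoC_minus, Cmod_R in HG. apply Rabs_def2 in HG.
  assert (L := rsum_incl (fun x => Cmod (f x)) l G (fun x => Cmod_ge_0 _) Nl NG IG). simpl in L.
  lra.
Qed.

Lemma summable_fst {I J} (f : I * J -> C) : summable f ->
  summable (fun i => usum (fun j => f (i, j))).
Proof.
  intros H.
  assert (H' : summable (fun x => RtoC (Cmod (f x)))).
  { apply (summable_le _ f); [|assumption]. intros x; rewrite Cmod_R, Rabs_pos_eq;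
    [lra|apply Cmod_ge_0]. }
  exists (Re (usum (fun x => RtoC (Cmod (f x))))).
  assert (Hs := is_sum_usum_fst _ H').
  assert (Hpos : forall i, exists s : R, (0 <= s)%R /\
    usum (fun j => RtoC (Cmod (f (i, j)))) = s /\ (Cmod (usum (fun j => f (i, j))) <= s)%R).
  { intros i. destruct (summable_slice f i H) as [M HM].
    assert (HB := usum_Cmod (fun j => f (i, j)) (ex_intro _ M HM)).
    destruct (is_sum_nonneg (fun j => Cmod (f (i, j))) M) as [s Hs'];
      [intros; apply Cmod_ge_0|assumption|].
    cbv beta in HB. rewrite (usum_eq _ _ Hs') in HB |- *. simpl in HB.
    exists s; repeat split; auto.
    - apply (HB nil); constructor.
    - apply Cmod_usum_le, HB. }
  intros l Nl. apply le_epsilon; intros e He.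
  destruct (is_sum_list _ _ l (mkposreal e He) Hs) as [G [NG [IG HG]]]; simpl in HG.
  assert (L1 : forall G, lsum (fun i => usum (fun j => RtoC (Cmod (f (i, j))))) G =
    RtoC (rsum (fun i => Re (usum (fun j => RtoC (Cmod (f (i, j)))))) G)).
  { clear - Hpos; unfold lsum, rsum; induction G as [|i G IH]; simpl; [reflexivity|].
    rewrite IH, RtoC_plus. f_equal. destruct (Hpos i) as [s [_ [-> _]]]; reflexivity. }
  rewrite L1 in HG.
  set (u := usum (fun x => RtoC (Cmod (f x)))) in *.
  set (r := rsum (fun i => Re (usum (fun j => RtoC (Cmod (f (i, j)))))) G) in *.
  assert (HG' : (Rabs (r - Re u) < e)%R).
  { eapply Rle_lt_trans; [|exact HG].
    replace (r - Re u)%R with (Re (RtoC r - u)); [apply re_le_Cmod|].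
    generalize r u; intros r' [u1 u2]; simpl; ring. }
  apply Rabs_def2 in HG'.
  assert (L2 : (rsum (fun i => Cmod (usum (fun j => f (i, j)))) l <=
    rsum (fun i => Re (usum (fun j => RtoC (Cmod (f (i, j)))))) l)%R).
  { apply rsum_le; intros i _. destruct (Hpos i) as [s [_ [-> ?]]]; simpl; lra. }
  assert (L3 : (rsum (fun i => Re (usum (fun j => RtoC (Cmod (f (i, j)))))) l <= r)%R).
  { apply rsum_incl; auto. intros i; destruct (Hpos i) as [s [? [-> ?]]]; simpl; lra. }
  lra.
Qed.

Lemma rsum_fibre {I J} (f : I * J -> R) A : NoDup A -> forall G,
  NoDup G -> (forall x, In x G -> In (fst x) A) ->
  exists L : I -> list J, (forall i, NoDup (L i)) /\
    rsum f G = rsum (fun i => rsum (fun j => f (i, j)) (L i)) A.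
Proof.
  induction 1 as [|i A Hi NA IH]; intros G NG HG.
  - exists (fun _ => nil); split; [constructor|].
    destruct G as [|x G]; [reflexivity|]. destruct (HG x); now left.
  - destruct (preimage_list (pair i) G) as [L [M [HP [NL HM]]]]; [congruence|assumption|].
    assert (NM : NoDup M).
    { apply (Permutation_NoDup HP) in NG. now apply NoDup_app_remove_l in NG. }
    destruct (IH M NM) as [K [NK HK]].
    { intros [i' j] Hx. assert (Hx' := Hx).
      assert (HxG : In (i', j) G).
      { eapply Permutation_in; [symmetry; exact HP|]. apply in_or_app; auto. }
      destruct (HG _ HxG) as [E|?]; [|assumption]. simpl in E; subst i'.
      destruct (HM _ Hx j); reflexivity. }
    exists (fun i' => if eq_dec_classic i' i then L else K i'); split.
    + intros i'; destruct (eq_dec_classic i' i); auto.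
    + rewrite (rsum_perm _ _ _ HP), rsum_app, rsum_map, HK.
      match goal with |- _ = rsum ?h (i :: A) => change (rsum h (i :: A)) with (h i + rsum h A)%R end.
      cbv beta. destruct (eq_dec_classic i i) as [_|?]; [|contradiction].
      f_equal. apply rsum_ext. intros i' Hi'. destruct (eq_dec_classic i' i); [|reflexivity].
      subst; contradiction.
Qed.

(** Tonelli: pairs are grouped by first coordinate, each group is bounded by B and the sum of the
    bounds by M. *)
Lemma summable_prod {I J} (f : I * J -> C) (B : I -> R) M :
  (forall i, rbounded (fun j => Cmod (f (i, j))) (B i)) -> rbounded B M -> summable f.
Proof.
  intros HB HM; exists M; intros G NG.
  destruct (rsum_fibre (fun x => Cmod (f x)) (nodup eq_dec_classic (map fst G))
    (NoDup_nodup _ _) G NG) as [L [NL ->]].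
  { intros x Hx; apply nodup_In, in_map, Hx. }
  eapply Rle_trans; [|apply HM, (NoDup_nodup eq_dec_classic (map fst G))].
  apply rsum_le; intros i _. apply HB, NL.
Qed.

Lemma summable_mult {I J} (f : I -> C) (g : J -> C) : summable f -> summable g ->
  summable (fun x => f (fst x) * g (snd x)).
Proof.
  intros [M HM] [N HN].
  assert (N0 : (0 <= N)%R) by (apply (HN nil); constructor).
  apply (summable_prod _ (fun i => (N * Cmod (f i))%R) (N * M)).
  - intros i l Nl; simpl.
    rewrite (rsum_ext _ (fun j => (Cmod (f i) * Cmod (g j))%R)) by (intros; apply Cmod_mult).
    rewrite rsum_scal. generalize (HN l Nl), (Cmod_ge_0 (f i)); simpl; nra.
  - intros l Nl. rewrite rsum_scal. apply Rmult_le_compat_l; [assumption|apply HM, Nl].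
Qed.

Lemma usum_mult {I J} (f : I -> C) (g : J -> C) : summable f -> summable g ->
  usum (fun x => f (fst x) * g (snd x)) = usum f * usum g.
Proof.
  intros Hf Hg. rewrite usum_fst by now apply summable_mult. simpl.
  rewrite (usum_ext _ (fun i => usum g * f i)).
  - rewrite usum_scal by assumption; ring.
  - intros i. rewrite usum_scal by assumption; ring.
Qed.

Definition swap {I J : Type} (x : I * J) : J * I := (snd x, fst x).

Lemma summable_swap {I J} (f : I * J -> C) : summable f -> summable (fun x => f (swap x)).
Proof. apply summable_comp. intros [a b] [c d] E; inversion E; now subst. Qed.

Lemma usum_snd {I J} (f : I * J -> C) : summable f ->
  usum f = usum (fun j => usum (fun i => f (i, j))).
Proof.
  intros H. rewrite (usum_bij swap swap f); [|intros []; reflexivity|intros []; reflexivity|assumption].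
  rewrite usum_fst by now apply summable_swap. reflexivity.
Qed.

Lemma summable_snd {I J} (f : I * J -> C) : summable f ->
  summable (fun j => usum (fun i => f (i, j))).
Proof. intros H. apply (summable_fst _ (summable_swap _ H)). Qed.

(** * Limits of sequences and dominated convergence *)

Definition clim (u : nat -> C) (l : C) : Prop :=
  forall e : R, (0 < e)%R -> exists N, forall n, (N <= n)%nat -> (Cmod (u n - l) < e)%R.

Lemma clim_unique u l m : clim u l -> clim u m -> l = m.
Proof.
  intros Hl Hm.
  assert (E : Cmod (l - m) = 0%R).
  { apply Rle_antisym; [|apply Cmod_ge_0]. apply le_epsilon; intros e He.
    destruct (Hl (e / 2)%R) as [N1 H1]; [lra|]. destruct (Hm (e / 2)%R) as [N2 H2]; [lra|].
    specialize (H1 (N1 + N2)%nat ltac:(lia)); specialize (H2 (N1 + N2)%nat ltac:(lia)).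
    replace (l - m) with (- (u (N1 + N2)%nat - l) + (u (N1 + N2)%nat - m)) by ring.
    eapply Rle_trans; [apply Cmod_triangle|]. rewrite Cmod_opp; lra. }
  apply Cmod_eq_0 in E. replace l with (l - m + m) by ring; rewrite E; ring.
Qed.

Lemma clim_const l : clim (fun _ => l) l.
Proof.
  intros e He; exists 0%nat; intros. replace (l - l) with (0 : C) by ring. rewrite Cmod_0; lra.
Qed.

Lemma clim_ext u v l : (forall n, u n = v n) -> clim u l -> clim v l.
Proof.
  intros H Hu e He; destruct (Hu e He) as [N HN]; exists N; intros; rewrite <- H; auto.
Qed.

Lemma clim_mult u v l m : clim u l -> clim v m -> clim (fun n => u n * v n) (l * m).
Proof.
  intros Hu Hv e He.
  set (K := (Cmod l + Cmod m + 1)%R).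
  assert (HK : (1 <= K)%R) by (unfold K; generalize (Cmod_ge_0 l), (Cmod_ge_0 m); lra).
  assert (Hd : (0 < Rmin 1 (e / (2 * K)))%R).
  { apply Rmin_glb_lt; [lra|]. apply Rdiv_lt_0_compat; lra. }
  destruct (Hu _ Hd) as [N1 H1], (Hv _ Hd) as [N2 H2].
  exists (N1 + N2)%nat; intros n Hn.
  specialize (H1 n ltac:(lia)); specialize (H2 n ltac:(lia)).
  assert (L1 := Rmin_l 1 (e / (2 * K))). assert (L2 := Rmin_r 1 (e / (2 * K))).
  set (d := Rmin 1 (e / (2 * K))) in *.
  replace (u n * v n - l * m) with ((u n - l) * (v n - m) + (l * (v n - m) + (u n - l) * m)) by ring.
  eapply Rle_lt_trans; [apply Cmod_triangle|].
  eapply Rle_lt_trans; [apply Rplus_le_compat_l, Cmod_triangle|].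
  rewrite !Cmod_mult.
  assert (Hd' : (d * (2 * K) <= e)%R).
  { replace e with (e / (2 * K) * (2 * K))%R by (field; lra). apply Rmult_le_compat_r; lra. }
  generalize (Cmod_ge_0 l), (Cmod_ge_0 m), (Cmod_ge_0 (u n - l)), (Cmod_ge_0 (v n - m)).
  intros. assert (Cmod (u n - l) * Cmod (v n - m) <= d * 1)%R by (apply Rmult_le_compat; lra).
  assert (Cmod l * Cmod (v n - m) <= Cmod l * d)%R by (apply Rmult_le_compat_l; lra).
  assert (Cmod (u n - l) * Cmod m <= d * Cmod m)%R by (apply Rmult_le_compat_r; lra).
  unfold K in *. nra.
Qed.

Lemma clim_plus u v l m : clim u l -> clim v m -> clim (fun n => u n + v n) (l + m).
Proof.
  intros Hu Hv e He.
  destruct (Hu (e / 2)%R) as [N1 H1]; [lra|]. destruct (Hv (e / 2)%R) as [N2 H2]; [lra|].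
  exists (N1 + N2)%nat; intros n Hn.
  specialize (H1 n ltac:(lia)); specialize (H2 n ltac:(lia)).
  replace (u n + v n - (l + m)) with ((u n - l) + (v n - m)) by ring.
  eapply Rle_lt_trans; [apply Cmod_triangle|]; lra.
Qed.

Lemma rbounded_tail {I} (g : I -> R) M (e : R) : (0 < e)%R -> (forall x, (0 <= g x)%R) ->
  rbounded g M -> exists F, NoDup F /\
    forall G, NoDup (F ++ G) -> (rsum g G < e)%R.
Proof.
  intros He Hg HM.
  destruct (is_sum_nonneg g M Hg HM) as [s Hs].
  assert (He2 : (0 < e / 2)%R) by lra.
  destruct (Hs (mkposreal _ He2)) as [F HF]; simpl in HF.
  exists (nodup eq_dec_classic F); split; [apply NoDup_nodup|].
  intros G NG. set (F' := nodup eq_dec_classic F) in *.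
  assert (H1 : (Cmod (lsum (fun x => RtoC (g x)) F' - s) < e / 2)%R).
  { apply HF; [apply NoDup_nodup|intros x Hx; apply nodup_In, Hx]. }
  assert (H2 : (Cmod (lsum (fun x => RtoC (g x)) (F' ++ G) - s) < e / 2)%R).
  { apply HF; [assumption|intros x Hx; apply in_or_app; left; apply nodup_In, Hx]. }
  assert (E : forall L, lsum (fun x => RtoC (g x)) L = RtoC (rsum g L)).
  { clear; unfold lsum, rsum; induction L as [|x L IH]; simpl; [reflexivity|].
    rewrite IH, RtoC_plus; reflexivity. }
  rewrite E, <- RtoC_minus, Cmod_R in H1, H2. rewrite rsum_app in H2.
  apply Rabs_def2 in H1, H2. lra.
Qed.

Lemma Cmod_usum_minus_lsum {I} (f : I -> C) (g : I -> R) M F e :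
  (forall x, Cmod (f x) <= g x)%R -> rbounded g M -> NoDup F -> (0 < e)%R ->
  (forall G, NoDup (F ++ G) -> (rsum g G < e)%R) ->
  (Cmod (usum f - lsum f F) <= 2 * e)%R.
Proof.
  intros Hfg HM NF He HF.
  assert (Hs : summable f) by (exists M; eapply rbounded_le; [exact Hfg|exact HM]).
  destruct (is_sum_list f _ F (mkposreal e He) (summable_is_sum f Hs)) as [G [NG [IG HG]]].
  destruct (incl_split F G NF NG IG) as [H [HP HN]].
  rewrite (lsum_perm _ _ _ HP), lsum_app in HG; simpl in HG.
  replace (usum f - lsum f F) with (- (lsum f F + lsum f H - usum f) + lsum f H) by ring.
  eapply Rle_trans; [apply Cmod_triangle|]. rewrite Cmod_opp.
  assert (Cmod (lsum f H) <= rsum g H)%R.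
  { eapply Rle_trans; [apply Cmod_lsum|]. apply rsum_le; auto. }
  specialize (HF H HN). lra.
Qed.

Lemma clim_lsum {I} (f : nat -> I -> C) (f0 : I -> C) F :
  (forall x, clim (fun n => f n x) (f0 x)) -> clim (fun n => lsum (f n) F) (lsum f0 F).
Proof.
  intros H; induction F as [|x F IH].
  - exact (clim_const 0).
  - exact (clim_plus _ _ _ _ (H x) IH).
Qed.

(** One finite set F carries all of the majorant up to e/8, hence controls the tails of every f n
    and of the limit at once; on F convergence is termwise. All interchanges of limit and sum below
    rest on this. *)
Lemma usum_dominated {I} (f : nat -> I -> C) (f0 : I -> C) (g : I -> R) M :
  (forall n x, Cmod (f n x) <= g x)%R -> rbounded g M ->
  (forall x, clim (fun n => f n x) (f0 x)) -> clim (fun n => usum (f n)) (usum f0).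
Proof.
  intros Hfg HM Hl.
  assert (Hg : forall x, (0 <= g x)%R).
  { intros x; eapply Rle_trans; [apply (Cmod_ge_0 (f 0%nat x))|apply Hfg]. }
  assert (Hf0 : forall x, (Cmod (f0 x) <= g x)%R).
  { intros x; apply le_epsilon; intros e He. destruct (Hl x e He) as [N HN].
    specialize (HN N (le_n _)).
    replace (f0 x) with (f N x + - (f N x - f0 x)) by ring.
    eapply Rle_trans; [apply Cmod_triangle|]. rewrite Cmod_opp.
    specialize (Hfg N x); lra. }
  intros e He. destruct (rbounded_tail g M (e / 8) ltac:(lra) Hg HM) as [F [NF HF]].
  destruct (clim_lsum f f0 F Hl (e / 4)%R) as [N HN]; [lra|].
  exists N; intros n Hn; specialize (HN n Hn).
  assert (A1 := Cmod_usum_minus_lsum (f n) g M F (e / 8) (Hfg n) HM NF ltac:(lra) HF).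
  assert (A2 := Cmod_usum_minus_lsum f0 g M F (e / 8) Hf0 HM NF ltac:(lra) HF).
  replace (usum (f n) - usum f0) with
    ((usum (f n) - lsum (f n) F) + ((lsum (f n) F - lsum f0 F) + - (usum f0 - lsum f0 F))) by ring.
  eapply Rle_lt_trans; [apply Cmod_triangle|].
  eapply Rle_lt_trans; [apply Rplus_le_compat_l, Cmod_triangle|]. rewrite Cmod_opp. lra.
Qed.

(** * Integer powers, bounds, and Euler's product *)

Lemma is_sum_single {I} (f : I -> C) a : (forall x, x <> a -> f x = 0) -> is_sum f (f a).
Proof.
  intros H eps; exists (a :: nil); intros G NG IG.
  destruct (incl_split (a :: nil) G) as [K [HP HN]]; auto.
  { constructor; [intros []|constructor]. }
  change (Cmod (lsum f G - f a) < eps)%R.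
  rewrite (lsum_perm _ _ _ HP), lsum_app, (lsum_zero f K).
  - unfold lsum; simpl. replace (f a + 0 + 0 - f a) with (0 : C) by ring.
    rewrite Cmod_0; apply eps.
  - intros x Hx; apply H; intros ->. simpl in HN; inversion HN; contradiction.
Qed.

Lemma usum_single {I} (f : I -> C) a : (forall x, x <> a -> f x = 0) -> usum f = f a.
Proof. intros H; now apply usum_eq, is_sum_single. Qed.

Lemma summable_geom (q : C) : (Cmod q < 1)%R -> summable (fun n : nat => q ^ n).
Proof.
  intros Hq. assert (H0 := Cmod_ge_0 q). exists (/ (1 - Cmod q))%R; intros l Nl.
  set (m := S (list_max l)).
  apply Rle_trans with (rsum (fun n => (Cmod q ^ n)%R) (seq 0 m)).
  - rewrite (rsum_ext _ (fun n => (Cmod q ^ n)%R)) by (intros; apply Cmod_pow).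
    apply rsum_incl; auto.
    + intros; now apply pow_le.
    + apply seq_NoDup.
    + intros n Hn. apply in_seq. assert (n <= list_max l)%nat; [|unfold m; lia].
      assert (HF := proj1 (list_max_le l (list_max l)) (le_n _)).
      rewrite Forall_forall in HF; auto.
  - assert (E : forall m, ((1 - Cmod q) * rsum (fun n => (Cmod q ^ n)%R) (seq 0 m) = 1 - Cmod q ^ m)%R).
    { clear; induction m as [|m IH].
      - unfold rsum; simpl; ring.
      - rewrite seq_S, rsum_app, Rmult_plus_distr_l, IH. unfold rsum; simpl; ring. }
    specialize (E m). assert (0 <= Cmod q ^ m)%R by now apply pow_le.
    apply Rmult_le_reg_l with (1 - Cmod q)%R; [lra|]. rewrite E, Rinv_r; lra.
Qed.

(** One of the two natural exponents is always 0. Since / 0 is 0 here, multiplicativity in the base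
    holds unconditionally, while additivity in the exponent asks for q <> 0. *)
Definition zp (q : C) (z : Z) : C := q ^ Z.to_nat z / q ^ Z.to_nat (- z).

Lemma zp_0 (q : C) : zp q 0 = 1.
Proof. unfold zp; simpl. field. Qed.

Lemma zp_nat (q : C) n : zp q (Z.of_nat n) = q ^ n.
Proof.
  unfold zp. rewrite Nat2Z.id. replace (Z.to_nat (- Z.of_nat n)) with 0%nat by lia.
  simpl; field.
Qed.

Lemma zp_pow (q : C) z : (0 <= z)%Z -> zp q z = q ^ Z.to_nat z.
Proof. intros H. rewrite <- (Z2Nat.id z H) at 1. apply zp_nat. Qed.

Lemma zp_1 (q : C) : zp q 1 = q.
Proof. change 1%Z with (Z.of_nat 1). rewrite zp_nat. simpl; ring. Qed.

Lemma zp_neq0 (q : C) z : q <> 0 -> zp q z <> 0.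
Proof.
  intros H; unfold zp. apply Cmult_neq_0; [now apply Cpow_nz|].
  intros E. assert (H' : q ^ Z.to_nat (- z) * / q ^ Z.to_nat (- z) = 1).
  { apply Cinv_r. now apply Cpow_nz. }
  rewrite E, Cmult_0_r in H'. apply C1_nz; auto.
Qed.

Lemma zp_succ (q : C) z : q <> 0 -> zp q (z + 1) = zp q z * q.
Proof.
  intros H. destruct (Z.le_gt_cases 0 z) as [Hz|Hz].
  - rewrite !zp_pow by lia. replace (Z.to_nat (z + 1)) with (S (Z.to_nat z)) by lia.
    rewrite Cpow_S; ring.
  - unfold zp. replace (Z.to_nat (- z)) with (S (Z.to_nat (- (z + 1)))) by lia.
    replace (Z.to_nat (z + 1)) with 0%nat by lia. replace (Z.to_nat z) with 0%nat by lia.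
    rewrite Cpow_S; simpl. field. split; auto. now apply Cpow_nz.
Qed.

Lemma zp_add (q : C) a b : q <> 0 -> zp q (a + b) = zp q a * zp q b.
Proof.
  intros H. revert b. apply (Z.peano_ind (fun b => zp q (a + b) = zp q a * zp q b)).
  - rewrite Z.add_0_r, zp_0; ring.
  - intros b IH. replace (a + Z.succ b)%Z with (a + b + 1)%Z by lia.
    rewrite zp_succ, IH by assumption. unfold Z.succ. rewrite zp_succ by assumption. ring.
  - intros b IH. apply (f_equal (fun x => x / q)) in IH.
    replace (a + b)%Z with (a + Z.pred b + 1)%Z in IH by lia.
    replace b with (Z.pred b + 1)%Z in IH at 2 by lia.
    rewrite !zp_succ in IH by assumption.
    transitivity (zp q (a + Z.pred b) * q / q); [field; assumption|].
    rewrite IH; field; assumption.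
Qed.

Lemma zp_opp (q : C) a : q <> 0 -> zp q (- a) = / zp q a.
Proof.
  intros H. assert (H1 : zp q (- a) * zp q a = 1).
  { rewrite <- zp_add by assumption. rewrite <- (zp_0 q); f_equal; lia. }
  assert (H2 := zp_neq0 q a H).
  transitivity (zp q (- a) * zp q a / zp q a); [field; assumption|]. rewrite H1; field; assumption.
Qed.

Lemma zp_mul (q : C) a b : q <> 0 -> zp (zp q a) b = zp q (a * b).
Proof.
  intros H. revert b. apply (Z.peano_ind (fun b => zp (zp q a) b = zp q (a * b))).
  - rewrite Z.mul_0_r, !zp_0; reflexivity.
  - intros b IH. unfold Z.succ. rewrite zp_succ, IH by now apply zp_neq0.
    rewrite <- zp_add by assumption. f_equal; lia.
  - intros b IH. replace b with (Z.pred b + 1)%Z in IH by lia.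
    rewrite zp_succ in IH by now apply zp_neq0.
    apply (f_equal (fun x => x / zp q a)) in IH.
    transitivity (zp (zp q a) (Z.pred b) * zp q a / zp q a); [field; now apply zp_neq0|].
    rewrite IH. unfold Cdiv. rewrite <- zp_opp, <- zp_add by assumption. f_equal; lia.
Qed.

Lemma Cinv_0 : / (0 : C) = 0.
Proof. unfold Cinv, RtoC; simpl. f_equal; unfold Rdiv; ring. Qed.

Lemma Cinv_mul (a b : C) : / (a * b) = / a * / b.
Proof.
  destruct (Ceq_dec a 0) as [->|Ha]; [rewrite Cmult_0_l, Cinv_0; ring|].
  destruct (Ceq_dec b 0) as [->|Hb]; [rewrite Cmult_0_r, Cinv_0; ring|].
  field; auto.
Qed.

Lemma zp_mult_l (a b : C) k : zp (a * b) k = zp a k * zp b k.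
Proof.
  unfold zp. rewrite !Cpow_mult_l. unfold Cdiv. rewrite Cinv_mul. ring.
Qed.

Lemma Cm1_neq0 : (-1 : C) <> 0.
Proof.
  intros E. apply (f_equal (fun x => x * -1)) in E. apply C1_nz.
  transitivity (-1 * -1); [ring|]. rewrite E; ring.
Qed.

Lemma zp_m1_even k : zp (-1) (2 * k) = 1.
Proof.
  rewrite <- zp_mul by apply Cm1_neq0. replace (zp (-1) 2) with (1 : C).
  - unfold zp. rewrite !Cpow_1_l. field.
  - rewrite zp_pow by lia. simpl; ring.
Qed.

Lemma zp_1_l k : zp 1 k = 1.
Proof. unfold zp; rewrite !Cpow_1_l; field. Qed.

Definition base (q : C) : Prop := q <> 0 /\ (Cmod q < 1)%R.

Lemma Cmod_pos (q : C) : base q -> (0 < Cmod q)%R.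
Proof. intros [H _]. now apply Cmod_gt_0. Qed.

Lemma base_pow (q : C) n : base q -> base (q ^ S n).
Proof.
  intros Hb. assert (Hp := Cmod_pos q Hb). destruct Hb as [H1 H2].
  split; [now apply Cpow_nz|]. rewrite Cmod_pow. apply Rle_lt_trans with (Cmod q); [|assumption].
  assert (Cmod q ^ n <= 1)%R.
  { rewrite <- (pow1 n). apply pow_incr; lra. }
  simpl; nra.
Qed.

Lemma base_opp (q : C) : base q -> base (- q).
Proof.
  intros [H1 H2]; split; [|now rewrite Cmod_opp].
  intros E; apply H1. replace q with (- - q) by ring. rewrite E; ring.
Qed.

Lemma Cmod_zp_le (q : C) a b : base q -> (a <= b)%Z -> (Cmod (zp q b) <= Cmod (zp q a))%R.
Proof.
  intros Hb Hab. destruct Hb as [H1 H2]. replace b with (a + (b - a))%Z by lia.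
  rewrite zp_add, Cmod_mult by assumption.
  assert (Cmod (zp q (b - a)) <= 1)%R.
  { rewrite zp_pow by lia. rewrite Cmod_pow, <- (pow1 (Z.to_nat (b - a))).
    apply pow_incr; split; [apply Cmod_ge_0|lra]. }
  generalize (Cmod_ge_0 (zp q a)); nra.
Qed.

Lemma Cmod_zp_le1 (q : C) a : base q -> (0 <= a)%Z -> (Cmod (zp q a) <= 1)%R.
Proof. intros Hb Ha. rewrite <- Cmod_1, <- (zp_0 q). now apply Cmod_zp_le. Qed.

Lemma summable_zp_abs (q : C) : base q -> summable (fun k => zp q (Z.abs k)).
Proof.
  intros [H1 H2].
  apply (summable_ext (fun k => (if Z.leb 0 k then zp q k else 0) + (if Z.leb 0 k then 0 else zp q (- k)))).
  { intros k. destruct (Z.leb_spec 0 k).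
    - rewrite Z.abs_eq by assumption; ring.
    - rewrite Z.abs_neq by lia; ring. }
  apply summable_plus.
  - apply (summable_reindex Z.of_nat).
    + intros; lia.
    + intros y Hy. destruct (Z.leb_spec 0 y); [|reflexivity].
      exfalso; apply (Hy (Z.to_nat y)); lia.
    + apply (summable_ext (fun n => q ^ n)); [|now apply summable_geom].
      intros n. destruct (Z.leb_spec 0 (Z.of_nat n)); [|lia]. now rewrite zp_nat.
  - apply (summable_reindex (fun n => - Z.of_nat n - 1)%Z).
    + intros; lia.
    + intros y Hy. destruct (Z.leb_spec 0 y); [reflexivity|].
      exfalso; apply (Hy (Z.to_nat (- y - 1))); lia.
    + apply (summable_ext (fun n => q * q ^ n)); [|now apply summable_scal, summable_geom].
      intros n. destruct (Z.leb_spec 0 (- Z.of_nat n - 1)); [lia|].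
      replace (- (- Z.of_nat n - 1))%Z with (Z.of_nat (S n)) by lia.
      rewrite zp_nat, Cpow_S; reflexivity.
Qed.

(** The exponent e is kept as an integer, so a convergence proof reduces to an inequality in Z; the
    case x = 0 absorbs the indices where a reciprocal q-factorial vanishes. *)
Definition dominated (q : C) (M : R) (x : C) (n : Z) : Prop :=
  x = 0 \/ exists e, (n <= e)%Z /\ (Cmod x <= M * Cmod (zp q e))%R.

Lemma dominated_Cmod (q : C) M (x : C) n : base q -> (0 <= M)%R -> dominated q M x n ->
  (Cmod x <= Cmod (M * zp q n))%R.
Proof.
  intros Hb HM H. rewrite Cmod_mult, Cmod_R, Rabs_pos_eq by assumption.
  destruct H as [->|[e [He Hx]]].
  - rewrite Cmod_0. apply Rmult_le_pos; [assumption|apply Cmod_ge_0].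
  - eapply Rle_trans; [exact Hx|]. apply Rmult_le_compat_l; [assumption|].
    now apply Cmod_zp_le.
Qed.

(** Comparison with the two-sided geometric series of |q|^|k|; the shift c costs only the constant
    factor q^(-c). *)
Lemma summable_Z1 (q : C) M c (f : Z -> C) : base q -> (0 <= M)%R ->
  (forall k, dominated q M (f k) (Z.abs k - c)) -> summable f.
Proof.
  intros Hb HM H.
  apply (summable_le _ (fun k => (M * zp q (- c)) * zp q (Z.abs k))).
  - intros k. eapply Rle_trans; [apply (dominated_Cmod q M _ _ Hb HM (H k))|].
    right; f_equal. rewrite <- Cmult_assoc, <- zp_add by apply Hb. f_equal; f_equal; lia.
  - now apply summable_scal, summable_zp_abs.
Qed.

Lemma summable_Z2 (q : C) M c (f : Z * Z -> C) : base q -> (0 <= M)%R ->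
  (forall k l, dominated q M (f (k, l)) (Z.abs k + Z.abs l - c)) -> summable f.
Proof.
  intros Hb HM H.
  apply (summable_le _ (fun x => (M * zp q (- c)) * (zp q (Z.abs (fst x)) * zp q (Z.abs (snd x))))).
  - intros [k l]. eapply Rle_trans; [apply (dominated_Cmod q M _ _ Hb HM (H k l))|].
    right; f_equal. simpl. rewrite <- !zp_add, <- Cmult_assoc, <- zp_add by apply Hb.
    f_equal; f_equal; lia.
  - apply summable_scal. apply (summable_mult (fun k => zp q (Z.abs k)) (fun k => zp q (Z.abs k)));
    now apply summable_zp_abs.
Qed.

Lemma summable_Z3 q M c (f : Z * (Z * Z) -> C) : base q -> (0 <= M)%R ->
  (forall k l m, dominated q M (f (k, (l, m))) (Z.abs k + Z.abs l + Z.abs m - c)) -> summable f.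
Proof.
  intros Hb HM H.
  apply (summable_le _ (fun x => (M * zp q (- c)) * (zp q (Z.abs (fst x)) *
    (zp q (Z.abs (fst (snd x))) * zp q (Z.abs (snd (snd x))))))).
  - intros [k [l m]]. eapply Rle_trans; [apply (dominated_Cmod q M _ _ Hb HM (H k l m))|].
    right; f_equal. simpl. rewrite <- !zp_add, <- Cmult_assoc, <- zp_add by apply Hb.
    f_equal; f_equal; lia.
  - apply summable_scal. apply (summable_mult (fun k => zp q (Z.abs k))
      (fun x => zp q (Z.abs (fst x)) * zp q (Z.abs (snd x)))); [now apply summable_zp_abs|].
    apply (summable_mult (fun k => zp q (Z.abs k)) (fun k => zp q (Z.abs k)));
    now apply summable_zp_abs.
Qed.

(** * Nonvanishing and uniform bounds of q-Pochhammer symbols *)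

Lemma one_minus_neq0 (x : C) : (Cmod x < 1)%R -> 1 - x <> 0.
Proof.
  intros H E. assert (E' : x = 1) by (replace x with (1 - (1 - x)) by ring; rewrite E; ring).
  rewrite E', Cmod_1 in H; lra.
Qed.

Lemma Cmod_pow_lt1 (q : C) n : (Cmod q < 1)%R -> (Cmod (q ^ S n) < 1)%R.
Proof.
  intros H. rewrite Cmod_pow. assert (H0 := Cmod_ge_0 q).
  assert (Cmod q ^ n <= 1)%R by (rewrite <- (pow1 n); apply pow_incr; lra).
  simpl; nra.
Qed.

Lemma qpoch_neq0 a (Q : C) n : (Cmod a < 1)%R -> (Cmod Q < 1)%R -> qpoch a Q n <> 0.
Proof.
  intros Ha HQ; induction n as [|n IH]; simpl; [apply C1_nz|].
  apply Cmult_neq_0; [assumption|]. apply one_minus_neq0. rewrite Cmod_mult, Cmod_pow.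
  assert (H0 := Cmod_ge_0 Q). assert (H1 := Cmod_ge_0 a).
  assert (Cmod Q ^ n <= 1)%R by (rewrite <- (pow1 n); apply pow_incr; lra).
  assert (0 <= Cmod Q ^ n)%R by (apply pow_le; lra). nra.
Qed.

(** u n is at most the product of the 1 + C r^k, hence at most exp of a geometric series. It serves
    for q-Pochhammer symbols, for their reciprocals and, later, for iterates of a perturbed
    recurrence. *)
Lemma prod_bound (u : nat -> R) (C r : R) : (0 <= C)%R -> (0 <= r < 1)%R ->
  (forall n, 0 <= u n)%R -> (u 0%nat <= 1)%R ->
  (forall n, u (S n) <= u n * (1 + C * r ^ n))%R ->
  forall n, (u n <= exp (C / (1 - r)))%R.
Proof.
  intros HC Hr Hu H0 HS.
  assert (H : forall n, (u n <= exp (C * ((1 - r ^ n) / (1 - r))))%R).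
  { induction n as [|n IH].
    - simpl. replace (C * ((1 - 1) / (1 - r)))%R with 0%R by (field; lra). rewrite exp_0; lra.
    - eapply Rle_trans; [apply HS|].
      assert (Hn : (0 <= r ^ n)%R) by (apply pow_le; lra).
      eapply Rle_trans; [apply Rmult_le_compat_r; [nra|apply IH]|].
      assert (E : (1 + C * r ^ n <= exp (C * r ^ n))%R) by apply exp_ineq1_le.
      eapply Rle_trans; [apply Rmult_le_compat_l; [left; apply exp_pos|apply E]|].
      rewrite <- exp_plus. right; f_equal. simpl; field; lra. }
  intros n; eapply Rle_trans; [apply H|].
  assert (Hn : (0 <= r ^ n)%R) by (apply pow_le; lra).
  assert (Hx : (C * ((1 - r ^ n) / (1 - r)) <= C / (1 - r))%R).
  { unfold Rdiv. apply Rmult_le_compat_l; [assumption|].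
    rewrite <- (Rmult_1_l (/ (1 - r))) at 2. apply Rmult_le_compat_r; [|lra].
    left; apply Rinv_0_lt_compat; lra. }
  destruct Hx as [Hx| ->]; [left; now apply exp_increasing|lra].
Qed.

Lemma qpoch_bound a (Q : C) n : (Cmod Q < 1)%R -> (Cmod (qpoch a Q n) <= exp (Cmod a / (1 - Cmod Q)))%R.
Proof.
  intros HQ. apply (prod_bound (fun n => Cmod (qpoch a Q n))).
  - apply Cmod_ge_0.
  - split; [apply Cmod_ge_0|assumption].
  - intros; apply Cmod_ge_0.
  - simpl; rewrite Cmod_1; lra.
  - intros m; simpl. rewrite Cmod_mult. apply Rmult_le_compat_l; [apply Cmod_ge_0|].
    eapply Rle_trans; [apply Cmod_triangle|].
    rewrite Cmod_opp, Cmod_1, Cmod_mult, Cmod_pow; lra.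
Qed.

Definition rq (Q : C) (z : Z) : C := if Z.ltb z 0 then 0 else / qpoch Q Q (Z.to_nat z).

Lemma rq_neg (Q : C) z : (z < 0)%Z -> rq Q z = 0.
Proof. intros H; unfold rq; destruct (Z.ltb_spec z 0); [reflexivity|lia]. Qed.

Lemma rq_nat (Q : C) n : rq Q (Z.of_nat n) = / qpoch Q Q n.
Proof. unfold rq; destruct (Z.ltb_spec (Z.of_nat n) 0); [lia|]. now rewrite Nat2Z.id. Qed.

Lemma rq_0 (Q : C) : rq Q 0 = 1.
Proof. change 0%Z with (Z.of_nat 0). rewrite rq_nat; simpl. field. Qed.

(** At z = 0 the factor 1 - Q^0 vanishes together with [rq Q (-1)], so the relation holds on all of
    Z. This frees the later telescopings of boundary terms. *)
Lemma rq_rec (Q : C) z : (Cmod Q < 1)%R -> (1 - zp Q z) * rq Q z = rq Q (z - 1).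
Proof.
  intros HQ. destruct (Z.lt_trichotomy z 0) as [H|[->|H]].
  - rewrite !rq_neg by lia; ring.
  - rewrite zp_0, (rq_neg Q (0 - 1)) by lia; ring.
  - replace z with (Z.of_nat (S (Z.to_nat (z - 1)))) by lia.
    set (n := Z.to_nat (z - 1)). replace (Z.of_nat (S n) - 1)%Z with (Z.of_nat n) by lia.
    rewrite !rq_nat, zp_nat. simpl. field. split; [now apply qpoch_neq0|].
    apply one_minus_neq0. now apply (Cmod_pow_lt1 Q n).
Qed.

(** The bound of [prod_bound] with C = 1/(1 - |Q|), because 1/(1 - |Q|^(m+1)) <= 1 + |Q|^m / (1 -
    |Q|). *)
Definition rq_bound (Q : C) : R := exp (/ (1 - Cmod Q) / (1 - Cmod Q)).

Lemma Cmod_rq (Q : C) z : (Cmod Q < 1)%R -> (Cmod (rq Q z) <= rq_bound Q)%R.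
Proof.
  intros HQ. unfold rq; destruct (Z.ltb_spec z 0).
  { rewrite Cmod_0. left; apply exp_pos. }
  generalize (Z.to_nat z); clear z H.
  assert (H0 := Cmod_ge_0 Q).
  assert (Hi : (0 < / (1 - Cmod Q))%R) by (apply Rinv_0_lt_compat; lra).
  intros n. rewrite Cmod_inv by now apply qpoch_neq0.
  apply (prod_bound (fun n => (/ Cmod (qpoch Q Q n))%R)).
  - lra.
  - lra.
  - intros m; left. apply Rinv_0_lt_compat, Cmod_gt_0. now apply qpoch_neq0.
  - simpl; rewrite Cmod_1; lra.
  - intros m; simpl. rewrite Cmod_mult, Rinv_mult.
    apply Rmult_le_compat_l.
    { left. apply Rinv_0_lt_compat, Cmod_gt_0. now apply qpoch_neq0. }
    assert (Hm : (0 <= Cmod Q ^ m <= 1)%R).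
    { split; [now apply pow_le|]. rewrite <- (pow1 m). apply pow_incr; lra. }
    assert (L : (1 - Cmod Q * Cmod Q ^ m <= Cmod (1 - Q * Q ^ m))%R).
    { rewrite <- Cmod_pow, <- Cmod_mult. set (x := Q * Q ^ m).
      assert (Cmod 1 <= Cmod (1 - x) + Cmod x)%R.
      { replace (1 : C) with ((1 - x) + x) at 1 by ring. apply Cmod_triangle. }
      rewrite Cmod_1 in H; lra. }
    assert (Hd : (0 < 1 - Cmod Q * Cmod Q ^ m)%R) by nra.
    eapply Rle_trans; [apply Rinv_le_contravar; [exact Hd|exact L]|].
    apply Rmult_le_reg_r with (1 - Cmod Q * Cmod Q ^ m)%R; [assumption|].
    rewrite Rinv_l by lra.
    set (x := (Cmod Q ^ m)%R) in *. set (r := Cmod Q) in *.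
    apply Rmult_le_reg_l with (1 - r)%R; [lra|].
    replace ((1 - r) * ((1 + / (1 - r) * x) * (1 - r * x)))%R with ((1 - r + x) * (1 - r * x))%R by (field; lra). clear L Hd.
    (* (1 - r + x)(1 - r x) - (1 - r) = x (r (1 - x) + (1 - r)^2), a sum of nonnegative terms. *)
    assert (0 <= r * x)%R by (apply Rmult_le_pos; lra).
    assert (0 <= x * (r * (1 - x)))%R by (repeat apply Rmult_le_pos; lra).
    assert (0 <= x * ((1 - r) * (1 - r)))%R by (repeat apply Rmult_le_pos; lra). lra.
Qed.

Lemma rq_bound_pos (Q : C) : (0 < rq_bound Q)%R.
Proof. apply exp_pos. Qed.

Lemma qpoch_inf_eq a (Q : C) l : clim (qpoch a Q) l -> qpoch_inf a Q = l.
Proof.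
  intros H. unfold qpoch_inf.
  assert (Hc : cauchy (T := C_UniformSpace) (filtermap (qpoch a Q) eventually)).
  { intros eps. exists l. destruct (H eps (cond_pos eps)) as [N HN].
    exists N; intros n Hn. apply C_NormedModule_mixin_compat1. now apply HN. }
  assert (Hp : ProperFilter (filtermap (qpoch a Q) eventually)).
  { apply filtermap_proper_filter, eventually_filter. }
  apply (clim_unique (qpoch a Q)); [|assumption].
  intros e He.
  (* A ball of the uniform structure on C is a product of two intervals; passing back to the modulus
     costs a factor sqrt 2. *)
  assert (Hs : (0 < sqrt 2)%R) by (apply sqrt_lt_R0; lra).
  assert (He' : (0 < e / sqrt 2)%R) by now apply Rdiv_lt_0_compat.
  destruct (complete_cauchy (T := C_CompleteNormedModule) _ Hp Hc (mkposreal _ He')) as [N HN].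
  exists N; intros n Hn. specialize (HN n Hn).
  apply C_NormedModule_mixin_compat2 in HN. simpl in HN.
  replace (sqrt 2 * (e / sqrt 2))%R with e in HN by (field; lra). exact HN.
Qed.

(** * Euler's series for the infinite product *)

Lemma qpoch_add a (Q : C) m n : qpoch a Q (m + n) = qpoch a Q m * qpoch (a * Q ^ m) Q n.
Proof.
  induction n as [|n IH].
  - rewrite Nat.add_0_r; simpl; ring.
  - rewrite Nat.add_succ_r. simpl. rewrite IH, Cpow_add_r; ring.
Qed.

(** Summand of Euler's expansion of (x; Q)_oo for Q = P^2, with Q^(k(k-1)/2) written as
    P^(k^2-k). *)
Definition euler_term (P x : C) (k : Z) : C := zp P (k * k - k) * zp (- x) k * rq (P ^ 2) k.

Lemma Cpow2 (x : C) : x ^ 2 = x * x.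
Proof. simpl; ring. Qed.

Lemma base_sq (P : C) : base P -> base (P ^ 2).
Proof. apply base_pow. Qed.

(* A power of [q] below [|x|^(+-1)], so that [x^k] can be absorbed in a Gaussian. *)
Lemma zp_dom (q : C) (x : C) : base q -> x <> 0 -> exists c, (0 <= c)%Z /\
  forall k, (Cmod (zp x k) <= Cmod (zp q (- c * Z.abs k)))%R.
Proof.
  intros Hb Hx.
  assert (Hy : exists n, (Rmax (Cmod x) (/ Cmod x) <= Cmod (zp q (- Z.of_nat n)))%R).
  { destruct (Pow_x_infinity (/ Cmod q)) with (b := Rmax (Cmod x) (/ Cmod x)) as [N HN].
    - rewrite Rabs_pos_eq; [|left; now apply Rinv_0_lt_compat, Cmod_pos].
      rewrite <- Rinv_1. apply Rinv_lt_contravar; [|apply Hb].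
      rewrite Rmult_1_r; now apply Cmod_pos.
    - exists N. specialize (HN N (le_n _)).
      rewrite zp_opp, zp_nat, Cmod_inv, Cmod_pow by (try apply Cpow_nz; apply Hb).
      rewrite Rabs_pos_eq, pow_inv in HN; [lra|]. apply pow_le. left.
      now apply Rinv_0_lt_compat, Cmod_pos. }
  destruct Hy as [n Hn]. exists (Z.of_nat n); split; [lia|]. intros k.
  assert (Hm : (Cmod (zp x k) <= Rmax (Cmod x) (/ Cmod x) ^ Z.to_nat (Z.abs k))%R).
  { destruct (Z.le_gt_cases 0 k).
    - rewrite zp_pow by assumption. rewrite Z.abs_eq, Cmod_pow by assumption.
      apply pow_incr; split; [apply Cmod_ge_0|apply Rmax_l].
    - replace k with (- (Z.of_nat (Z.to_nat (- k))))%Z at 1 by lia.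
      rewrite zp_opp, zp_nat, Cmod_inv, Cmod_pow, <- pow_inv by (try apply Cpow_nz; assumption).
      replace (Z.to_nat (Z.abs k)) with (Z.to_nat (- k)) by lia.
      apply pow_incr; split; [|apply Rmax_r]. left; now apply Rinv_0_lt_compat, Cmod_gt_0. }
  eapply Rle_trans; [exact Hm|].
  rewrite <- zp_mul by apply Hb. rewrite zp_pow, Cmod_pow by lia.
  apply pow_incr; split; [|exact Hn].
  eapply Rle_trans; [apply (Cmod_ge_0 x)|apply Rmax_l].
Qed.

Lemma gauss_dominated (q : C) (x : C) a b : base q -> x <> 0 -> (0 < a)%Z -> exists c, forall k,
  dominated q 1 (zp q (a * (k * k) + b * k) * zp x k) (Z.abs k - c).
Proof.
  intros Hb Hx Ha. destruct (zp_dom q x Hb Hx) as [c [Hc H]].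
  (* With m = |k| and d = c + |b| + 1 the exponent is at least m^2 - (d - 1) m, and m^2 - d m >=
     -d^2. *)
  exists ((c + Z.abs b + 1) * (c + Z.abs b + 1))%Z; intros k. right.
  exists (a * (k * k) + b * k - c * Z.abs k)%Z; split.
  - assert (- (Z.abs b * Z.abs k) <= b * k)%Z by (rewrite <- Z.abs_mul; lia).
    assert (k * k = Z.abs k * Z.abs k)%Z by (rewrite <- Z.abs_mul; nia).
    assert (0 <= Z.abs k)%Z by lia. assert (0 <= Z.abs b)%Z by lia.
    generalize dependent (Z.abs k); intros m; intros. generalize dependent (Z.abs b); intros b'; intros.
    assert (k * k <= a * (k * k))%Z by nia. rewrite H1 in *. nia.
  - rewrite Rmult_1_l, Cmod_mult.
    replace (a * (k * k) + b * k - c * Z.abs k)%Z with ((a * (k * k) + b * k) + (- c * Z.abs k))%Z by ring.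
    rewrite (zp_add q (a * (k * k) + b * k)), Cmod_mult by apply Hb.
    apply Rmult_le_compat_l; [apply Cmod_ge_0|apply H].
Qed.

Lemma dominated_mult (q : C) M (x : C) n K (y : C) : (0 <= K)%R -> (0 <= M)%R -> dominated q M x n ->
  (Cmod y <= K)%R -> dominated q (M * K) (x * y) n.
Proof.
  intros HK HM [->|[e [He Hx]]] Hy; [left; ring|right; exists e; split; [assumption|]].
  rewrite Cmod_mult.
  apply Rle_trans with ((M * Cmod (zp q e)) * K)%R; [|right; ring].
  apply Rmult_le_compat; auto using Cmod_ge_0.
Qed.

(** The general convergence criterion: a Gaussian in q absorbs any geometric factor x^k and any
    bounded factor. *)
Lemma summable_gauss (q : C) (x : C) a b K (g : Z -> C) : base q -> x <> 0 -> (0 < a)%Z -> (0 <= K)%R ->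
  (forall k, (Cmod (g k) <= K)%R) ->
  summable (fun k => zp q (a * (k * k) + b * k) * zp x k * g k).
Proof.
  intros Hb Hx Ha HK Hg. destruct (gauss_dominated q x a b Hb Hx Ha) as [c Hc].
  apply (summable_Z1 q (1 * K) c); [assumption|lra|].
  intros k. apply dominated_mult; auto; lra.
Qed.

Lemma Copp_neq0 (x : C) : x <> 0 -> - x <> 0.
Proof. intros H E; apply H. replace x with (- - x) by ring. rewrite E; ring. Qed.

Lemma summable_euler (P : C) (x : C) : base P -> x <> 0 -> summable (euler_term P x).
Proof.
  intros Hb Hx. unfold euler_term.
  apply (summable_ext (fun k => zp P (1 * (k * k) + (-1) * k) * zp (- x) k * rq (P ^ 2) k)).
  { intros k. do 3 f_equal. ring. }
  apply (summable_gauss P _ _ _ (rq_bound (P ^ 2))); auto; try lia.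
  - now apply Copp_neq0.
  - left; apply rq_bound_pos.
  - intros; apply Cmod_rq. now apply base_sq.
Qed.

Lemma usum_shift (u : Z -> C) : summable u -> usum (fun k => u (k + 1)%Z) = usum u.
Proof.
  intros H. symmetry. apply (usum_bij (fun k => k + 1)%Z (fun k => k - 1)%Z); auto; intros; lia.
Qed.

Lemma summable_shift (u : Z -> C) d : summable u -> summable (fun k => u (k + d)%Z).
Proof. intros H. apply (summable_comp (fun k => k + d)%Z); [|assumption]. intros x y E; lia. Qed.

Lemma usum_telescope (u : Z -> C) : summable u -> usum (fun k => u k - u (k + 1)%Z) = 0.
Proof.
  intros H. rewrite usum_minus, usum_shift; auto; [ring|]. now apply summable_shift.
Qed.

Lemma zp_sq (P : C) k : P <> 0 -> zp (P ^ 2) k = zp P (2 * k).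
Proof. intros H. rewrite <- zp_mul by assumption. rewrite (zp_pow P 2) by lia. reflexivity. Qed.

(** With u k = (1 - Q^k) times the summand, the termwise difference of the two sides is u k - u
    (k+1), as 1 - Q^(k+1) cancels in the reciprocal q-factorial. The same u is the difference of the
    summands at x and x Q, hence summable. *)
Lemma euler_rec (P : C) (x : C) : base P -> x <> 0 ->
  usum (euler_term P x) = (1 - x) * usum (euler_term P (x * P ^ 2)).
Proof.
  intros Hb Hx. assert (HP := proj1 Hb). assert (HQ : P ^ 2 <> 0) by now apply Cpow_nz.
  assert (Hx2 : x * P ^ 2 <> 0) by now apply Cmult_neq_0.
  assert (S1 := summable_euler P x Hb Hx). assert (S2 := summable_euler P _ Hb Hx2).
  rewrite <- usum_scal by assumption.
  set (u := fun k => (1 - zp (P ^ 2) k) * euler_term P x k).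
  assert (Hu : forall k, euler_term P x k - (1 - x) * euler_term P (x * P ^ 2) k = u k - u (k + 1)%Z).
  { intros k. unfold u, euler_term.
    replace ((k + 1) * (k + 1) - (k + 1))%Z with ((k * k - k) + 2 * k)%Z by ring.
    replace (- (x * P ^ 2)) with ((- x) * P ^ 2) by ring.
    rewrite zp_mult_l, (zp_add P), <- (zp_sq P k), (zp_succ (- x)) by (auto using Copp_neq0).
    replace ((1 - zp (P ^ 2) (k + 1)) *
      (zp P (k * k - k) * zp (P ^ 2) k * (zp (- x) k * - x) * rq (P ^ 2) (k + 1)))
    with (zp P (k * k - k) * zp (P ^ 2) k * (zp (- x) k * - x) *
      ((1 - zp (P ^ 2) (k + 1)) * rq (P ^ 2) (k + 1))) by ring.
    rewrite rq_rec by now apply base_sq. replace (k + 1 - 1)%Z with k by ring. ring. }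
  assert (Su : summable u).
  { apply (summable_ext (fun k => euler_term P x k - euler_term P (x * P ^ 2) k)).
    - intros k. unfold u, euler_term. replace (- (x * P ^ 2)) with ((- x) * P ^ 2) by ring.
      rewrite zp_mult_l. ring.
    - now apply summable_minus. }
  assert (E := usum_telescope u Su).
  rewrite <- (usum_ext _ _ Hu), usum_minus in E by auto using summable_scal.
  replace (usum (euler_term P x)) with
    (usum (euler_term P x) - usum (fun k => (1 - x) * euler_term P (x * P ^ 2) k)
      + usum (fun k => (1 - x) * euler_term P (x * P ^ 2) k)) by ring.
  rewrite E; ring.
Qed.

Lemma clim_pow_0 (Q : C) : (Cmod Q < 1)%R -> clim (fun n => Q ^ n) 0.
Proof.
  intros HQ e He. destruct (pow_lt_1_zero (Cmod Q)) with (y := e) as [N HN]; auto.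
  { rewrite Rabs_pos_eq; [assumption|apply Cmod_ge_0]. }
  exists N; intros n Hn. replace (Q ^ n - 0) with (Q ^ n) by ring. rewrite Cmod_pow.
  specialize (HN n Hn). rewrite Rabs_pos_eq in HN; [assumption|apply pow_le, Cmod_ge_0].
Qed.

Lemma clim_scal_0 (u : nat -> C) c : clim u 0 -> clim (fun n => c * u n) 0.
Proof.
  intros H. replace (0 : C) with (c * 0) by ring. apply clim_mult; [apply clim_const|assumption].
Qed.

(** Replacing x by x Q^n multiplies the k-th term by Q^(nk); as terms with k < 0 vanish, only k = 0
    survives. The c n k allow for further bounded factors tending to 1. *)
Lemma usum_scale_lim (Q : C) (B : Z -> C) (c : nat -> Z -> C) K : (Cmod Q < 1)%R ->
  summable B -> (forall k, (k < 0)%Z -> B k = 0) ->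
  (0 <= K)%R -> (forall n k, (Cmod (c n k) <= K)%R) -> (forall k, clim (fun n => c n k) 1) ->
  clim (fun n => usum (fun k => zp (Q ^ n) k * B k * c n k)) (B 0%Z).
Proof.
  intros HQ [M HM] HB HK Hc Hl.
  replace (B 0%Z) with (usum (fun k : Z => if Z.eqb k 0 then B k else 0)).
  2: { rewrite (usum_single _ 0%Z); [reflexivity|].
       intros k Hk. destruct (Z.eqb_spec k 0); [contradiction|reflexivity]. }
  apply (usum_dominated _ _ (fun k => (K * Cmod (B k))%R) (K * M)).
  - intros n k. rewrite Cmod_mult, Rmult_comm. apply Rmult_le_compat; auto using Cmod_ge_0.
    rewrite Cmod_mult. destruct (Z.le_gt_cases 0 k) as [Hk|Hk].
    + rewrite <- (Rmult_1_l (Cmod (B k))) at 2. apply Rmult_le_compat_r; [apply Cmod_ge_0|].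
      rewrite zp_pow by assumption. rewrite <- Cpow_mult_r, Cmod_pow, <- (pow1 (n * Z.to_nat k)).
      apply pow_incr; split; [apply Cmod_ge_0|lra].
    + rewrite HB, Cmod_0 by assumption; lra.
  - intros l Nl. rewrite rsum_scal. apply Rmult_le_compat_l; [assumption|now apply HM].
  - intros k. destruct (Z.eqb_spec k 0) as [->|Hk].
    + apply (clim_ext (fun n => B 0%Z * c n 0%Z)); [intros; rewrite zp_0; ring|].
      match goal with |- clim ?u ?l => enough (HL : clim u (l * 1))
        by (rewrite Cmult_1_r in HL; exact HL) end.
      apply clim_mult; [apply clim_const|apply Hl].
    + destruct (Z.le_gt_cases 0 k) as [Hk'|Hk'].
      * apply (clim_ext (fun n => (B k * (Q ^ Z.to_nat k) ^ n) * c n k)).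
        { intros n. rewrite zp_pow by assumption. rewrite <- !Cpow_mult_r, (Nat.mul_comm n). ring. }
        replace (0 : C) with (0 * 1 : C) by ring. apply clim_mult; [|apply Hl].
        apply clim_scal_0, clim_pow_0. replace (Z.to_nat k) with (S (Z.to_nat (k - 1))) by lia.
        now apply Cmod_pow_lt1.
      * apply (clim_ext (fun _ => 0)); [|apply clim_const].
        intros n. rewrite HB by assumption; ring.
Qed.

Lemma euler_lim (P x : C) : base P -> x <> 0 ->
  clim (fun n => usum (euler_term P (x * (P ^ 2) ^ n))) 1.
Proof.
  intros Hb Hx. assert (HP := proj1 Hb).
  replace (1 : C) with (euler_term P x 0).
  2: { unfold euler_term; simpl. rewrite !zp_0, rq_0; ring. }
  apply (clim_ext (fun n => usum (fun k => zp ((P ^ 2) ^ n) k * euler_term P x k * 1))).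
  - intros n; apply usum_ext; intros k; unfold euler_term.
    replace (- (x * (P ^ 2) ^ n)) with ((- x) * (P ^ 2) ^ n) by ring.
    rewrite zp_mult_l; ring.
  - apply (usum_scale_lim _ _ (fun _ _ => 1) 1).
    + now apply base_sq.
    + now apply summable_euler.
    + intros k Hk; unfold euler_term. rewrite rq_neg by assumption; ring.
    + lra.
    + intros; rewrite Cmod_1; lra.
    + intros; apply clim_const.
Qed.

Lemma euler_qpoch (P : C) (x : C) n : base P -> x <> 0 ->
  usum (euler_term P x) = qpoch x (P ^ 2) n * usum (euler_term P (x * (P ^ 2) ^ n)).
Proof.
  intros Hb Hx. assert (HQ : P ^ 2 <> 0) by (apply Cpow_nz, Hb).
  induction n as [|n IH].
  - replace (x * (P ^ 2) ^ 0) with x by (simpl; ring). change (qpoch x (P ^ 2) 0) with (1 : C). ring.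
  - rewrite IH, euler_rec; [|assumption|apply Cmult_neq_0; [assumption|now apply Cpow_nz]].
    rewrite (Cpow_S (P ^ 2) n).
    change (qpoch x (P ^ 2) (S n)) with (qpoch x (P ^ 2) n * (1 - x * (P ^ 2) ^ n)).
    set (Q := P ^ 2). replace (x * Q ^ n * Q) with (x * (Q * Q ^ n)) by ring. ring.
Qed.

(** The iterated functional equation writes the series E as a partial product times a remainder r
    tending to 1. Convergence of the infinite product is thus a consequence, not a prerequisite. *)
Lemma qpoch_lim_euler (P : C) (x : C) : base P -> x <> 0 -> clim (qpoch x (P ^ 2)) (usum (euler_term P x)).
Proof.
  intros Hb Hx e He.
  set (E := usum (euler_term P x)).
  (* The bound 1/2 keeps |r| >= 1/2, so the partial product u has modulus at most 2 |E|; the other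
     bound then controls |u| |r - 1|. *)
  set (d := Rmin (1 / 2) (e / (2 * (Cmod E + 1)))).
  assert (HE := Cmod_ge_0 E).
  assert (Hd : (0 < d)%R).
  { apply Rmin_glb_lt; [lra|]. apply Rdiv_lt_0_compat; lra. }
  destruct (euler_lim P x Hb Hx d Hd) as [N HN]. exists N; intros n Hn. specialize (HN n Hn).
  assert (Eq : E = qpoch x (P ^ 2) n * usum (euler_term P (x * (P ^ 2) ^ n))) by now apply euler_qpoch.
  set (r := usum (euler_term P (x * (P ^ 2) ^ n))) in *. set (u := qpoch x (P ^ 2) n) in *.
  assert (D1 : (d <= 1 / 2)%R) by apply Rmin_l.
  assert (D2 : (d <= e / (2 * (Cmod E + 1)))%R) by apply Rmin_r.
  assert (Hr : (1 / 2 <= Cmod r)%R).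
  { assert (Cmod 1 <= Cmod (r - 1) + Cmod r)%R.
    { replace (1 : C) with (- (r - 1) + r) at 1 by ring.
      eapply Rle_trans; [apply Cmod_triangle|]. rewrite Cmod_opp; lra. }
    rewrite Cmod_1 in H; lra. }
  assert (Hu : (Cmod u <= 2 * Cmod E)%R).
  { rewrite Eq, Cmod_mult. generalize (Cmod_ge_0 u); nra. }
  replace (u - E) with (- (u * (r - 1))) by (rewrite Eq; ring).
  rewrite Cmod_opp, Cmod_mult.
  assert (D3 : (d * (2 * (Cmod E + 1)) <= e)%R).
  { replace e with (e / (2 * (Cmod E + 1)) * (2 * (Cmod E + 1)))%R by (field; lra).
    apply Rmult_le_compat_r; lra. }
  generalize (Cmod_ge_0 u), (Cmod_ge_0 (r - 1)). intros.
  assert (Cmod u * Cmod (r - 1) <= 2 * Cmod E * Cmod (r - 1))%R by (apply Rmult_le_compat_r; lra).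
  assert (2 * Cmod E * Cmod (r - 1) <= 2 * Cmod E * d)%R by (apply Rmult_le_compat_l; lra).
  nra.
Qed.

Lemma euler (P : C) (x : C) : base P -> x <> 0 -> usum (euler_term P x) = qpoch_inf x (P ^ 2).
Proof. intros Hb Hx; symmetry; apply qpoch_inf_eq. now apply qpoch_lim_euler. Qed.

Lemma qpoch_lim (P : C) (x : C) : base P -> x <> 0 -> clim (qpoch x (P ^ 2)) (qpoch_inf x (P ^ 2)).
Proof. intros Hb Hx. rewrite <- euler by assumption. now apply qpoch_lim_euler. Qed.

Lemma qpoch_inf_split (P : C) (x : C) n : base P -> x <> 0 ->
  qpoch_inf x (P ^ 2) = qpoch x (P ^ 2) n * qpoch_inf (x * (P ^ 2) ^ n) (P ^ 2).
Proof.
  intros Hb Hx. rewrite <- !euler; auto; [now apply euler_qpoch|].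
  apply Cmult_neq_0; [assumption|]. apply Cpow_nz, Cpow_nz, Hb.
Qed.

Lemma qpoch_inf_tail (P : C) (x : C) : base P -> x <> 0 ->
  clim (fun n => qpoch_inf (x * (P ^ 2) ^ n) (P ^ 2)) 1.
Proof.
  intros Hb Hx. apply (clim_ext (fun n => usum (euler_term P (x * (P ^ 2) ^ n)))).
  - intros n; apply euler; auto. apply Cmult_neq_0; [assumption|]. apply Cpow_nz, Cpow_nz, Hb.
  - now apply euler_lim.
Qed.

(** Some tail of the product lies close to 1, and the finite part in front of it is nonzero. *)
Lemma qpoch_inf_neq0 (P : C) (x : C) : base P -> x <> 0 -> (forall n, qpoch x (P ^ 2) n <> 0) ->
  qpoch_inf x (P ^ 2) <> 0.
Proof.
  intros Hb Hx Hn E. destruct (qpoch_inf_tail P x Hb Hx 1%R) as [N HN]; [lra|].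
  specialize (HN N (le_n _)). rewrite (qpoch_inf_split P x N) in E by assumption.
  destruct (Ceq_dec (qpoch_inf (x * (P ^ 2) ^ N) (P ^ 2)) 0) as [E'|E'].
  - rewrite E' in HN. replace (0 - 1 : C) with (- (1) : C) in HN by ring.
    rewrite Cmod_opp, Cmod_1 in HN; lra.
  - revert E; apply Cmult_neq_0; auto.
Qed.

(** * The q-binomial theorem and the Jacobi triple product *)

Lemma qpoch_zero (a Q : C) m n : (m < n)%nat -> a * Q ^ m = 1 -> qpoch a Q n = 0.
Proof.
  intros Hmn E. induction n as [|n IH]; [lia|]. simpl.
  destruct (Nat.eq_dec m n) as [->|Hn].
  - rewrite E; ring.
  - rewrite IH by lia; ring.
Qed.

(** For z < 0 the product contains 1 - Q^0, in agreement with [rq] being 0. This is how whole fibres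
    of later multiple sums disappear. *)
Lemma qpoch_inf_zp (P : C) z : base P ->
  qpoch_inf (zp (P ^ 2) (z + 1)) (P ^ 2) = qpoch_inf (P ^ 2) (P ^ 2) * rq (P ^ 2) z.
Proof.
  intros Hb. assert (HQ := base_sq P Hb). destruct HQ as [HQ0 HQ1].
  destruct (Z.le_gt_cases 0 z) as [Hz|Hz].
  - destruct (Z_of_nat_complete z Hz) as [n ->].
    rewrite (qpoch_inf_split P (P ^ 2) n) by assumption.
    rewrite rq_nat, zp_succ, zp_nat by assumption.
    rewrite (Cmult_comm ((P ^ 2) ^ n) (P ^ 2)).
    field. now apply qpoch_neq0.
  - rewrite (qpoch_inf_split P _ (Z.to_nat (- z))) by (auto using zp_neq0).
    rewrite (qpoch_zero _ _ (Z.to_nat (- z - 1))).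
    + rewrite rq_neg by assumption; ring.
    + lia.
    + rewrite <- (zp_nat (P ^ 2)), <- zp_add by assumption. rewrite <- (zp_0 (P ^ 2)). f_equal; lia.
Qed.

Lemma qpoch_inf_QQ_neq0 (P : C) : base P -> qpoch_inf (P ^ 2) (P ^ 2) <> 0.
Proof.
  intros Hb. destruct (base_sq P Hb) as [H0 H1].
  apply qpoch_inf_neq0; auto. intros; now apply qpoch_neq0.
Qed.

Lemma rq_lim (P : C) z : base P ->
  clim (fun n => qpoch_inf (P ^ 2) (P ^ 2) * rq (P ^ 2) (z + Z.of_nat n)) 1.
Proof.
  intros Hb. destruct (base_sq P Hb) as [H0 H1].
  apply (clim_ext (fun n => qpoch_inf (zp (P ^ 2) (z + 1) * (P ^ 2) ^ n) (P ^ 2))).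
  - intros n. rewrite <- qpoch_inf_zp by assumption. f_equal.
    rewrite <- (zp_nat (P ^ 2)), <- zp_add by assumption. f_equal; lia.
  - apply qpoch_inf_tail; [assumption|now apply zp_neq0].
Qed.

Definition binom_term (P x : C) (m k : Z) : C :=
  zp P (k * k - k) * zp (- x) k * (rq (P ^ 2) k * rq (P ^ 2) (m - k)).

Lemma Cmod_rq2 (Q : C) a b : (Cmod Q < 1)%R ->
  (Cmod (rq Q a * rq Q b) <= rq_bound Q * rq_bound Q)%R.
Proof.
  intros H. rewrite Cmod_mult. apply Rmult_le_compat; auto using Cmod_ge_0, Cmod_rq.
Qed.

Lemma summable_binom (P x : C) m : base P -> x <> 0 -> summable (binom_term P x m).
Proof.
  intros Hb Hx. unfold binom_term.
  apply (summable_ext (fun k => zp P (1 * (k * k) + (-1) * k) * zp (- x) k *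
    (rq (P ^ 2) k * rq (P ^ 2) (m - k)))).
  { intros k. do 3 f_equal. ring. }
  apply (summable_gauss P _ _ _ (rq_bound (P ^ 2) * rq_bound (P ^ 2))); auto; try lia.
  - now apply Copp_neq0.
  - left; apply Rmult_lt_0_compat; apply rq_bound_pos.
  - intros; apply Cmod_rq2. now apply base_sq.
Qed.

(** Split 1 - Q^m = (1 - Q^(m-k)) + Q^(m-k) (1 - Q^k). The first part lowers m in the summand; the
    second, after k -> k + 1, is -x Q^(m-1) times the summand for m - 1. *)
Lemma binom_rec (P x : C) m : base P -> x <> 0 ->
  (1 - zp (P ^ 2) m) * usum (binom_term P x m)
  = (1 - x * zp (P ^ 2) (m - 1)) * usum (binom_term P x (m - 1)).
Proof.
  intros Hb Hx. destruct (base_sq P Hb) as [H0 H1]. assert (HP := proj1 Hb).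
  assert (S1 := summable_binom P x m Hb Hx). assert (S2 := summable_binom P x (m - 1) Hb Hx).
  set (u := fun k => (1 - zp (P ^ 2) k) * zp (P ^ 2) (m - k) * binom_term P x m k).
  assert (Hu : forall k, u (k + 1)%Z = - x * zp (P ^ 2) (m - 1) * binom_term P x (m - 1) k).
  { intros k; unfold u, binom_term.
    replace ((k + 1) * (k + 1) - (k + 1))%Z with ((k * k - k) + 2 * k)%Z by ring.
    rewrite (zp_add P), <- (zp_sq P k), (zp_succ (- x)) by (auto using Copp_neq0).
    replace (m - (k + 1))%Z with (m - 1 - k)%Z by ring.
    assert (E1 := rq_rec (P ^ 2) (k + 1) H1). replace (k + 1 - 1)%Z with k in E1 by ring.
    rewrite <- E1. assert (E2 : zp (P ^ 2) (m - 1) = zp (P ^ 2) k * zp (P ^ 2) (m - 1 - k)).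
    { rewrite <- zp_add by assumption. f_equal; ring. }
    rewrite E2; ring. }
  assert (Su : summable u).
  { apply (summable_ext (fun k => u (k - 1 + 1)%Z)); [intros; f_equal; ring|].
    apply (summable_ext (fun k => - x * zp (P ^ 2) (m - 1) * binom_term P x (m - 1) (k - 1))).
    - intros k; now rewrite Hu.
    - apply summable_scal, (summable_shift _ (-1) S2). }
  rewrite <- usum_scal by assumption.
  rewrite (usum_ext _ (fun k => binom_term P x (m - 1) k + u k)).
  - rewrite usum_plus, <- (usum_shift u), (usum_ext _ _ Hu), usum_scal by assumption. ring.
  - intros k; unfold u, binom_term.
    assert (E1 := rq_rec (P ^ 2) (m - k) H1). replace (m - k - 1)%Z with (m - 1 - k)%Z in E1 by ring.
    rewrite <- E1. assert (E2 : zp (P ^ 2) m = zp (P ^ 2) k * zp (P ^ 2) (m - k)).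
    { rewrite <- zp_add by assumption. f_equal; ring. }
    rewrite E2; ring.
Qed.

Lemma q_binomial (P x : C) m : base P -> x <> 0 ->
  usum (binom_term P x (Z.of_nat m)) = qpoch x (P ^ 2) m * rq (P ^ 2) (Z.of_nat m).
Proof.
  intros Hb Hx. destruct (base_sq P Hb) as [H0 H1].
  induction m as [|m IH].
  - rewrite (usum_single _ 0%Z).
    + unfold binom_term; simpl. rewrite !zp_0, !rq_0; ring.
    + intros k Hk; unfold binom_term. destruct (Z.lt_trichotomy k 0) as [H|[H|H]]; [|lia|].
      * rewrite (rq_neg _ k) by assumption; ring.
      * rewrite (rq_neg _ (Z.of_nat 0 - k)) by lia; ring.
  - assert (E := binom_rec P x (Z.of_nat (S m)) Hb Hx).
    replace (Z.of_nat (S m) - 1)%Z with (Z.of_nat m) in E by lia.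
    rewrite IH, !zp_nat in E.
    assert (E2 := rq_rec (P ^ 2) (Z.of_nat (S m)) H1).
    replace (Z.of_nat (S m) - 1)%Z with (Z.of_nat m) in E2 by lia.
    rewrite zp_nat in E2. rewrite <- E2 in E.
    assert (HN : 1 - (P ^ 2) ^ S m <> 0) by (now apply one_minus_neq0, Cmod_pow_lt1).
    change (qpoch x (P ^ 2) (S m)) with (qpoch x (P ^ 2) m * (1 - x * (P ^ 2) ^ m)).
    clear IH E2. set (s := usum _) in *. set (r := rq _ _) in *. set (d := 1 - (P ^ 2) ^ S m) in *.
    transitivity ((d * s) / d); [field; assumption|]. rewrite E. field. assumption.
Qed.

(** Factor by factor, 1 - x Q^(-i) = -x Q^(-i) (1 - Q^i / x) for i = 1, ..., n; the two powers of Q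
    on the left collect the Q^i. *)
Lemma qpoch_reverse (x Q : C) n : x <> 0 -> Q <> 0 ->
  qpoch (x * zp Q (- Z.of_nat n)) Q n * zp Q (Z.of_nat n)
  * zp Q (Z.of_nat n * (Z.of_nat n - 1) / 2) = (- x) ^ n * qpoch (Q / x) Q n.
Proof.
  intros Hx HQ. induction n as [|n IH].
  - simpl. rewrite !zp_0. ring.
  - set (N := Z.of_nat n) in *.
    assert (HT : (Z.of_nat (S n) * (Z.of_nat (S n) - 1) / 2 = N * (N - 1) / 2 + N)%Z).
    { replace (Z.of_nat (S n) * (Z.of_nat (S n) - 1))%Z with (N * (N - 1) + N * 2)%Z by lia.
      now rewrite Z.div_add by lia. }
    rewrite HT. replace (Z.of_nat (S n)) with (N + 1)%Z by lia.
    rewrite (qpoch_add _ _ 1 n). simpl (qpoch _ _ 1).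
    replace (x * zp Q (- (N + 1)) * Q ^ 1) with (x * zp Q (- N)).
    2: { rewrite <- Cmult_assoc. f_equal. simpl. rewrite Cmult_1_r, <- zp_succ by assumption. f_equal; ring. }
    replace (zp Q (- (N + 1))) with (/ (zp Q N * Q)).
    2: { rewrite zp_opp, zp_succ by assumption; reflexivity. }
    rewrite (zp_add Q (N * (N - 1) / 2)), zp_succ by assumption.
    simpl (qpoch (Q / x) Q (S n)). simpl ((- x) ^ S n).
    assert (Hz := zp_neq0 Q N HQ).
    transitivity ((- x * qpoch (x * zp Q (- N)) Q n * zp Q N * zp Q (N * (N - 1) / 2)) * (1 - Q * zp Q N / x)).
    + field. auto.
    + replace (- x * qpoch (x * zp Q (- N)) Q n * zp Q N * zp Q (N * (N - 1) / 2)) with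
        (- x * ((- x) ^ n * qpoch (Q / x) Q n)) by (rewrite <- IH; ring).
      unfold N. rewrite zp_nat. field. assumption.
Qed.

Definition jacobi_term (P x : C) (n r : Z) : C :=
  zp P (r * r - r) * zp (- x) r * (rq (P ^ 2) (n + r) * rq (P ^ 2) (n - r)).

Lemma summable_jacobi (P x : C) n : base P -> x <> 0 -> summable (jacobi_term P x n).
Proof.
  intros Hb Hx. unfold jacobi_term.
  apply (summable_ext (fun k => zp P (1 * (k * k) + (-1) * k) * zp (- x) k *
    (rq (P ^ 2) (n + k) * rq (P ^ 2) (n - k)))).
  { intros k. do 3 f_equal. ring. }
  apply (summable_gauss P _ _ _ (rq_bound (P ^ 2) * rq_bound (P ^ 2))); auto; try lia.
  - now apply Copp_neq0.
  - left; apply Rmult_lt_0_compat; apply rq_bound_pos.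
  - intros; apply Cmod_rq2. now apply base_sq.
Qed.

Lemma finite_jacobi (P x : C) n : base P -> x <> 0 ->
  usum (jacobi_term P x (Z.of_nat n))
  = qpoch x (P ^ 2) n * qpoch (P ^ 2 / x) (P ^ 2) n * rq (P ^ 2) (2 * Z.of_nat n).
Proof.
  intros Hb Hx. destruct (base_sq P Hb) as [H0 H1]. assert (HP := proj1 Hb).
  set (N := Z.of_nat n). set (Q := P ^ 2) in *.
  (* The q-binomial theorem of order 2n at x Q^(-n), recentred by k = r + n: half of its product is
     (x; Q)_n, the other half reverses into (Q/x; Q)_n. *)
  set (y := x * zp Q (- N)).
  assert (Hy : y <> 0) by (apply Cmult_neq_0; auto using zp_neq0).
  assert (HB := q_binomial P y (n + n) Hb Hy). fold Q in HB.
  replace (Z.of_nat (n + n)) with (2 * N)%Z in HB by lia.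
  rewrite (usum_bij (fun r => r + N)%Z (fun k => k - N)%Z) in HB;
    [|intros; ring|intros; ring|now apply summable_binom].
  assert (HR := qpoch_reverse x Q n Hx H0). fold N in HR.
  assert (HT : (N * (N - 1) = 2 * (N * (N - 1) / 2))%Z).
  { assert (Heven : Z.even (N * (N - 1)) = true).
    { rewrite Z.even_mul, Z.even_sub. destruct (Z.even N); reflexivity. }
    apply Z.even_spec in Heven as [k Hk]. rewrite Hk, (Z.mul_comm 2 k), Z.div_mul; lia. }
  set (T := (N * (N - 1) / 2)%Z) in *.
  rewrite (usum_ext _ (fun r => (- x) ^ n / (zp Q N * zp Q T) * jacobi_term P x N r)) in HB.
  2: { intros r. unfold binom_term, jacobi_term. fold Q.
       replace (2 * N - (r + N))%Z with (N - r)%Z by ring. rewrite (Z.add_comm N r).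
       unfold y. replace (- (x * zp Q (- N))) with ((- x) * zp Q (- N)) by ring.
       rewrite zp_mult_l, (zp_add (- x)), zp_mul by (auto using Copp_neq0).
       replace (zp (- x) N) with ((- x) ^ n) by (unfold N; now rewrite zp_nat).
       assert (HzQ : forall k, zp Q k = zp P (2 * k)) by (intros; now apply zp_sq).
       rewrite !HzQ.
       replace ((r + N) * (r + N) - (r + N))%Z with
         (- (2 * (- N * (r + N))) + ((r * r - r) + (- (2 * N) + - (2 * T))))%Z
         by (rewrite <- HT; ring).
       rewrite !zp_add, !zp_opp by assumption. field.
       repeat split; auto using zp_neq0. }
  rewrite usum_scal in HB by now apply summable_jacobi.
  rewrite qpoch_add in HB. unfold y at 2 in HB.
  replace (x * zp Q (- N) * Q ^ n) with x in HB.
  2: { rewrite <- Cmult_assoc. unfold N. rewrite <- zp_nat, <- zp_add by assumption.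
       rewrite Z.add_opp_diag_l, zp_0; ring. }
  fold y in HR. set (S := usum _) in *.
  assert (Hz1 := zp_neq0 Q N H0). assert (Hz2 := zp_neq0 Q T H0).
  assert (Hx' := Cpow_nz (- x) n (Copp_neq0 x Hx)).
  set (A := qpoch y Q n) in *. set (B := qpoch x Q n) in *. set (D := qpoch (Q / x) Q n) in *.
  set (X := (- x) ^ n) in *. set (z1 := zp Q N) in *. set (z2 := zp Q T) in *.
  transitivity ((X / (z1 * z2) * S) * (z1 * z2) / X); [field; auto|].
  rewrite HB. transitivity ((A * z1 * z2) * B * rq Q (2 * N) / X); [field; auto|].
  rewrite HR; field; auto.
Qed.

Lemma clim_scal (u : nat -> C) c l : clim u l -> clim (fun n => c * u n) (c * l).
Proof. intros H. apply clim_mult; [apply clim_const|assumption]. Qed.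

Lemma clim_subseq (u : nat -> C) (s : nat -> nat) l : (forall n, (n <= s n)%nat) ->
  clim u l -> clim (fun n => u (s n)) l.
Proof.
  intros Hs H e He. destruct (H e He) as [N HN]; exists N; intros n Hn; apply HN.
  specialize (Hs n); lia.
Qed.

Lemma Cmod_qpoch_inf_rq (P : C) : base P -> exists K, (0 <= K)%R /\
  forall z, (Cmod (qpoch_inf (P ^ 2) (P ^ 2) * rq (P ^ 2) z) <= K)%R.
Proof.
  intros Hb. exists (Cmod (qpoch_inf (P ^ 2) (P ^ 2)) * rq_bound (P ^ 2))%R; split.
  - apply Rmult_le_pos; [apply Cmod_ge_0|left; apply rq_bound_pos].
  - intros z. rewrite Cmod_mult. apply Rmult_le_compat_l; [apply Cmod_ge_0|].
    apply Cmod_rq. now apply base_sq.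
Qed.

(** The limit of the finite form, multiplied by the square of (Q; Q)_oo so that both reciprocal
    q-factorials tend to 1 under a uniform bound. *)
Lemma jacobi_triple (P x : C) : base P -> x <> 0 ->
  usum (fun r => zp P (r * r - r) * zp (- x) r)
  = qpoch_inf x (P ^ 2) * qpoch_inf (P ^ 2 / x) (P ^ 2) * qpoch_inf (P ^ 2) (P ^ 2).
Proof.
  intros Hb Hx. destruct (base_sq P Hb) as [H0 H1]. assert (HP := proj1 Hb).
  set (Q := P ^ 2) in *. set (E := qpoch_inf Q Q).
  assert (Hx' : Q / x <> 0).
  { apply Cmult_neq_0; [assumption|]. intros Ei. apply C1_nz.
    rewrite <- (Cinv_r x Hx), Ei; ring. }
  destruct (Cmod_qpoch_inf_rq P Hb) as [K [HK0 HK]]. fold Q E in HK.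
  assert (S0 : summable (fun r => zp P (r * r - r) * zp (- x) r)).
  { apply (summable_ext (fun k => zp P (1 * (k * k) + (-1) * k) * zp (- x) k * 1)).
    { intros k. rewrite Cmult_1_r. do 2 f_equal. ring. }
    apply (summable_gauss P _ _ _ 1); auto; try lia; try lra.
    - now apply Copp_neq0.
    - intros; rewrite Cmod_1; lra. }
  destruct S0 as [M HM].
  apply (clim_unique (fun n => usum (fun r => (E * E) * jacobi_term P x (Z.of_nat n) r))).
  - apply (usum_dominated _ _ (fun r => (K * K * Cmod (zp P (r * r - r) * zp (- x) r))%R) (K * K * M)).
    + intros n r. unfold jacobi_term; fold Q.
      replace (E * E * (zp P (r * r - r) * zp (- x) r * (rq Q (Z.of_nat n + r) * rq Q (Z.of_nat n - r))))
        with ((zp P (r * r - r) * zp (- x) r) * ((E * rq Q (Z.of_nat n + r)) * (E * rq Q (Z.of_nat n - r)))) by ring.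
      rewrite Cmod_mult, Rmult_comm. apply Rmult_le_compat_r; [apply Cmod_ge_0|].
      rewrite Cmod_mult. apply Rmult_le_compat; auto using Cmod_ge_0.
    + intros l Nl. rewrite rsum_scal. apply Rmult_le_compat_l; [now apply Rmult_le_pos|now apply HM].
    + intros r.
      apply (clim_ext (fun n => (zp P (r * r - r) * zp (- x) r) *
        ((E * rq Q (r + Z.of_nat n)) * (E * rq Q (- r + Z.of_nat n))))).
      { intros n; unfold jacobi_term; fold Q. rewrite (Z.add_comm r), (Z.add_comm (- r)). unfold Z.sub.
        ring. }
      match goal with |- clim ?u ?l => enough (HL : clim u (l * (1 * 1)))
        by (rewrite !Cmult_1_r in HL; exact HL) end.
      apply clim_scal, clim_mult; now apply rq_lim.
  - apply (clim_ext (fun n => (qpoch x Q n * qpoch (Q / x) Q n) * (E * (E * rq Q (0 + Z.of_nat (2 * n)))))).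
    + intros n. rewrite usum_scal by now apply summable_jacobi.
      rewrite finite_jacobi by assumption. fold Q.
      replace (0 + Z.of_nat (2 * n))%Z with (2 * Z.of_nat n)%Z by lia. ring.
    + apply clim_mult; [apply clim_mult; now apply qpoch_lim|].
      match goal with |- clim ?u ?l => enough (HL : clim u (l * 1))
        by (rewrite !Cmult_1_r in HL; exact HL) end.
      apply clim_scal.
      apply (clim_subseq (fun n => E * rq Q (0 + Z.of_nat n)) (fun n => 2 * n)%nat); [intros; lia|].
      now apply rq_lim.
Qed.

Definition theta (a z : C) : C := usum (fun n => zp a (n * n) * zp z n).

Lemma summable_theta (a z : C) : base a -> z <> 0 -> summable (fun n => zp a (n * n) * zp z n).
Proof.
  intros Hb Hz.
  apply (summable_ext (fun k => zp a (1 * (k * k) + 0 * k) * zp z k * 1)).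
  { intros k. rewrite Cmult_1_r. do 2 f_equal. ring. }
  apply (summable_gauss a _ _ _ 1); auto; try lia; try lra.
  intros; rewrite Cmod_1; lra.
Qed.

Lemma theta_prod (a z : C) : base a -> z <> 0 ->
  theta a z = qpoch_inf (- (a * z)) (a ^ 2) * qpoch_inf (- (a / z)) (a ^ 2) * qpoch_inf (a ^ 2) (a ^ 2).
Proof.
  intros Hb Hz. assert (Ha := proj1 Hb). unfold theta.
  replace (- (a / z)) with (a ^ 2 / - (a * z)).
  - rewrite <- jacobi_triple by (auto using Copp_neq0, Cmult_neq_0).
    apply usum_ext; intros n. replace (- - (a * z)) with (a * z) by ring.
    rewrite zp_mult_l. replace (n * n)%Z with ((n * n - n) + n)%Z at 1 by ring.
    rewrite zp_add by assumption. ring.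
  - simpl. field. split; auto.
Qed.

(** * Two sums for Bailey's lemma *)

(** Here P^(2r^2) is Q^(r^2). With [gauss_sum] this is the Bailey pair relative to 1 with beta_n =
    1/(Q^2; Q^2)_n, written over all integers r. *)
Definition gauss_term (P : C) (n r : Z) : C :=
  zp (-1) r * zp P (2 * (r * r)) * (rq (P ^ 2) (n - r) * rq (P ^ 2) (n + r)).

Lemma Cmod_m1_zp k : Cmod (zp (-1) k) = 1%R.
Proof.
  unfold zp. rewrite Cmod_div by (apply Cpow_nz, Cm1_neq0).
  rewrite !Cmod_pow. replace (Cmod (-1)) with 1%R.
  - rewrite !pow1; field.
  - rewrite Cmod_R. unfold Rabs; destruct (Rcase_abs (-1)); lra.
Qed.

Lemma summable_gauss_signed (P : C) a b K (g : Z -> C) : base P -> (0 < a)%Z -> (0 <= K)%R ->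
  (forall k, (Cmod (g k) <= K)%R) ->
  summable (fun k => zp (-1) k * zp P (a * (k * k) + b * k) * g k).
Proof.
  intros Hb Ha HK Hg.
  apply (summable_ext (fun k => zp P (a * (k * k) + b * k) * zp (-1) k * g k)); [intros; ring|].
  apply (summable_gauss P _ a b K); auto using Cm1_neq0.
Qed.

Lemma summable_gauss_term (P : C) n : base P -> summable (gauss_term P n).
Proof.
  intros Hb. unfold gauss_term.
  apply (summable_ext (fun r => zp (-1) r * zp P (2 * (r * r) + 0 * r) *
    (rq (P ^ 2) (n - r) * rq (P ^ 2) (n + r)))).
  { intros k. do 3 f_equal. ring. }
  apply (summable_gauss_signed P 2 0 (rq_bound (P ^ 2) * rq_bound (P ^ 2))); auto; try lia.
  - left; apply Rmult_lt_0_compat; apply rq_bound_pos.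
  - intros; apply Cmod_rq2. now apply base_sq.
Qed.

Lemma zp_m1_opp k : zp (-1) (- k) = zp (-1) k.
Proof.
  replace (- k)%Z with (k + 2 * (- k))%Z by ring.
  rewrite zp_add, zp_m1_even by apply Cm1_neq0. ring.
Qed.

Lemma zp_m1_succ k : zp (-1) (k + 1) = - zp (-1) k.
Proof. rewrite zp_succ by apply Cm1_neq0. ring. Qed.

Lemma usum_neg (f : Z -> C) : summable f -> usum f = usum (fun k => f (- k)%Z).
Proof.
  intros H. apply (usum_bij (fun k => - k)%Z (fun k => - k)%Z); auto; intros; ring.
Qed.

Lemma usum_antisym (f : Z -> C) (s : Z -> Z) : summable f -> (forall k, s (s k) = k) ->
  (forall k, f (s k) = - f k) -> usum f = 0.
Proof.
  intros H Hs Hf. assert (E : usum f = -1 * usum f).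
  { rewrite <- usum_scal by assumption. rewrite (usum_bij s s) by assumption.
    apply usum_ext; intros k; rewrite Hf; ring. }
  assert (E2 : (2 : C) <> 0).
  { intros E2. apply RtoC_inj in E2; lra. }
  transitivity ((usum f - -1 * usum f) / 2); [field; assumption|].
  rewrite <- E. field.
Qed.

(** 1 - Q^(2n) = (1 - Q^(n-r)) + Q^(n-r) (1 - Q^(n+r)) splits the left side into u and v. Reflection
    r -> -r turns v into w, which is antisymmetric under r -> -1 - r and sums to 0; the right side
    is u - w. *)
Lemma gauss_rec (P : C) n : base P ->
  (1 - zp (P ^ 2) (2 * n)) * usum (gauss_term P n) = usum (gauss_term P (n - 1)).
Proof.
  intros Hb. destruct (base_sq P Hb) as [H0 H1]. assert (HP := proj1 Hb).
  set (Q := P ^ 2) in *.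
  assert (S1 := summable_gauss_term P n Hb). assert (S2 := summable_gauss_term P (n - 1) Hb).
  assert (Sg : forall a b c, summable (fun r => zp (-1) r * zp P (2 * (r * r) + c * r) *
    (rq Q (a - r) * rq Q (b + r)))).
  { intros a b c. apply (summable_gauss_signed P 2 c (rq_bound Q * rq_bound Q)); auto; try lia.
    - left; apply Rmult_lt_0_compat; apply rq_bound_pos.
    - intros; now apply Cmod_rq2. }
  set (u := fun r => zp (-1) r * zp P (2 * (r * r) + 0 * r) * (rq Q (n - 1 - r) * rq Q (n + r))).
  set (v := fun r => zp Q n * (zp (-1) r * zp P (2 * (r * r) + (-2) * r) * (rq Q (n - r) * rq Q (n - 1 + r)))).
  set (w := fun r => zp Q n * (zp (-1) r * zp P (2 * (r * r) + 2 * r) * (rq Q (n - 1 - r) * rq Q (n + r)))).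
  assert (Su : summable u) by apply Sg.
  assert (Sv : summable v) by apply summable_scal, Sg.
  assert (Sw : summable w) by apply summable_scal, Sg.
  assert (HzQ : forall k, zp Q k = zp P (2 * k)) by (intros; now apply zp_sq).
  assert (E1 : usum (fun r => (1 - zp Q (2 * n)) * gauss_term P n r) = usum u + usum v).
  { rewrite <- usum_plus by assumption. apply usum_ext; intros r; unfold u, v, gauss_term; fold Q.
    assert (A1 := rq_rec Q (n - r) H1). replace (n - r - 1)%Z with (n - 1 - r)%Z in A1 by ring.
    assert (A2 := rq_rec Q (n + r) H1). replace (n + r - 1)%Z with (n - 1 + r)%Z in A2 by ring.
    rewrite <- A1, <- A2.
    replace (2 * n)%Z with ((n - r) + (n + r))%Z by ring.
    rewrite (zp_add Q) by assumption.
    replace (2 * (r * r) + 0 * r)%Z with (2 * (r * r))%Z by ring.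
    assert (A3 : zp Q n * zp P (2 * (r * r) + -2 * r) = zp P (2 * (r * r)) * zp Q (n - r)).
    { rewrite !HzQ, <- !zp_add by assumption. f_equal; ring. }
    transitivity (zp (-1) r * zp P (2 * (r * r)) * ((1 - zp Q (n - r)) * rq Q (n - r) * rq Q (n + r)) +
      zp (-1) r * (zp P (2 * (r * r)) * zp Q (n - r)) * (rq Q (n - r) * ((1 - zp Q (n + r)) * rq Q (n + r)))).
    - ring.
    - rewrite <- A3; ring. }
  assert (E2 : usum v = usum w).
  { rewrite (usum_neg v) by assumption. apply usum_ext; intros r; unfold v, w.
    rewrite zp_m1_opp. replace (2 * (- r * - r) + -2 * - r)%Z with (2 * (r * r) + 2 * r)%Z by ring.
    replace (n - - r)%Z with (n + r)%Z by ring. replace (n - 1 + - r)%Z with (n - 1 - r)%Z by ring. ring. }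
  assert (E3 : usum w = 0).
  { apply (usum_antisym w (fun r => - 1 - r)%Z); [assumption|intros; ring|].
    intros r; unfold w. replace (-1 - r)%Z with (- (r + 1))%Z by ring.
    rewrite zp_m1_opp, zp_m1_succ.
    replace (2 * (- (r + 1) * - (r + 1)) + 2 * - (r + 1))%Z with (2 * (r * r) + 2 * r)%Z by ring.
    replace (n - 1 - - (r + 1))%Z with (n + r)%Z by ring.
    replace (n + - (r + 1))%Z with (n - 1 - r)%Z by ring. ring. }
  assert (E4 : usum (gauss_term P (n - 1)) = usum u - usum w).
  { rewrite <- usum_minus by assumption. apply usum_ext; intros r; unfold u, w, gauss_term; fold Q.
    assert (A2 := rq_rec Q (n + r) H1). replace (n + r - 1)%Z with (n - 1 + r)%Z in A2 by ring.
    rewrite <- A2. replace (2 * (r * r) + 0 * r)%Z with (2 * (r * r))%Z by ring.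
    assert (A3 : zp Q n * zp P (2 * (r * r) + 2 * r) = zp P (2 * (r * r)) * zp Q (n + r)).
    { rewrite !HzQ, <- !zp_add by assumption. f_equal; ring. }
    transitivity (zp (-1) r * zp P (2 * (r * r)) * (rq Q (n - 1 - r) * rq Q (n + r)) -
      zp (-1) r * (zp P (2 * (r * r)) * zp Q (n + r)) * (rq Q (n - 1 - r) * rq Q (n + r))).
    - ring.
    - rewrite <- A3; ring. }
  rewrite <- usum_scal, E1, E4, E2, E3 by assumption. ring.
Qed.

Lemma rq_sq_rec (Q : C) n : base Q -> (1 - zp Q (2 * n)) * rq (Q ^ 2) n = rq (Q ^ 2) (n - 1).
Proof.
  intros Hb. rewrite <- (zp_sq Q n) by apply Hb. apply rq_rec. apply (base_sq Q Hb).
Qed.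

Lemma gauss_sum (P : C) n : base P -> usum (gauss_term P n) = rq ((P ^ 2) ^ 2) n.
Proof.
  intros Hb. assert (HQ := base_sq P Hb).
  destruct (Z.le_gt_cases 0 n) as [Hn|Hn].
  - destruct (Z_of_nat_complete n Hn) as [m ->]. clear Hn. induction m as [|m IH].
    + simpl (Z.of_nat 0). rewrite rq_0, (usum_single _ 0%Z).
      * unfold gauss_term. simpl. rewrite !zp_0, !rq_0; ring.
      * intros k Hk; unfold gauss_term. destruct (Z.lt_trichotomy k 0) as [H|[H|H]]; [|lia|].
        -- rewrite (rq_neg _ (0 + k)) by lia; ring.
        -- rewrite (rq_neg _ (0 - k)) by lia; ring.
    + assert (E1 := gauss_rec P (Z.of_nat (S m)) Hb).
      assert (E2 := rq_sq_rec (P ^ 2) (Z.of_nat (S m)) HQ).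
      replace (Z.of_nat (S m) - 1)%Z with (Z.of_nat m) in E1, E2 by lia.
      rewrite IH, <- E2 in E1.
      assert (HN : 1 - zp (P ^ 2) (2 * Z.of_nat (S m)) <> 0).
      { rewrite zp_pow by lia. replace (Z.to_nat (2 * Z.of_nat (S m))) with (S (2 * m + 1)) by lia.
        apply one_minus_neq0, Cmod_pow_lt1, HQ. }
      set (d := 1 - _) in *.
      transitivity ((d * usum (gauss_term P (Z.of_nat (S m)))) / d); [field; assumption|].
      rewrite E1; field; assumption.
  - rewrite rq_neg by assumption. apply usum_zero; intros r; unfold gauss_term.
    destruct (Z.le_gt_cases r 0).
    + rewrite (rq_neg _ (n + r)) by lia; ring.
    + rewrite (rq_neg _ (n - r)) by lia; ring.
Qed.

Definition qpz (a Q : C) (k : Z) : C := qpoch a Q (Z.to_nat k).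

Lemma qpz_succ (a Q : C) k : (0 <= k)%Z -> qpz a Q (k + 1) = qpz a Q k * (1 - a * zp Q k).
Proof.
  intros H. unfold qpz. replace (Z.to_nat (k + 1)) with (S (Z.to_nat k)) by lia.
  rewrite zp_pow by assumption. reflexivity.
Qed.

Definition qp_bound (a Q : C) : R := exp (Cmod a / (1 - Cmod Q)).

Lemma Cmod_qpz (a Q : C) k : (Cmod Q < 1)%R -> (Cmod (qpz a Q k) <= qp_bound a Q)%R.
Proof. intros; now apply qpoch_bound. Qed.

Lemma Cmod_mult_le (x y : C) a b : (Cmod x <= a)%R -> (Cmod y <= b)%R -> (Cmod (x * y) <= a * b)%R.
Proof. intros; rewrite Cmod_mult; apply Rmult_le_compat; auto using Cmod_ge_0. Qed.

Definition conj_term (P a b : C) (m k : Z) : C :=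
  zp P (k * k - k) * zp (- b) k * (qpz a (P ^ 2) k * (rq (P ^ 2) k * rq (P ^ 2) (m + k))).

Lemma summable_conj (P a b : C) m : base P -> b <> 0 -> summable (conj_term P a b m).
Proof.
  intros Hb Hx. unfold conj_term.
  apply (summable_ext (fun k => zp P (1 * (k * k) + (-1) * k) * zp (- b) k *
    (qpz a (P ^ 2) k * (rq (P ^ 2) k * rq (P ^ 2) (m + k))))).
  { intros k. do 3 f_equal. ring. }
  apply (summable_gauss P _ _ _ (qp_bound a (P ^ 2) * (rq_bound (P ^ 2) * rq_bound (P ^ 2)))); auto; try lia.
  - now apply Copp_neq0.
  - left; repeat apply Rmult_lt_0_compat; apply exp_pos.
  - intros; apply Cmod_mult_le; [apply Cmod_qpz|apply Cmod_rq2]; now apply base_sq.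
Qed.

(** The certificate 1 - Q^k of Euler's series again. The relation a b = Q^(m+1) lets 1 - a Q^k
    combine with the denominator of index m + k, and is preserved by (b, m) -> (b Q, m + 1). *)
Lemma conj_rec (P a b : C) m : base P -> b <> 0 -> a * b = zp (P ^ 2) (m + 1) ->
  usum (conj_term P a b m) = (1 - b) * usum (conj_term P a (b * P ^ 2) (m + 1)).
Proof.
  intros Hb Hx Hab. destruct (base_sq P Hb) as [H0 H1]. assert (HP := proj1 Hb).
  assert (Hx2 : b * P ^ 2 <> 0) by now apply Cmult_neq_0.
  set (Q := P ^ 2) in *.
  assert (S1 := summable_conj P a b m Hb Hx). assert (S2 := summable_conj P a _ (m + 1) Hb Hx2).
  set (u := fun k => (1 - zp Q k) * conj_term P a b m k).
  assert (HzQ : forall k, zp Q k = zp P (2 * k)) by (intros; now apply zp_sq).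
  assert (Hu : forall k, conj_term P a b m k - (1 - b) * conj_term P a (b * Q) (m + 1) k = u k - u (k + 1)%Z).
  { intros k. unfold u, conj_term. fold Q.
    replace (- (b * Q)) with ((- b) * Q) by ring. rewrite zp_mult_l.
    destruct (Z.le_gt_cases 0 k) as [Hk|Hk].
    - rewrite qpz_succ by assumption.
      replace ((k + 1) * (k + 1) - (k + 1))%Z with ((k * k - k) + 2 * k)%Z by ring.
      rewrite (zp_add P), <- HzQ, (zp_succ (- b)) by (auto using Copp_neq0).
      assert (A1 := rq_rec Q (k + 1) H1). replace (k + 1 - 1)%Z with k in A1 by ring.
      assert (A2 := rq_rec Q (m + 1 + k) H1). replace (m + 1 + k - 1)%Z with (m + k)%Z in A2 by ring.
      rewrite zp_add, <- Hab in A2 by assumption.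
      replace (m + (k + 1))%Z with (m + 1 + k)%Z by ring.
      rewrite <- A2, <- A1. ring.
    - rewrite (rq_neg Q k) by assumption.
      destruct (Z.eq_dec k (-1)) as [->|Hk'].
      + simpl. rewrite zp_0; ring.
      + rewrite (rq_neg Q (k + 1)) by lia; ring. }
  assert (Su : summable u).
  { apply (summable_ext (fun k => conj_term P a b m k - conj_term P a (b * Q) m k)).
    - intros k. unfold u, conj_term. replace (- (b * Q)) with ((- b) * Q) by ring.
      rewrite zp_mult_l. ring.
    - apply summable_minus; [assumption|now apply summable_conj]. }
  assert (E := usum_telescope u Su).
  rewrite <- (usum_ext _ _ Hu), usum_minus, usum_scal in E by auto using summable_scal.
  replace (usum (conj_term P a b m)) with (usum (conj_term P a b m)
    - (1 - b) * usum (conj_term P a (b * Q) (m + 1)) + (1 - b) * usum (conj_term P a (b * Q) (m + 1))) by ring.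
  rewrite E; ring.
Qed.

Lemma conj_iter (P a b : C) m n : base P -> b <> 0 -> a * b = zp (P ^ 2) (m + 1) ->
  usum (conj_term P a b m) =
  qpoch b (P ^ 2) n * usum (conj_term P a (b * (P ^ 2) ^ n) (m + Z.of_nat n)).
Proof.
  intros Hb Hx Hab. destruct (base_sq P Hb) as [H0 H1].
  induction n as [|n IH].
  - replace (b * (P ^ 2) ^ 0) with b by (simpl; ring). rewrite Z.add_0_r.
    change (qpoch b (P ^ 2) 0) with (1 : C). ring.
  - rewrite IH, conj_rec; [|assumption|apply Cmult_neq_0; [assumption|now apply Cpow_nz]|].
    + rewrite (Cpow_S (P ^ 2) n).
      change (qpoch b (P ^ 2) (S n)) with (qpoch b (P ^ 2) n * (1 - b * (P ^ 2) ^ n)).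
      replace (m + Z.of_nat n + 1)%Z with (m + Z.of_nat (S n))%Z by lia.
      set (Q := P ^ 2). replace (b * Q ^ n * Q) with (b * (Q * Q ^ n)) by ring. ring.
    + rewrite Cmult_assoc, Hab, <- (zp_nat (P ^ 2)), <- zp_add by assumption. f_equal; lia.
Qed.

(* The limit case [sum_k (a)_k (-c/a)^k Q^(k(k-1)/2) / ((Q)_k (c)_k) = (c/a)_oo / (c)_oo]
   of the q-Gauss sum, with [b = c/a], [c = Q^(m+1)]. *)
Lemma conj_sum (P a b : C) m : base P -> b <> 0 -> a * b = zp (P ^ 2) (m + 1) ->
  qpoch_inf (P ^ 2) (P ^ 2) * usum (conj_term P a b m) = qpoch_inf b (P ^ 2).
Proof.
  intros Hb Hx Hab. destruct (base_sq P Hb) as [H0 H1].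
  set (Q := P ^ 2) in *. set (E := qpoch_inf Q Q).
  apply (clim_unique (fun n => qpoch b Q n * (E * usum (conj_term P a (b * Q ^ n) (m + Z.of_nat n))))).
  - apply (clim_ext (fun _ => E * usum (conj_term P a b m))).
    + intros n. rewrite (conj_iter P a b m n) by assumption. fold Q. ring.
    + apply clim_const.
  - match goal with |- clim ?u ?l => enough (HL : clim u (l * 1))
        by (rewrite Cmult_1_r in HL; exact HL) end.
    apply clim_mult; [now apply qpoch_lim|].
    destruct (Cmod_qpoch_inf_rq P Hb) as [K [HK0 HK]]. fold Q E in HK.
    set (B := fun k => zp P (1 * (k * k) + (-1) * k) * zp (- b) k * (qpz a Q k * rq Q k)).
    replace (1 : C) with (B 0%Z).
    2: { unfold B. simpl (1 * (0 * 0) + -1 * 0)%Z. rewrite !zp_0, rq_0.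
         unfold qpz; simpl (qpoch a Q _). ring. }
    apply (clim_ext (fun n => usum (fun k => zp (Q ^ n) k * B k * (E * rq Q (m + k + Z.of_nat n))))).
    + intros n. rewrite <- usum_scal.
      * apply usum_ext; intros k; unfold conj_term, B; fold Q.
        replace (- (b * Q ^ n)) with ((- b) * Q ^ n) by ring.
        rewrite zp_mult_l. replace (1 * (k * k) + -1 * k)%Z with (k * k - k)%Z by ring.
        replace (m + Z.of_nat n + k)%Z with (m + k + Z.of_nat n)%Z by ring. ring.
      * apply summable_conj; [assumption|]. apply Cmult_neq_0; [assumption|now apply Cpow_nz].
    + apply (usum_scale_lim Q B (fun n k => E * rq Q (m + k + Z.of_nat n)) K); auto.
      * apply (summable_gauss P _ _ _ (qp_bound a Q * rq_bound Q)); auto; try lia.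
        -- now apply Copp_neq0.
        -- left; repeat apply Rmult_lt_0_compat; apply exp_pos.
        -- intros; apply Cmod_mult_le; [now apply Cmod_qpz|now apply Cmod_rq].
      * intros k Hk; unfold B. rewrite rq_neg by assumption; ring.
      * intros k; now apply rq_lim.
Qed.

(** * An alternating q-series *)

Lemma Zabs_le_sq n : (Z.abs n <= n * n)%Z.
Proof. destruct (Z.abs_spec n) as [[? ->]|[? ->]]; nia. Qed.

(** The coefficients are (P; Q)_k / (Q^2; Q^2)_k with Q = P^2. The summation formula concerns w =
    -1; general w is kept for the q-difference equation. *)
Definition slater_term (P w : C) (k : Z) : C :=
  zp P (1 * (k * k) + 0 * k) * zp w k * (qpz P (P ^ 2) k * rq ((P ^ 2) ^ 2) k).

Lemma summable_slater (P w : C) : base P -> w <> 0 -> summable (slater_term P w).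
Proof.
  intros Hb Hw. unfold slater_term.
  apply (summable_gauss P _ _ _ (qp_bound P (P ^ 2) * rq_bound ((P ^ 2) ^ 2))); auto; try lia.
  - left; repeat apply Rmult_lt_0_compat; apply exp_pos.
  - intros; apply Cmod_mult_le; [apply Cmod_qpz|apply Cmod_rq]; repeat apply base_sq; assumption.
Qed.

Lemma qpz_add (a Q : C) r k : (0 <= r)%Z -> (0 <= k)%Z ->
  qpz a Q (k + r) = qpz a Q r * qpz (a * zp Q r) Q k.
Proof.
  intros Hr Hk. unfold qpz. rewrite Z2Nat.inj_add, Nat.add_comm, qpoch_add, zp_pow by assumption.
  reflexivity.
Qed.

(** The series at w = -1 with 1/(Q^2; Q^2)_n expanded by the Bailey pair, ready for exchanging the
    two summations. *)
Definition slater_double (P : C) (x : Z * Z) : C :=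
  zp (-1) (fst x) * zp P (fst x * fst x) * qpz P (P ^ 2) (fst x) * gauss_term P (fst x) (snd x).

Lemma summable_slater_double (P : C) : base P -> summable (slater_double P).
Proof.
  intros Hb. assert (HP := proj1 Hb). assert (HQ := base_sq P Hb).
  set (K := (qp_bound P (P ^ 2) * (rq_bound (P ^ 2) * rq_bound (P ^ 2)))%R).
  assert (HK : (0 <= K)%R) by (left; repeat apply Rmult_lt_0_compat; apply exp_pos).
  apply (summable_Z2 P K 0); auto.
  intros n r. right. exists (n * n + 2 * (r * r))%Z; split.
  { generalize (Zabs_le_sq n), (Zabs_le_sq r); lia. }
  unfold slater_double, gauss_term; simpl fst; simpl snd.
  replace (zp (-1) n * zp P (n * n) * qpz P (P ^ 2) n *
    (zp (-1) r * zp P (2 * (r * r)) * (rq (P ^ 2) (n - r) * rq (P ^ 2) (n + r))))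
  with ((zp (-1) n * zp (-1) r) * (qpz P (P ^ 2) n * (rq (P ^ 2) (n - r) * rq (P ^ 2) (n + r)))
    * zp P (n * n + 2 * (r * r))) by (rewrite zp_add by assumption; ring).
  rewrite Cmod_mult. apply Rmult_le_compat_r; [apply Cmod_ge_0|].
  rewrite Cmod_mult, Cmod_mult, !Cmod_m1_zp, !Rmult_1_l.
  apply Cmod_mult_le; [apply Cmod_qpz|apply Cmod_rq2]; apply HQ.
Qed.

(** With n = k + r the fibre becomes the q-Gauss limit for a = b = P^(2r+1) and m = 2r, since a b =
    Q^(2r+1); then (P; Q)_r and (P^(2r+1); Q)_oo recombine. *)
Lemma slater_fibre (P : C) r : base P -> (0 <= r)%Z ->
  qpoch_inf (P ^ 2) (P ^ 2) * usum (fun n => slater_double P (n, r))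
  = zp P (3 * (r * r)) * qpoch_inf P (P ^ 2).
Proof.
  intros Hb Hr. assert (HP := proj1 Hb). destruct (base_sq P Hb) as [H0 H1].
  set (Q := P ^ 2) in *.
  assert (HzQ : forall k, zp Q k = zp P (2 * k)) by (intros; now apply zp_sq).
  set (b := P * zp Q r).
  assert (Hbn : b <> 0) by (apply Cmult_neq_0; auto using zp_neq0).
  assert (Eb : b = zp P (2 * r + 1)) by (unfold b; rewrite zp_succ, <- HzQ by assumption; ring).
  rewrite (usum_bij (fun k => k + r)%Z (fun k => k - r)%Z); [|intros; ring|intros; ring|].
  2: { apply (summable_comp (fun n => (n, r)) (slater_double P)); [congruence|].
       now apply summable_slater_double. }
  rewrite (usum_ext _ (fun k => (zp P (3 * (r * r)) * qpz P Q r) * conj_term P b b (2 * r) k)).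
  - rewrite usum_scal by now apply summable_conj.
    transitivity ((zp P (3 * (r * r)) * qpz P Q r) * (qpoch_inf Q Q * usum (conj_term P b b (2 * r)))); [ring|].
    assert (CS : qpoch_inf Q Q * usum (conj_term P b b (2 * r)) = qpoch_inf b Q).
    { apply conj_sum; auto. fold Q. rewrite Eb, <- zp_add, HzQ by assumption. f_equal; ring. }
    rewrite CS. unfold qpz. unfold Q at 3. rewrite (qpoch_inf_split P P (Z.to_nat r)) by assumption.
      fold Q. rewrite <- (zp_pow Q r) by assumption. fold b. ring.
  - intros k. unfold slater_double, gauss_term, conj_term; simpl fst; simpl snd. fold Q.
    destruct (Z.le_gt_cases 0 k) as [Hk|Hk].
    2: { replace (k + r - r)%Z with k by ring. rewrite !(rq_neg Q k) by assumption; ring. }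
    rewrite qpz_add by assumption. fold b.
    replace (k + r - r)%Z with k by ring. replace (k + r + r)%Z with (2 * r + k)%Z by ring.
    replace (- b) with (-1 * b) by ring. rewrite zp_mult_l, (zp_add (-1)) by apply Cm1_neq0.
    replace (zp b k) with (zp P ((2 * r + 1) * k)) by (rewrite Eb, zp_mul; auto).
    assert (E1 : zp (-1) r * zp (-1) r = 1).
    { rewrite <- zp_add by apply Cm1_neq0. replace (r + r)%Z with (2 * r)%Z by ring. apply zp_m1_even. }
    assert (E2 : zp P ((k + r) * (k + r)) * zp P (2 * (r * r)) =
      zp P (3 * (r * r)) * (zp P (k * k - k) * zp P ((2 * r + 1) * k))).
    { rewrite <- !zp_add by assumption. f_equal; ring. }
    transitivity (zp (-1) k * (zp (-1) r * zp (-1) r) * (zp P ((k + r) * (k + r)) * zp P (2 * (r * r)))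
      * (qpz P Q r * qpz b Q k) * (rq Q k * rq Q (2 * r + k))); [ring|].
    rewrite E1, E2; ring.
Qed.

Lemma slater_sum (P : C) : base P ->
  qpoch_inf (P ^ 2) (P ^ 2) * usum (slater_term P (-1)) = qpoch_inf P (P ^ 2) * theta (P ^ 3) 1.
Proof.
  intros Hb. assert (HP := proj1 Hb).
  assert (SD := summable_slater_double P Hb).
  assert (E1 : usum (slater_term P (-1)) = usum (slater_double P)).
  { rewrite usum_fst by assumption. apply usum_ext; intros n.
    unfold slater_double; simpl fst; simpl snd.
    rewrite usum_scal by now apply summable_gauss_term.
    rewrite gauss_sum by assumption. unfold slater_term.
    replace (1 * (n * n) + 0 * n)%Z with (n * n)%Z by ring. ring. }
  rewrite E1, usum_snd, <- usum_scal by (auto using summable_snd).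
  unfold theta. rewrite <- usum_scal.
  2: { apply summable_theta; [now apply base_pow|apply C1_nz]. }
  apply usum_ext; intros r. rewrite zp_1_l, Cmult_1_r.
  assert (E3 : zp (P ^ 3) (r * r) = zp P (3 * (r * r))).
  { rewrite <- (zp_mul P 3) by assumption. rewrite (zp_pow P 3) by lia. reflexivity. }
  rewrite E3. destruct (Z.le_gt_cases 0 r) as [Hr|Hr].
  - rewrite slater_fibre by assumption. ring.
  (* The summand is even in r, which reduces negative r to the previous case. *)
  - rewrite (usum_ext _ (fun n => slater_double P (n, (- r)%Z))).
    + rewrite slater_fibre by (auto; lia). replace (- r * - r)%Z with (r * r)%Z by ring. ring.
    + intros n; unfold slater_double, gauss_term; simpl fst; simpl snd.
      rewrite zp_m1_opp. replace (- r * - r)%Z with (r * r)%Z by ring.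
      replace (n - - r)%Z with (n + r)%Z by ring. replace (n + - r)%Z with (n - r)%Z by ring. ring.
Qed.

(** The difference of the series at w and w Q^2 carries 1 - Q^(2k), which cancels one factor of
    (Q^2; Q^2)_k. After k -> k + 1 the new factor 1 - P Q^k of the numerator yields terms at w Q and
    w Q^2. *)
Lemma slater_rec (P w : C) : base P -> w <> 0 ->
  usum (slater_term P w) = (1 - w * P ^ 2) * usum (slater_term P (w * (P ^ 2) ^ 2))
    + P * w * usum (slater_term P (w * P ^ 2)).
Proof.
  intros Hb Hw. assert (HP := proj1 Hb). assert (HQ := base_sq P Hb). destruct HQ as [H0 H1].
  set (Q := P ^ 2) in *.
  assert (HzQ : forall k, zp Q k = zp P (2 * k)) by (intros; now apply zp_sq).
  assert (Hw1 : w * Q <> 0) by now apply Cmult_neq_0.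
  assert (Hw2 : w * Q ^ 2 <> 0) by (apply Cmult_neq_0; [assumption|now apply Cpow_nz]).
  assert (S0 := summable_slater P w Hb Hw). assert (S1 := summable_slater P _ Hb Hw1).
  assert (S2 := summable_slater P _ Hb Hw2).
  set (u := fun k => slater_term P w k - slater_term P (w * Q ^ 2) k).
  assert (Su : summable u) by now apply summable_minus.
  assert (EQ2 : forall k, zp (Q ^ 2) k = zp Q (2 * k)) by (intros; now apply zp_sq).
  assert (Hu : forall k, u (k + 1)%Z = w * P * slater_term P (w * Q) k + (- (w * P * P)) * slater_term P (w * Q ^ 2) k).
  { intros k. unfold u, slater_term. fold Q. rewrite !zp_mult_l, !EQ2.
    destruct (Z.le_gt_cases 0 k) as [Hk|Hk].
    - assert (A1 := rq_sq_rec Q (k + 1) (conj H0 H1)). replace (k + 1 - 1)%Z with k in A1 by ring.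
      rewrite <- A1, qpz_succ, (zp_succ w) by assumption.
      replace (1 * ((k + 1) * (k + 1)) + 0 * (k + 1))%Z with ((1 * (k * k) + 0 * k) + (2 * k + 1))%Z by ring.
      rewrite (zp_add P), (zp_succ P), <- HzQ by assumption.
      replace (2 * k)%Z with (k + k)%Z by ring. rewrite (zp_add Q k k) by assumption. ring.
    - rewrite (rq_neg _ k) by assumption. destruct (Z.eq_dec k (-1)) as [->|Hk'].
      + simpl (-1 + 1)%Z. simpl (2 * 0)%Z. rewrite (zp_0 Q). ring.
      + rewrite (rq_neg _ (k + 1)) by lia. ring. }
  assert (E : usum (slater_term P w) - usum (slater_term P (w * Q ^ 2)) =
    w * P * usum (slater_term P (w * Q)) + (- (w * P * P)) * usum (slater_term P (w * Q ^ 2))).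
  { rewrite <- usum_minus by assumption. fold u. rewrite <- (usum_shift u), (usum_ext _ _ Hu) by assumption.
    rewrite usum_plus, !usum_scal; auto using summable_scal. }
  replace (usum (slater_term P w)) with
    (usum (slater_term P w) - usum (slater_term P (w * Q ^ 2)) + usum (slater_term P (w * Q ^ 2))) by ring.
  rewrite E. set (U1 := usum (slater_term P (w * Q))). set (U2 := usum (slater_term P (w * Q ^ 2))).
  assert (EPP : Q = P * P) by apply Cpow2. rewrite EPP; ring.
Qed.

(** No Gaussian factor, so convergence comes from |w| < 1. This is the shape in which the smoothed
    triple sums will appear. *)
Definition heine_term (P w : C) (k : Z) : C :=
  zp w k * (qpz (- P) (P ^ 2) k * rq ((P ^ 2) ^ 2) k).

Lemma summable_heine (P w : C) : base P -> base w -> summable (heine_term P w).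
Proof.
  intros Hb Hw. assert (HQ := base_sq P Hb).
  set (K := (qp_bound (- P) (P ^ 2) * rq_bound ((P ^ 2) ^ 2))%R).
  assert (HK : (0 <= K)%R) by (left; repeat apply Rmult_lt_0_compat; apply exp_pos).
  apply (summable_Z1 w K 0); auto. intros k.
  destruct (Z.le_gt_cases 0 k) as [Hk|Hk].
  - right. exists k; split; [lia|]. unfold heine_term. rewrite Cmult_comm, Cmod_mult.
    apply Rmult_le_compat_r; [apply Cmod_ge_0|].
    apply Cmod_mult_le; [apply Cmod_qpz|apply Cmod_rq]; repeat apply base_sq; assumption.
  - left. unfold heine_term. rewrite rq_neg by assumption; ring.
Qed.

Lemma base_mult (a b : C) : base a -> base b -> base (a * b).
Proof.
  intros Ha Hb. assert (A1 := Cmod_pos a Ha). assert (B1 := Cmod_pos b Hb).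
  destruct Ha, Hb. split; [now apply Cmult_neq_0|]. rewrite Cmod_mult; nra.
Qed.

Lemma heine_rec (P w : C) : base P -> base w ->
  (1 - w) * usum (heine_term P w) = usum (heine_term P (w * (P ^ 2) ^ 2))
    + P * w * usum (heine_term P (w * P ^ 2)).
Proof.
  intros Hb Hw. assert (HP := proj1 Hb). assert (HQ := base_sq P Hb). destruct HQ as [H0 H1].
  set (Q := P ^ 2) in *.
  assert (Hw1 : base (w * Q)) by (apply base_mult; [assumption|now split]).
  assert (Hw2 : base (w * Q ^ 2)) by (apply base_mult; [assumption|apply base_sq; now split]).
  assert (S0 := summable_heine P w Hb Hw). assert (S1 := summable_heine P _ Hb Hw1).
  assert (S2 := summable_heine P _ Hb Hw2).
  set (u := fun k => heine_term P w k - heine_term P (w * Q ^ 2) k).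
  assert (Su : summable u) by now apply summable_minus.
  assert (EQ2 : forall k, zp (Q ^ 2) k = zp Q (2 * k)) by (intros; now apply zp_sq).
  assert (Hu : forall k, u (k + 1)%Z = w * heine_term P w k + (w * P) * heine_term P (w * Q) k).
  { intros k. unfold u, heine_term. fold Q. rewrite !zp_mult_l, !EQ2.
    destruct (Z.le_gt_cases 0 k) as [Hk|Hk].
    - assert (A1 := rq_sq_rec Q (k + 1) (conj H0 H1)). replace (k + 1 - 1)%Z with k in A1 by ring.
      rewrite <- A1, qpz_succ, (zp_succ w) by (try apply Hw; assumption). ring.
    - rewrite (rq_neg _ k) by assumption. destruct (Z.eq_dec k (-1)) as [->|Hk'].
      + simpl (-1 + 1)%Z. simpl (2 * 0)%Z. rewrite (zp_0 Q). ring.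
      + rewrite (rq_neg _ (k + 1)) by lia. ring. }
  assert (E : usum (heine_term P w) - usum (heine_term P (w * Q ^ 2)) =
    w * usum (heine_term P w) + (w * P) * usum (heine_term P (w * Q))).
  { rewrite <- usum_minus by assumption. fold u. rewrite <- (usum_shift u), (usum_ext _ _ Hu) by assumption.
    rewrite usum_plus, !usum_scal; auto using summable_scal. }
  transitivity ((usum (heine_term P w) - usum (heine_term P (w * Q ^ 2))) + usum (heine_term P (w * Q ^ 2))
    - w * usum (heine_term P w)); [ring|].
  rewrite E; ring.
Qed.

(** Going backwards, the maximum of two consecutive values grows by at most 1 + 2 |Q|^n per step,
    and these factors have a bounded product; so D n is at most a constant times values arbitrarily
    far out, which tend to 0. *)
Lemma rec_unique (Q : C) (D : nat -> C) (a b : nat -> C) : (Cmod Q < 1)%R ->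
  (forall n, Cmod (a n) <= Cmod Q ^ n)%R -> (forall n, Cmod (b n) <= Cmod Q ^ n)%R ->
  (forall n, D n = (1 + a n) * D (S (S n)) + b n * D (S n)) ->
  clim D 0 -> forall n, D n = 0.
Proof.
  intros HQ Ha Hb' HD Hl. assert (H0 := Cmod_ge_0 Q).
  set (En := fun n => Rmax (Cmod (D n)) (Cmod (D (S n)))).
  assert (HE : forall n, (En n <= (1 + 2 * Cmod Q ^ n) * En (S n))%R).
  { intros n. assert (Hp : (0 <= Cmod Q ^ n)%R) by now apply pow_le.
    assert (M1 : (Cmod (D (S n)) <= En (S n))%R) by apply Rmax_l.
    assert (M2 : (Cmod (D (S (S n))) <= En (S n))%R) by apply Rmax_r.
    assert (M0 := Cmod_ge_0 (D (S n))).
    unfold En at 1. apply Rmax_lub; [|nra].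
    rewrite HD. eapply Rle_trans; [apply Cmod_triangle|]. rewrite !Cmod_mult.
    assert (A1 : (Cmod (1 + a n) <= 1 + Cmod Q ^ n)%R).
    { eapply Rle_trans; [apply Cmod_triangle|]. rewrite Cmod_1. specialize (Ha n); lra. }
    assert (A2 := Hb' n). generalize (Cmod_ge_0 (1 + a n)), (Cmod_ge_0 (b n)), (Cmod_ge_0 (D (S (S n)))).
    intros. assert (Cmod (1 + a n) * Cmod (D (S (S n))) <= (1 + Cmod Q ^ n) * En (S n))%R
      by (apply Rmult_le_compat; assumption).
    assert (Cmod (b n) * Cmod (D (S n)) <= Cmod Q ^ n * En (S n))%R by (apply Rmult_le_compat; assumption).
    lra. }
  set (p := fix p (m : nat) : R := match m with O => 1%R | S m => (p m * (1 + 2 * Cmod Q ^ m))%R end).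
  assert (Hp0 : forall m, (0 <= p m)%R).
  { induction m as [|m IH]; simpl; [lra|]. apply Rmult_le_pos; [assumption|].
    assert (0 <= Cmod Q ^ m)%R by now apply pow_le. lra. }
  assert (Hp : forall m, (p m <= exp (2 / (1 - Cmod Q)))%R).
  { apply prod_bound; try lra; try assumption; simpl; [lra|]. intros; lra. }
  assert (HEp : forall n, (0 <= En n)%R).
  { intros n; eapply Rle_trans; [apply (Cmod_ge_0 (D n))|apply Rmax_l]. }
  assert (Hit : forall n m, (En n <= p m * En (n + m)%nat)%R).
  { intros n; induction m as [|m IH]; simpl p.
    - rewrite Nat.add_0_r; lra.
    - eapply Rle_trans; [exact IH|]. rewrite Nat.add_succ_r, Rmult_assoc.
      apply Rmult_le_compat_l; [apply Hp0|]. eapply Rle_trans; [apply HE|].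
      apply Rmult_le_compat_r; [apply HEp|].
      assert (Cmod Q ^ (n + m) <= Cmod Q ^ m)%R; [|lra].
      rewrite pow_add. assert (Cmod Q ^ n <= 1)%R by (rewrite <- (pow1 n); apply pow_incr; lra).
      assert (0 <= Cmod Q ^ m)%R by now apply pow_le. nra. }
  intros n. apply Cmod_eq_0, Rle_antisym; [|apply Cmod_ge_0].
  apply le_epsilon; intros e He. set (Kx := exp (2 / (1 - Cmod Q))) in *.
  assert (HK : (0 < Kx)%R) by apply exp_pos.
  destruct (Hl (e / Kx)%R) as [N HN]; [now apply Rdiv_lt_0_compat|].
  assert (HB : (En (n + N)%nat <= e / Kx)%R).
  { unfold En; apply Rmax_lub; left.
    - specialize (HN (n + N)%nat ltac:(lia)).
      now replace (D (n + N)%nat - 0) with (D (n + N)%nat) in HN by ring.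
    - specialize (HN (S (n + N)) ltac:(lia)).
      now replace (D (S (n + N)) - 0) with (D (S (n + N))) in HN by ring. }
  apply Rle_trans with (En n); [apply Rmax_l|].
  eapply Rle_trans; [apply (Hit n N)|].
  apply Rle_trans with (Kx * (e / Kx))%R; [apply Rmult_le_compat; auto|].
  right; field; lra.
Qed.

Lemma slater_lim (P : C) : base P ->
  clim (fun n => usum (slater_term P (- (P ^ 2) ^ S n))) 1.
Proof.
  intros Hb. assert (HP := proj1 Hb). assert (HQ := base_sq P Hb). destruct HQ as [H0 H1].
  set (Q := P ^ 2) in *.
  assert (HQn : - Q <> 0) by now apply Copp_neq0.
  replace (1 : C) with (slater_term P (- Q) 0).
  2: { unfold slater_term; simpl (1 * (0 * 0) + 0 * 0)%Z. rewrite !zp_0, rq_0.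
       unfold qpz; simpl (qpoch P _ _). ring. }
  apply (clim_ext (fun n => usum (fun k => zp (Q ^ n) k * slater_term P (- Q) k * 1))).
  - intros n; apply usum_ext; intros k; unfold slater_term.
    replace (- Q ^ S n) with (Q ^ n * - Q) by (rewrite Cpow_S; ring). rewrite zp_mult_l; ring.
  - apply (usum_scale_lim Q _ (fun _ _ => 1) 1); auto.
    + now apply summable_slater.
    + intros k Hk; unfold slater_term. rewrite rq_neg by assumption; ring.
    + lra.
    + intros; rewrite Cmod_1; lra.
    + intros; apply clim_const.
Qed.

Lemma heine_lim (P : C) : base P ->
  clim (fun n => usum (heine_term P (- (P ^ 2) ^ S n))) 1.
Proof.
  intros Hb. assert (HP := proj1 Hb). assert (HQ := base_sq P Hb). destruct HQ as [H0 H1].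
  set (Q := P ^ 2) in *.
  replace (1 : C) with (heine_term P (- Q) 0).
  2: { unfold heine_term. rewrite !zp_0, rq_0. unfold qpz; simpl (qpoch _ _ _). ring. }
  apply (clim_ext (fun n => usum (fun k => zp (Q ^ n) k * heine_term P (- Q) k * 1))).
  - intros n; apply usum_ext; intros k; unfold heine_term.
    replace (- Q ^ S n) with (Q ^ n * - Q) by (rewrite Cpow_S; ring). rewrite zp_mult_l; ring.
  - apply (usum_scale_lim Q _ (fun _ _ => 1) 1); auto.
    + apply summable_heine; [assumption|]. apply base_opp; now split.
    + intros k Hk; unfold heine_term. rewrite rq_neg by assumption; ring.
    + lra.
    + intros; rewrite Cmod_1; lra.
    + intros; apply clim_const.
Qed.

(* Both sides satisfy the same second-order q-difference equation in [w],
   and agree in the limit [w -> 0]. *)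
Lemma heine_transform (P : C) n : base P ->
  qpoch_inf (- (P ^ 2) ^ S n) (P ^ 2) * usum (heine_term P (- (P ^ 2) ^ S n))
  = usum (slater_term P (- (P ^ 2) ^ S n)).
Proof.
  intros Hb. assert (HP := proj1 Hb). assert (HQ := base_sq P Hb). destruct HQ as [H0 H1].
  set (Q := P ^ 2) in *.
  assert (HQn : forall n, - Q ^ n <> 0) by (intros; now apply Copp_neq0, Cpow_nz).
  set (F := fun n => qpoch_inf (- Q ^ S n) Q * usum (heine_term P (- Q ^ S n))).
  set (h := fun n => usum (slater_term P (- Q ^ S n))).
  assert (HF : forall n, F n = (1 + Q ^ S (S n)) * F (S (S n)) + (- (P * Q ^ S n)) * F (S n)).
  { intros m. unfold F.
    assert (R1 := heine_rec P (- Q ^ S m) Hb (base_opp _ (base_pow Q m (conj H0 H1)))). fold Q in R1.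
    replace (- Q ^ S m * Q ^ 2) with (- Q ^ S (S (S m))) in R1 by (rewrite !Cpow_S; simpl; ring).
    replace (- Q ^ S m * Q) with (- Q ^ S (S m)) in R1 by (rewrite !Cpow_S; simpl; ring).
    assert (SP : forall j, qpoch_inf (- Q ^ j) Q = (1 + Q ^ j) * qpoch_inf (- Q ^ S j) Q).
    { intros j. unfold Q at 2. rewrite (qpoch_inf_split P (- Q ^ j) 1) by auto. fold Q.
      simpl (qpoch (- Q ^ j) Q 1).
      replace (- Q ^ j * Q ^ 1) with (- Q ^ S j) by (rewrite Cpow_S; simpl; ring).
      ring. }
    rewrite (SP (S m)), (SP (S (S m))).
    transitivity ((1 + Q ^ S (S m)) * qpoch_inf (- Q ^ S (S (S m))) Q *
      ((1 - - Q ^ S m) * usum (heine_term P (- Q ^ S m)))); [ring|].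
    rewrite R1; ring. }
  assert (Hh : forall n, h n = (1 + Q ^ S (S n)) * h (S (S n)) + (- (P * Q ^ S n)) * h (S n)).
  { intros m. unfold h. rewrite (slater_rec P (- Q ^ S m)) by auto. fold Q.
    replace (- Q ^ S m * Q ^ 2) with (- Q ^ S (S (S m))) by (rewrite !Cpow_S; simpl; ring).
    replace (- Q ^ S m * Q) with (- Q ^ S (S m)) by (rewrite !Cpow_S; simpl; ring). ring. }
  assert (LF : clim F 1).
  { unfold F. match goal with |- clim ?u _ => enough (HL : clim u (1 * 1))
        by (rewrite Cmult_1_r in HL; exact HL) end.
    apply clim_mult; [|now apply heine_lim].
    apply (clim_ext (fun n => qpoch_inf (- Q * Q ^ n) Q)).
    - intros m; f_equal. rewrite Cpow_S; ring.
    - apply qpoch_inf_tail; [assumption|now apply Copp_neq0]. }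
  assert (D0 : forall n, F n - h n = 0).
  { assert (Hpow : forall m, (Cmod (Q ^ S m) <= Cmod Q ^ m)%R).
    { intros m. rewrite Cmod_pow. simpl. assert (0 <= Cmod Q ^ m)%R by (apply pow_le, Cmod_ge_0).
      generalize (Cmod_ge_0 Q); nra. }
    apply (rec_unique Q _ (fun n => Q ^ S (S n)) (fun n => - (P * Q ^ S n))); auto.
    - intros m. eapply Rle_trans; [apply Hpow|]. rewrite <- Cmod_pow. apply Hpow.
    - intros m. rewrite Cmod_opp, Cmod_mult.
      apply Rle_trans with (1 * Cmod Q ^ m)%R; [|lra].
      apply Rmult_le_compat; auto using Cmod_ge_0. left; apply Hb.
    - intros m. rewrite HF, Hh at 1. ring.
    - replace (0 : C) with (1 + -1 * 1 : C) by ring.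
      apply (clim_ext (fun n => F n + -1 * h n)); [intros; ring|].
      apply clim_plus; [assumption|]. apply clim_mult; [apply clim_const|now apply slater_lim]. }
  specialize (D0 n). unfold F, h in D0.
  match goal with |- ?a = ?b => transitivity (a - b + b); [ring|] end. rewrite D0; ring.
Qed.

(** The Slater-type identity sits at w = -1, outside the disc |w| < 1 required for [heine_term]. One
    step of [slater_rec] moves to w = -Q and w = -Q^2, where [heine_transform] applies; hence the
    two-term combination. *)
Lemma alternating_sum (P : C) : base P ->
  qpoch_inf (P ^ 2) (P ^ 2) * qpoch_inf (- P ^ 2) (P ^ 2) *
  (usum (heine_term P (- (P ^ 2) ^ 2)) - P * usum (heine_term P (- P ^ 2)))
  = qpoch_inf P (P ^ 2) * theta (P ^ 3) 1.
Proof.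
  intros Hb. assert (HP := proj1 Hb). assert (HQ := base_sq P Hb). destruct HQ as [H0 H1].
  rewrite <- slater_sum by assumption. rewrite (slater_rec P (-1)) by (auto using Cm1_neq0).
  assert (T1 := heine_transform P 0 Hb). assert (T2 := heine_transform P 1 Hb).
  set (Q := P ^ 2) in *.
  replace (-1 * Q ^ 2) with (- Q ^ 2) by ring. replace (-1 * Q) with (- Q) by ring.
  rewrite <- T2. replace (- Q ^ 1) with (- Q) in T1 by (simpl; ring). rewrite <- T1.
  assert (SP : qpoch_inf (- Q) Q = (1 + Q) * qpoch_inf (- Q ^ 2) Q).
  { unfold Q at 2. rewrite (qpoch_inf_split P (- Q) 1) by auto using Copp_neq0. fold Q.
    simpl (qpoch (- Q) Q 1). replace (- Q * Q ^ 1) with (- Q ^ 2) by (simpl; ring). simpl; ring. }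
  rewrite SP. ring.
Qed.

(** * The recurrence and its solutions *)

(** q^4 as an iterated square, so that results on a base P^2 apply verbatim with P = q^2. *)
Notation "'Q4' q" := ((q ^ 2) ^ 2) (at level 9, q at level 9).

Lemma zp_Q4 (q : C) k : q <> 0 -> zp (Q4 q) k = zp q (4 * k).
Proof.
  intros H. rewrite !zp_sq by auto using Cpow_nz. f_equal; ring.
Qed.

(** The sign s merges a_j with its companion: i^2 - 2ij and i have the same parity, so inserting
    (-1)^i amounts to q -> -q. *)
Definition a_term (s q : C) (j i : Z) : C := zp s i * zp q (i * i - 2 * i * j) * rq (Q4 q) i.
Definition a_sum (s q : C) (j : Z) : C := usum (a_term s q j).
Definition r_term (q : C) (j k : Z) : C := zp q (4 * (k * k) + 4 * (j + 1) * k) * rq (Q4 q) k.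
(** The prefactor makes the k-sum satisfy the recurrence of a and, multiplied by the weight,
    restores q^(3j^2+2j). *)
Definition t_sum (q : C) (j : Z) : C := zp (-1) j * zp q (j * j + 2 * j) * usum (r_term q j).

Definition is_sign (s : C) : Prop := s = 1 \/ s = -1.

Lemma sign_sq s : is_sign s -> s * s = 1.
Proof. intros [-> | ->]; ring. Qed.

Lemma sign_neq0 s : is_sign s -> s <> 0.
Proof. intros [-> | ->]; [apply C1_nz|apply Cm1_neq0]. Qed.

Lemma Cmod_sign s k : is_sign s -> Cmod (zp s k) = 1%R.
Proof. intros [-> | ->]; [rewrite zp_1_l; apply Cmod_1|apply Cmod_m1_zp]. Qed.

Lemma base_Q4 (q : C) : base q -> base (Q4 q).
Proof. intros; now repeat apply base_sq. Qed.

Lemma summable_a (s q : C) j : is_sign s -> base q -> summable (a_term s q j).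
Proof.
  intros Hs Hb. apply (summable_ext (fun i => zp q (1 * (i * i) + (-2 * j) * i) * zp s i * rq (Q4 q) i)).
  - intros i; unfold a_term. replace (1 * (i * i) + -2 * j * i)%Z with (i * i - 2 * i * j)%Z by ring. ring.
  - apply (summable_gauss q s 1 _ (rq_bound (Q4 q))); auto using sign_neq0; try lia.
    + left; apply rq_bound_pos.
    + intros; apply Cmod_rq. now apply base_Q4.
Qed.

Lemma summable_r (q : C) j : base q -> summable (r_term q j).
Proof.
  intros Hb. apply (summable_ext (fun i => zp q (4 * (i * i) + (4 * (j + 1)) * i) * zp 1 i * rq (Q4 q) i)).
  - intros i; unfold r_term. rewrite zp_1_l; ring.
  - apply (summable_gauss q 1 4 _ (rq_bound (Q4 q))); auto using C1_nz; try lia.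
    + left; apply rq_bound_pos.
    + intros; apply Cmod_rq. now apply base_Q4.
Qed.

Lemma zp_sign_mul (q : C) n k : q <> 0 -> zp (- zp q n) k = zp (-1) k * zp q (n * k).
Proof.
  intros H. replace (- zp q n) with (-1 * zp q n) by ring. now rewrite zp_mult_l, zp_mul.
Qed.

Lemma C2_neq0 : (2 : C) <> 0.
Proof. intros E. apply RtoC_inj in E; lra. Qed.

(* Expand the right-hand side as a double sum over [(i, m)]; only [i + j + m] odd survives,
   and for [m = 2n + 1 + j - i] the sum over [i] is an Euler product vanishing unless [j + n < 0]. *)
Lemma connection (q : C) j : base q ->
  2 * q * qpoch_inf (Q4 q) (Q4 q) * t_sum q j
  = theta q 1 * (zp (-1) j * a_sum (-1) q j) - theta q (-1) * a_sum 1 q j.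
Proof.
  intros Hb. assert (Hq := proj1 Hb). assert (Hb2 := base_sq q Hb).
  set (P := q ^ 2) in *. set (Q := P ^ 2) in *. set (E0 := qpoch_inf Q Q).
  assert (HQ : Q <> 0) by (apply Cpow_nz, Hb2).
  assert (HzQ : forall k, zp Q k = zp q (4 * k)) by (intros; now apply zp_Q4).
  assert (HzP : forall k, zp P k = zp q (2 * k)) by (intros; now apply zp_sq).
  assert (Hm1 := Cm1_neq0).
  assert (Sa1 := summable_a 1 q j (or_introl eq_refl) Hb).
  assert (Sa2 := summable_a (-1) q j (or_intror eq_refl) Hb).
  assert (St1 := summable_theta q 1 Hb C1_nz). assert (St2 := summable_theta q (-1) Hb Cm1_neq0).
  set (G := fun x : Z * Z => zp q (fst x * fst x - 2 * fst x * j + snd x * snd x) * rq Q (fst x)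
     * (zp (-1) (fst x) - zp (-1) (j + snd x))).
  set (G1 := fun x : Z * Z => a_term (-1) q j (fst x) * (zp q (snd x * snd x) * zp 1 (snd x))).
  set (G2 := fun x : Z * Z => a_term 1 q j (fst x) * (zp q (snd x * snd x) * zp (-1) (snd x))).
  assert (S1 : summable G1) by (apply (summable_mult _ _ Sa2 St1)).
  assert (S2 : summable G2) by (apply (summable_mult _ _ Sa1 St2)).
  assert (EG : forall x, G x = G1 x - zp (-1) j * G2 x).
  { intros [i m]; unfold G, G1, G2, a_term; cbn [fst snd]. fold P Q.
    rewrite !zp_1_l, !zp_add by assumption. ring. }
  assert (SG : summable G).
  { apply (summable_ext (fun x => G1 x - zp (-1) j * G2 x)); [intros; now rewrite EG|].
    apply summable_minus; [assumption|now apply summable_scal]. }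
  assert (SUM : usum G = theta q 1 * a_sum (-1) q j - zp (-1) j * (theta q (-1) * a_sum 1 q j)).
  { rewrite (usum_ext _ _ EG), usum_minus, usum_scal by (auto using summable_scal).
    assert (M1 : usum G1 = a_sum (-1) q j * theta q 1) by exact (usum_mult _ _ Sa2 St1).
    assert (M2 : usum G2 = a_sum 1 q j * theta q (-1)) by exact (usum_mult _ _ Sa1 St2).
    rewrite M1, M2; ring. }
  assert (Ej : zp (-1) j * zp (-1) j = 1).
  { rewrite <- zp_add by assumption. replace (j + j)%Z with (2 * j)%Z by ring. apply zp_m1_even. }
  assert (GOAL : usum G = 2 * E0 * zp q ((j + 1) * (j + 1)) * usum (r_term q j)).
  { set (g := fun x : Z * Z => (snd x, (2 * fst x + 1 + j - snd x)%Z)).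
    assert (Hg : forall x y, g x = g y -> x = y).
    { intros [n i] [n' i'] H. assert (H1 := f_equal fst H). assert (H2 := f_equal snd H).
      unfold g in H1, H2; cbn [fst snd] in H1, H2. f_equal; lia. }
    assert (SH := summable_comp g G Hg SG). assert (SF := summable_fst _ SH).
    assert (Ein : forall n, usum (fun i => G (g (n, i))) =
      2 * E0 * zp q ((j + 2 * n + 1) * (j + 2 * n + 1)) * rq Q (- (j + n) - 1)).
    { intros n. unfold g; cbn [fst snd].
      rewrite (usum_ext _ (fun i => 2 * zp q ((j + 2 * n + 1) * (j + 2 * n + 1)) * euler_term P (zp Q (- (j + n))) i)).
      + rewrite usum_scal by (apply summable_euler; [assumption|now apply zp_neq0]).
        rewrite euler by (auto using zp_neq0).
        replace (- (j + n))%Z with (- (j + n) - 1 + 1)%Z at 1 by ring.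
        unfold Q at 1. rewrite qpoch_inf_zp by assumption. fold Q E0. ring.
      + intros i. unfold G, euler_term; cbn [fst snd]. fold Q.
        rewrite HzP. replace (- zp Q (- (j + n))) with (- zp q (4 * (- (j + n)))) by now rewrite HzQ.
        rewrite zp_sign_mul by assumption.
        replace (j + (2 * n + 1 + j - i))%Z with (- i + 2 * (j + n) + 1)%Z by ring.
        rewrite zp_m1_succ, (zp_add (-1)), zp_m1_even, zp_m1_opp by assumption.
        replace (i * i - 2 * i * j + (2 * n + 1 + j - i) * (2 * n + 1 + j - i))%Z with
          (2 * (i * i - i) + (4 * - (j + n) * i + (j + 2 * n + 1) * (j + 2 * n + 1)))%Z by ring.
        rewrite !(zp_add q) by assumption. ring. }
    rewrite (usum_reindex g G Hg); [| |assumption].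
    2: { intros [i m] Hy. unfold G; cbn [fst snd].
         destruct (Z.Even_or_Odd (i + j + m)) as [[n Hn]|[n Hn]].
         - replace (j + m)%Z with (- i + 2 * n)%Z by lia.
           rewrite (zp_add (-1)), zp_m1_even, zp_m1_opp by assumption. ring.
         - exfalso. apply (Hy ((n - j)%Z, i)). unfold g; cbn [fst snd]. f_equal. lia. }
    rewrite usum_fst by assumption. apply (summable_ext _ _ Ein) in SF. rewrite (usum_ext _ _ Ein).
    (* n = -j - 1 - k turns the surviving fibres, j + n < 0, into k >= 0. *)
    rewrite (usum_bij (fun k => - j - 1 - k)%Z (fun n => - j - 1 - n)%Z); [|intros; ring|intros; ring|assumption].
    rewrite <- usum_scal by now apply summable_r. apply usum_ext; intros k.
    unfold r_term; fold P Q. replace (- (j + (- j - 1 - k)) - 1)%Z with k by ring.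
    replace ((j + 2 * (- j - 1 - k) + 1) * (j + 2 * (- j - 1 - k) + 1))%Z with
      ((j + 1) * (j + 1) + (4 * (k * k) + 4 * (j + 1) * k))%Z by ring.
    rewrite (zp_add q ((j + 1) * (j + 1))) by assumption. ring. }
  unfold t_sum.
  transitivity (zp (-1) j * usum G).
  - rewrite GOAL. replace ((j + 1) * (j + 1))%Z with (j * j + 2 * j + 1)%Z by ring.
    rewrite (zp_succ q) by assumption. ring.
  - rewrite SUM. transitivity (theta q 1 * (zp (-1) j * a_sum (-1) q j)
      - (zp (-1) j * zp (-1) j) * (theta q (-1) * a_sum 1 q j)); [ring|]. rewrite Ej; ring.
Qed.

Definition solves (q : C) (y : Z -> C) : Prop :=
  forall j, y (j + 2)%Z = y j + zp q (- 3 - 2 * j) * y (j + 1)%Z.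

(** The difference of the values at j + 2 and j carries 1 - Q^i, which lowers the reciprocal
    q-factorial; after shifting i it is a multiple of the summand at j + 1. *)
Lemma a_sum_rec (s q : C) j : is_sign s -> base q ->
  a_sum s q (j + 2) = a_sum s q j + s * zp q (- 3 - 2 * j) * a_sum s q (j + 1).
Proof.
  intros Hs Hb. assert (Hq := proj1 Hb). assert (Hs0 := sign_neq0 s Hs).
  assert (S0 := summable_a s q j Hs Hb). assert (S1 := summable_a s q (j + 1) Hs Hb).
  assert (S2 := summable_a s q (j + 2) Hs Hb).
  assert (HQ := base_Q4 q Hb).
  set (u := fun i => a_term s q (j + 2) i - a_term s q j i).
  assert (Su : summable u) by now apply summable_minus.
  assert (Hu : forall i, u (i + 1)%Z = s * zp q (- 3 - 2 * j) * a_term s q (j + 1) i).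
  { intros i; unfold u, a_term.
    assert (A := rq_rec (Q4 q) (i + 1) (proj2 HQ)). replace (i + 1 - 1)%Z with i in A by ring.
    rewrite <- A. rewrite zp_succ, zp_Q4 by assumption.
    set (r := rq (Q4 q) (i + 1)).
    assert (E : zp q ((i + 1) * (i + 1) - 2 * (i + 1) * j) =
      zp q (4 * (i + 1)) * zp q ((i + 1) * (i + 1) - 2 * (i + 1) * (j + 2))).
    { rewrite <- zp_add by assumption. f_equal; ring. }
    assert (E2 : zp q (-3 - 2 * j) * zp q (i * i - 2 * i * (j + 1)) = zp q ((i + 1) * (i + 1) - 2 * (i + 1) * (j + 2))).
    { rewrite <- zp_add by assumption. f_equal; ring. }
    rewrite E, <- E2. ring. }
  assert (E : usum u = s * zp q (- 3 - 2 * j) * a_sum s q (j + 1)).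
  { rewrite <- (usum_shift u), (usum_ext _ _ Hu), usum_scal by assumption. reflexivity. }
  unfold u in E. rewrite usum_minus in E by assumption. fold (a_sum s q (j + 2)) (a_sum s q j) in E.
  rewrite <- E; ring.
Qed.

(** The twist s^j absorbs the sign in the recurrence, so that both signs solve one and the same
    equation. *)
Definition b_sum (s q : C) (j : Z) : C := zp s j * a_sum s q j.

Lemma b_sum_solves (s q : C) : is_sign s -> base q -> solves q (b_sum s q).
Proof.
  intros Hs Hb j. assert (Hs0 := sign_neq0 s Hs). unfold b_sum. rewrite a_sum_rec by assumption.
  replace (j + 2)%Z with (j + 1 + 1)%Z by ring. rewrite !(zp_succ s) by assumption.
  transitivity (zp s j * (s * s) * a_sum s q j + (s * s) * zp q (-3 - 2 * j) * (zp s j * s * a_sum s q (j + 1))); [ring|].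
  rewrite sign_sq by assumption; ring.
Qed.

Lemma a_sum_solves (q : C) : base q -> solves q (a_sum 1 q).
Proof.
  intros Hb. replace (a_sum 1 q) with (b_sum 1 q); [apply b_sum_solves; [now left|assumption]|].
  extensionality j. unfold b_sum. rewrite zp_1_l; ring.
Qed.

Lemma t_sum_eq (q : C) j : base q ->
  t_sum q j = / (2 * q * qpoch_inf (Q4 q) (Q4 q)) *
    (theta q 1 * b_sum (-1) q j - theta q (-1) * a_sum 1 q j).
Proof.
  intros Hb. unfold b_sum. rewrite <- connection by assumption. field. repeat split.
  - apply (qpoch_inf_QQ_neq0 (q ^ 2)). now apply base_sq.
  - apply Hb.
Qed.

Lemma t_sum_solves (q : C) : base q -> solves q (t_sum q).
Proof.
  intros Hb j. rewrite !t_sum_eq by assumption.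
  rewrite (b_sum_solves (-1) q (or_intror eq_refl) Hb j), (a_sum_solves q Hb j). ring.
Qed.

Definition weight (q : C) (j : Z) : C := zp (-1) j * zp q (2 * (j * j)) * rq (Q4 q) j.

(** The factor Q^j supplies decay. The coefficients q^4, -2 q^2, 1 are those of a square: lowering j
    by 1 multiplies the (i, k) summand of the product by s q^(2(i+k)), so the bracket becomes (q^2 -
    s q^(2(i+k)))^2. *)
Definition smoothed (q : C) (y y' : Z -> C) (j : Z) : C :=
  weight q j * zp q (4 * j) * (q ^ 4 * (y j * y' j) - 2 * q ^ 2 * (y (j - 1)%Z * y' (j - 1)%Z)
    + y (j - 2)%Z * y' (j - 2)%Z).

Lemma weight_rec (q : C) j : base q ->
  weight q (j + 1) * (1 - zp q (4 * (j + 1))) = - (zp q (4 * j + 2) * weight q j).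
Proof.
  intros Hb. assert (Hq := proj1 Hb). unfold weight. rewrite zp_m1_succ.
  assert (A := rq_rec (Q4 q) (j + 1) (proj2 (base_Q4 q Hb))). replace (j + 1 - 1)%Z with j in A by ring.
  rewrite <- A, zp_Q4 by assumption.
  replace (2 * ((j + 1) * (j + 1)))%Z with (2 * (j * j) + (4 * j + 2))%Z by ring.
  rewrite (zp_add q (2 * (j * j))) by assumption. ring.
Qed.

Lemma weight_neg (q : C) j : (j < 0)%Z -> weight q j = 0.
Proof. intros H; unfold weight; rewrite rq_neg by assumption; ring. Qed.

(* Averaging trades the conditionally convergent pieces of [sum w_j y_j y'_j] for absolutely
   convergent ones: the difference telescopes. *)
Lemma smoothing (q : C) y y' : base q -> solves q y -> solves q y' ->
  summable (fun j => weight q j * (y j * y' j)) ->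
  summable (smoothed q y y') /\
  2 * usum (fun j => weight q j * (y j * y' j)) = usum (smoothed q y y').
Proof.
  intros Hb Hy Hy' Sv. assert (Hq := proj1 Hb).
  set (v := fun j => weight q j * (y j * y' j)) in *.
  assert (Hv : forall j, (j < 0)%Z -> v j = 0).
  { intros j Hj; unfold v. rewrite weight_neg by assumption; ring. }
  (* Up to terms with a factor Q^j, 2 v j minus both telescoping differences is v j + v (j+1): for
     growing solutions v alternates in sign, and adding neighbours cancels the leading parts. *)
  set (u1 := fun j => v j * (1 - zp q (4 * j))).
  set (u2 := fun j => zp q (4 * j) * v (j - 1)%Z).
  assert (S1 : summable u1).
  { apply (summable_le _ (fun j => 2 * v j)); [|now apply summable_scal].
    intros j; unfold u1. destruct (Z.le_gt_cases 0 j) as [Hj|Hj].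
    - rewrite Cmult_comm, !Cmod_mult. apply Rmult_le_compat_r; [apply Cmod_ge_0|].
      eapply Rle_trans; [apply Cmod_triangle|]. rewrite Cmod_opp, Cmod_1, Cmod_R, Rabs_pos_eq by lra.
      generalize (Cmod_zp_le1 q (4 * j) Hb ltac:(lia)); lra.
    - rewrite Hv by assumption. rewrite Cmult_0_l, Cmult_0_r; lra. }
  assert (S2 : summable u2).
  { apply (summable_le _ (fun j => v (j - 1)%Z)); [|apply (summable_shift v (-1) Sv)].
    intros j; unfold u2. destruct (Z.le_gt_cases 0 j) as [Hj|Hj].
    - rewrite Cmod_mult. rewrite <- (Rmult_1_l (Cmod (v _))) at 2.
      apply Rmult_le_compat_r; [apply Cmod_ge_0|]. apply Cmod_zp_le1; [assumption|lia].
    - rewrite Hv by lia. rewrite Cmult_0_r; lra. }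
  assert (E : forall j, smoothed q y y' j = 2 * v j - ((u1 j - u1 (j + 1)%Z) + (u2 j - u2 (j + 1)%Z))).
  { intros j. unfold smoothed, u1, u2, v.
    replace (j + 1 - 1)%Z with j by ring.
    assert (W1 := weight_rec q j Hb).
    assert (W0 := weight_rec q (j - 1) Hb). replace (j - 1 + 1)%Z with j in W0 by ring.
    assert (Y1 := Hy (j - 1)%Z). assert (Y1' := Hy' (j - 1)%Z).
    assert (Y0 := Hy (j - 2)%Z). assert (Y0' := Hy' (j - 2)%Z).
    replace (j - 1 + 2)%Z with (j + 1)%Z in Y1, Y1' by ring.
    replace (j - 1 + 1)%Z with j in Y1, Y1' by ring.
    replace (j - 2 + 2)%Z with j in Y0, Y0' by ring.
    replace (j - 2 + 1)%Z with (j - 1)%Z in Y0, Y0' by ring.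
    (* All powers are expressed through Z and q; the recurrences eliminate the values at j + 1 and j
       - 2, leaving a rational identity in those at j and j - 1. *)
    set (Z := zp q (2 * j)).
    assert (HZ : Z <> 0) by now apply zp_neq0.
    assert (EZ4 : zp q (4 * j) = Z * Z) by (unfold Z; rewrite <- zp_add by assumption; f_equal; ring).
    assert (EZ5 : zp q (4 * (j + 1)) = Z * Z * q ^ 4).
    { rewrite <- EZ4, <- (zp_nat q 4), <- zp_add by assumption. f_equal; simpl (Z.of_nat 4); ring. }
    assert (EZ6 : zp q (4 * j + 2) = Z * Z * q ^ 2).
    { rewrite <- EZ4, <- (zp_nat q 2), <- zp_add by assumption. reflexivity. }
    assert (EZ7 : zp q (4 * (j - 1) + 2) * q ^ 2 = Z * Z).
    { rewrite <- EZ4, <- (zp_nat q 2), <- zp_add by assumption. f_equal; simpl (Z.of_nat 2); ring. }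
    assert (EZ8 : zp q (-3 - 2 * (j - 1)) = / (Z * q)).
    { unfold Z. rewrite <- (zp_1 q) at 3. rewrite <- zp_add, <- zp_opp by assumption. f_equal; ring. }
    assert (EZ9 : zp q (-3 - 2 * (j - 2)) = q / Z).
    { unfold Z, Cdiv. rewrite <- (zp_1 q) at 2. rewrite <- zp_opp, <- zp_add by assumption. f_equal; ring. }
    rewrite EZ8 in Y1, Y1'. rewrite EZ9 in Y0, Y0'. rewrite EZ6, EZ5 in W1.
    rewrite EZ4 in *. rewrite EZ5.
    replace (weight q (j + 1) * (y (j + 1)%Z * y' (j + 1)%Z) * (1 - Z * Z * q ^ 4)) with
      (weight q (j + 1) * (1 - Z * Z * q ^ 4) * (y (j + 1)%Z * y' (j + 1)%Z)) by ring.
    rewrite W1, Y1, Y1'.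
    replace (Z * Z * (weight q (j - 1) * (y (j - 1)%Z * y' (j - 1)%Z))) with
      (q ^ 2 * (zp q (4 * (j - 1) + 2) * weight q (j - 1)) * (y (j - 1)%Z * y' (j - 1)%Z)) by (rewrite <- EZ7; ring).
    replace (zp q (4 * (j - 1) + 2) * weight q (j - 1)) with (- (weight q j * (1 - Z * Z))) by (rewrite W0; ring).
    replace (y (j - 2)%Z) with (y j - q / Z * y (j - 1)%Z) by (rewrite Y0; ring).
    replace (y' (j - 2)%Z) with (y' j - q / Z * y' (j - 1)%Z) by (rewrite Y0'; ring).
    generalize (weight q j), (y j), (y' j), (y (j - 1)%Z), (y' (j - 1)%Z). intros W a b c d.
    field. split; assumption. }
  assert (T1 := usum_telescope u1 S1). assert (T2 := usum_telescope u2 S2).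
  assert (D1 : summable (fun j => u1 j - u1 (j + 1)%Z)) by (apply summable_minus; [assumption|now apply summable_shift]).
  assert (D2 : summable (fun j => u2 j - u2 (j + 1)%Z)) by (apply summable_minus; [assumption|now apply summable_shift]).
  assert (S3 := summable_plus _ _ D1 D2).
  assert (S4 := summable_scal _ 2 Sv). split.
  - eapply summable_ext; [intros j; symmetry; apply E|]. now apply summable_minus.
  - rewrite (usum_ext _ _ E), usum_minus, usum_plus, T1, T2, usum_scal by assumption. ring.
Qed.

(** * The triple sum in terms of theta functions *)

(** j comes first because for fixed j the sums over i and k separate. *)
Definition triple_term (q : C) (x : Z * (Z * Z)) : C :=
  let j := fst x in let i := fst (snd x) in let k := snd (snd x) in
  zp q (i * i + 3 * (j * j) + 4 * (k * k) + 4 * (j * k) + 2 * j + 4 * k - 2 * (i * j))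
  * (rq (Q4 q) i * (rq (Q4 q) j * rq (Q4 q) k)).

Lemma Zabs_nonneg_sum i j : (0 <= j)%Z -> (i <= (i - j) * (i - j) + j)%Z.
Proof. intros H. generalize (Zabs_le_sq (i - j)). lia. Qed.

Lemma summable_triple (q : C) : base q -> summable (triple_term q).
Proof.
  intros Hb. assert (HQ := proj2 (base_Q4 q Hb)).
  set (K := (rq_bound (Q4 q) * (rq_bound (Q4 q) * rq_bound (Q4 q)))%R).
  assert (HK : (0 <= K)%R) by (left; repeat apply Rmult_lt_0_compat; apply exp_pos).
  apply (summable_Z3 q K 0); auto. intros j i k. unfold triple_term; cbn [fst snd].
  destruct (Z.le_gt_cases 0 i) as [Hi|Hi]; [|left; rewrite (rq_neg _ i) by assumption; ring].
  destruct (Z.le_gt_cases 0 j) as [Hj|Hj]; [|left; rewrite (rq_neg _ j) by assumption; ring].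
  destruct (Z.le_gt_cases 0 k) as [Hk|Hk]; [|left; rewrite (rq_neg _ k) by assumption; ring].
  right. eexists; split; [|rewrite Cmult_comm, Cmod_mult; apply Rmult_le_compat_r;
    [apply Cmod_ge_0|apply Cmod_mult_le; [now apply Cmod_rq|now apply Cmod_rq2]]].
  assert (A := Zabs_nonneg_sum i j Hj).
  (* Completing the square in i leaves nonnegative terms in j and k, and (i - j)^2 + j >= i. *)
  replace (i * i + 3 * (j * j) + 4 * (k * k) + 4 * (j * k) + 2 * j + 4 * k - 2 * (i * j))%Z with
    ((i - j) * (i - j) + 2 * (j * j) + 4 * (k * k) + 4 * (j * k) + 2 * j + 4 * k)%Z by ring.
  rewrite !Z.abs_eq by assumption. nia.
Qed.

Lemma triple_slice (q : C) j : base q ->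
  usum (fun x => triple_term q (j, x)) = weight q j * (a_sum 1 q j * t_sum q j).
Proof.
  intros Hb. assert (Hq := proj1 Hb).
  assert (Sa := summable_a 1 q j (or_introl eq_refl) Hb). assert (Sr := summable_r q j Hb).
  rewrite (usum_ext _ (fun x => (zp q (3 * (j * j) + 2 * j) * rq (Q4 q) j) *
    (a_term 1 q j (fst x) * r_term q j (snd x)))).
  - rewrite usum_scal by now apply summable_mult.
    rewrite (usum_mult _ _ Sa Sr). fold (a_sum 1 q j). unfold weight, t_sum.
    assert (Ej : zp (-1) j * zp (-1) j = 1).
    { rewrite <- zp_add by apply Cm1_neq0. replace (j + j)%Z with (2 * j)%Z by ring. apply zp_m1_even. }
    replace (3 * (j * j) + 2 * j)%Z with (2 * (j * j) + (j * j + 2 * j))%Z by ring.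
    rewrite (zp_add q (2 * (j * j))) by assumption.
    set (R := usum (r_term q j)). set (A := a_sum 1 q j).
    transitivity ((zp (-1) j * zp (-1) j) * (zp q (2 * (j * j)) * zp q (j * j + 2 * j) * rq (Q4 q) j * (A * R)));
      [rewrite Ej; ring|ring].
  - intros [i k]. unfold triple_term, a_term, r_term; cbn [fst snd]. rewrite zp_1_l.
    replace (i * i + 3 * (j * j) + 4 * (k * k) + 4 * (j * k) + 2 * j + 4 * k - 2 * (i * j))%Z with
      ((3 * (j * j) + 2 * j) + ((i * i - 2 * i * j) + (4 * (k * k) + 4 * (j + 1) * k)))%Z by ring.
    rewrite !(zp_add q (3 * (j * j) + 2 * j)), (zp_add q (i * i - 2 * i * j)) by assumption. ring.
Qed.

Lemma triple_sum_weight (q : C) : base q ->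
  summable (fun j => weight q j * (a_sum 1 q j * t_sum q j)) /\
  usum (triple_term q) = usum (fun j => weight q j * (a_sum 1 q j * t_sum q j)).
Proof.
  intros Hb. assert (S := summable_triple q Hb). split.
  - eapply summable_ext; [intros j; now apply triple_slice|]. now apply summable_fst.
  - rewrite usum_fst by assumption. apply usum_ext; intros j; now apply triple_slice.
Qed.

Definition pair_term (s q : C) (x : Z * (Z * Z)) : C :=
  let j := fst x in let i := fst (snd x) in let k := snd (snd x) in
  weight q j * zp q (4 * j) * zp s j * ((q ^ 2 - s * zp q (2 * (i + k))) ^ 2)
  * (a_term 1 q j i * a_term s q j k).

Lemma summable_pair (s q : C) : is_sign s -> base q -> summable (pair_term s q).
Proof.
  intros Hs Hb. assert (Hq := proj1 Hb). assert (HQ := proj2 (base_Q4 q Hb)).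
  set (K := (4 * (rq_bound (Q4 q) * (rq_bound (Q4 q) * rq_bound (Q4 q))))%R).
  assert (HK : (0 <= K)%R).
  { unfold K. apply Rmult_le_pos; [lra|]. left; repeat apply Rmult_lt_0_compat; apply exp_pos. }
  apply (summable_Z3 q K 0); auto. intros j i k. unfold pair_term, weight, a_term; cbn [fst snd].
  destruct (Z.le_gt_cases 0 i) as [Hi|Hi]; [|left; rewrite (rq_neg _ i) by assumption; ring].
  destruct (Z.le_gt_cases 0 j) as [Hj|Hj]; [|left; rewrite (rq_neg _ j) by assumption; ring].
  destruct (Z.le_gt_cases 0 k) as [Hk|Hk]; [|left; rewrite (rq_neg _ k) by assumption; ring].
  (* Without the q^(4j) gained by smoothing the exponent would vanish for i = j = k. Two of the four
     j compensate i and k through i <= (i - j)^2 + j, a third pays for j itself. *)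
  right. exists ((i - j) * (i - j) + (k - j) * (k - j) + 4 * j)%Z. split.
  - assert (A := Zabs_nonneg_sum i j Hj). assert (A' := Zabs_nonneg_sum k j Hj).
    rewrite !Z.abs_eq by assumption. lia.
  - rewrite zp_1_l.
    replace ((i - j) * (i - j) + (k - j) * (k - j) + 4 * j)%Z with
      (2 * (j * j) + (4 * j + ((i * i - 2 * i * j) + (k * k - 2 * k * j))))%Z by ring.
    rewrite !(zp_add q) by assumption.
    set (d := q ^ 2 - s * (zp q (2 * (i + k)))). set (r := rq (Q4 q)).
    match goal with |- (Cmod ?x <= _ * Cmod ?y)%R =>
      replace x with (zp (-1) j * zp s j * zp s k * (d ^ 2 * (r i * (r j * r k))) * y) by ring end.
    rewrite (Cmod_mult _ (zp q (2 * (j * j)) * _)). apply Rmult_le_compat_r; [apply Cmod_ge_0|].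
    rewrite 3!Cmod_mult, Cmod_m1_zp, !Cmod_sign, !Rmult_1_l by assumption.
    apply Cmod_mult_le.
    + assert (Hd : (Cmod d <= 2)%R).
      { unfold d. eapply Rle_trans; [apply Cmod_triangle|]. rewrite Cmod_opp, Cmod_mult.
        assert (Hs1 : Cmod s = 1%R) by (rewrite <- (zp_1 s); now apply Cmod_sign).
        rewrite Hs1, Rmult_1_l.
        assert (A1 : (Cmod (q ^ 2) < 1)%R) by now apply base_sq.
        assert (A2 := Cmod_zp_le1 q (2 * (i + k)) Hb ltac:(lia)). lra. }
      rewrite Cmod_pow. replace 4%R with (2 ^ 2)%R by ring.
      apply pow_incr; split; [apply Cmod_ge_0|assumption].
    + apply Cmod_mult_le; [now apply Cmod_rq|now apply Cmod_rq2].
Qed.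

Lemma zp_sign_pred s j : is_sign s -> zp s (j - 1) = s * zp s j.
Proof.
  intros Hs. assert (Hs0 := sign_neq0 s Hs). replace j with (j - 1 + 1)%Z at 2 by ring.
  rewrite zp_succ by assumption. transitivity ((s * s) * zp s (j - 1)); [|ring].
  rewrite sign_sq by assumption; ring.
Qed.

Lemma pair_slice (s q : C) j : is_sign s -> base q ->
  usum (fun x => pair_term s q (j, x)) = smoothed q (a_sum 1 q) (b_sum s q) j.
Proof.
  intros Hs Hb. assert (Hq := proj1 Hb).
  assert (Sa := fun j => summable_a 1 q j (or_introl eq_refl) Hb).
  assert (Ss := fun j => summable_a s q j Hs Hb).
  set (g := fun j (x : Z * Z) => a_term 1 q j (fst x) * a_term s q j (snd x)).
  assert (Sg : forall j, summable (g j)) by (intros; apply (summable_mult _ _ (Sa _) (Ss _))).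
  assert (Eg : forall j, usum (g j) = a_sum 1 q j * a_sum s q j) by (intros; apply (usum_mult _ _ (Sa _) (Ss _))).
  set (c := weight q j * zp q (4 * j) * zp s j).
  rewrite (usum_ext _ (fun x => c * q ^ 4 * g j x + (c * - (2 * s * q ^ 2) * g (j - 1)%Z x + c * g (j - 2)%Z x))).
  - rewrite !usum_plus, !usum_scal, !Eg by auto using summable_scal, summable_plus.
    unfold smoothed, b_sum. replace (j - 2)%Z with (j - 1 - 1)%Z by ring. rewrite !zp_sign_pred by assumption.
    unfold c. transitivity (weight q j * zp q (4 * j) * zp s j *
      (q ^ 4 * (a_sum 1 q j * a_sum s q j) - 2 * s * q ^ 2 * (a_sum 1 q (j - 1) * a_sum s q (j - 1))
       + (s * s) * (a_sum 1 q (j - 1 - 1) * a_sum s q (j - 1 - 1)))).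
    + rewrite sign_sq by assumption. ring.
    + ring.
  - intros [i k]. unfold pair_term, g; cbn [fst snd]. fold c.
    unfold a_term. rewrite !zp_1_l.
    replace (i * i - 2 * i * (j - 1))%Z with ((i * i - 2 * i * j) + 2 * i)%Z by ring.
    replace (i * i - 2 * i * (j - 2))%Z with ((i * i - 2 * i * j) + (2 * i + 2 * i))%Z by ring.
    replace (k * k - 2 * k * (j - 1))%Z with ((k * k - 2 * k * j) + 2 * k)%Z by ring.
    replace (k * k - 2 * k * (j - 2))%Z with ((k * k - 2 * k * j) + (2 * k + 2 * k))%Z by ring.
    replace (2 * (i + k))%Z with (2 * i + 2 * k)%Z by ring.
    rewrite !(zp_add q) by assumption.
    transitivity (c * (q ^ 4 - 2 * s * q ^ 2 * (zp q (2 * i) * zp q (2 * k)) +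
      (s * s) * ((zp q (2 * i) * zp q (2 * k)) * (zp q (2 * i) * zp q (2 * k)))) *
      (zp q (i * i - 2 * i * j) * rq (Q4 q) i * (zp s k * zp q (k * k - 2 * k * j) * rq (Q4 q) k))); [ring|].
    rewrite sign_sq by assumption. ring.
Qed.

Lemma smoothed_sum_pair (s q : C) : is_sign s -> base q ->
  usum (smoothed q (a_sum 1 q) (b_sum s q)) = usum (pair_term s q).
Proof.
  intros Hs Hb. assert (S := summable_pair s q Hs Hb).
  rewrite usum_fst by assumption. apply usum_ext; intros j; symmetry; now apply pair_slice.
Qed.

(** The contribution of i + k = n: the infinite product is the sum over j, the finite one the
    q-binomial sum in k. *)
Definition diag_term (s q : C) (n : Z) : C :=
  (q ^ 2 - s * zp q (2 * n)) ^ 2 * qpoch_inf (s * zp q (6 - 2 * n)) (Q4 q)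
  * zp q (n * n) * qpz (- (s * zp q (2 - 2 * n))) (Q4 q) n * rq (Q4 q) n.

(** The exponent in j is 2 (j^2 - j) + (6 - 2 (i + k)) j, that of Euler's series with P = q^2 at s
    q^(6 - 2 (i + k)). *)
Lemma pair_fibre (s q : C) i k : is_sign s -> base q ->
  usum (fun j => pair_term s q (j, (i, k))) =
  (q ^ 2 - s * zp q (2 * (i + k))) ^ 2 * qpoch_inf (s * zp q (6 - 2 * (i + k))) (Q4 q)
  * (zp q (i * i) * rq (Q4 q) i * (zp s k * zp q (k * k) * rq (Q4 q) k)).
Proof.
  intros Hs Hb. assert (Hq := proj1 Hb). assert (Hb2 := base_sq q Hb).
  set (x := s * zp q (6 - 2 * (i + k))).
  assert (Hx : x <> 0) by (apply Cmult_neq_0; auto using sign_neq0, zp_neq0).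
  rewrite <- (euler (q ^ 2) x) by assumption.
  set (c := (q ^ 2 - s * zp q (2 * (i + k))) ^ 2).
  set (d := zp q (i * i) * rq (Q4 q) i * (zp s k * zp q (k * k) * rq (Q4 q) k)).
  transitivity (c * d * usum (euler_term (q ^ 2) x)); [|ring].
  rewrite <- usum_scal by now apply summable_euler.
  apply usum_ext; intros j. unfold pair_term, weight, a_term, euler_term; cbn [fst snd]. fold c.
  unfold x. replace (- (s * zp q (6 - 2 * (i + k)))) with (s * - zp q (6 - 2 * (i + k))) by ring.
  rewrite zp_mult_l, zp_sign_mul, zp_1_l, zp_sq by assumption. unfold d.
  assert (E : zp q (2 * (j * j)) * zp q (4 * j) * zp q (i * i - 2 * i * j) * zp q (k * k - 2 * k * j) =
     zp q (i * i) * zp q (k * k) * (zp q (2 * (j * j - j)) * zp q ((6 - 2 * (i + k)) * j))).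
  { rewrite <- !zp_add by assumption. f_equal; ring. }
  transitivity (c * (zp q (2 * (j * j)) * zp q (4 * j) * zp q (i * i - 2 * i * j) * zp q (k * k - 2 * k * j))
    * (zp (-1) j * zp s j * zp s k * rq (Q4 q) i * rq (Q4 q) j * rq (Q4 q) k)); [ring|].
  rewrite E; ring.
Qed.

Lemma binom_full (P x : C) n : base P -> x <> 0 ->
  usum (binom_term P x n) = qpz x (P ^ 2) n * rq (P ^ 2) n.
Proof.
  intros Hb Hx. destruct (Z.le_gt_cases 0 n) as [Hn|Hn].
  - destruct (Z_of_nat_complete n Hn) as [m ->]. unfold qpz. rewrite Nat2Z.id. now apply q_binomial.
  - rewrite (rq_neg _ n), usum_zero; [ring| |assumption].
    intros k; unfold binom_term. destruct (Z.le_gt_cases 0 k).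
    + rewrite (rq_neg _ (n - k)) by lia; ring.
    + rewrite (rq_neg _ k) by assumption; ring.
Qed.

Lemma pair_sum_diag (s q : C) : is_sign s -> base q ->
  summable (diag_term s q) /\ usum (pair_term s q) = usum (diag_term s q).
Proof.
  intros Hs Hb. assert (Hq := proj1 Hb). assert (Hb2 := base_sq q Hb).
  assert (S0 := summable_pair s q Hs Hb).
  assert (S1 := summable_snd _ S0). assert (E1 := usum_snd _ S0).
  set (H := fun x : Z * Z => usum (fun j => pair_term s q (j, x))) in *.
  change (summable H) in S1. change (usum (pair_term s q) = usum H) in E1.
  set (g := fun x : Z * Z => ((fst x - snd x)%Z, snd x)).
  set (g' := fun x : Z * Z => ((fst x + snd x)%Z, snd x)).
  assert (G1 : forall x, g' (g x) = x) by (intros [n k]; unfold g, g'; cbn [fst snd]; f_equal; ring).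
  assert (G2 : forall x, g (g' x) = x) by (intros [n k]; unfold g, g'; cbn [fst snd]; f_equal; ring).
  assert (S2 : summable (fun x => H (g x))).
  { apply (summable_comp g); [|assumption]. intros x y E; rewrite <- (G1 x), <- (G1 y), E; reflexivity. }
  assert (Ein : forall n, usum (fun k => H (g (n, k))) = diag_term s q n).
  { intros n. unfold g; cbn [fst snd]. unfold diag_term.
    set (c := (q ^ 2 - s * zp q (2 * n)) ^ 2 * qpoch_inf (s * zp q (6 - 2 * n)) (Q4 q)).
    (* (n - k)^2 + k^2 = n^2 + 2 (k^2 - k) + (2 - 2n) k gives the argument; its sign is opposite to
       s because the q-binomial sum runs over powers of -y. *)
    set (y := - (s * zp q (2 - 2 * n))).
    assert (Hy : y <> 0) by (apply Copp_neq0, Cmult_neq_0; auto using sign_neq0, zp_neq0).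
    rewrite (usum_ext _ (fun k => c * zp q (n * n) * binom_term (q ^ 2) y n k)).
    - rewrite usum_scal, binom_full by (auto using summable_binom). ring.
    - intros k. unfold H. rewrite pair_fibre by assumption.
      replace (n - k + k)%Z with n by ring. fold c. unfold binom_term, y.
      replace (- - (s * zp q (2 - 2 * n))) with (s * zp q (2 - 2 * n)) by ring.
      rewrite zp_mult_l, zp_mul, zp_sq by assumption.
      assert (E : zp q ((n - k) * (n - k)) * zp q (k * k) =
        zp q (n * n) * (zp q (2 * (k * k - k)) * zp q ((2 - 2 * n) * k))).
      { rewrite <- !zp_add by assumption. f_equal; ring. }
      transitivity (c * (zp q ((n - k) * (n - k)) * zp q (k * k)) *
        (zp s k * rq (Q4 q) k * rq (Q4 q) (n - k))); [ring|]. rewrite E; ring. }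
  split.
  - apply (summable_ext _ _ Ein). exact (summable_fst (fun x => H (g x)) S2).
  - rewrite E1, (usum_bij g g' H), (usum_fst (fun x => H (g x))) by assumption.
    apply usum_ext, Ein.
Qed.

(** The zero has several sources: the squared factor for s = 1, n = 1; a factor 1 - Q^0 of the
    infinite product for s = 1, n >= 3; a factor 1 - Q^0 of the finite product for s = -1; and [rq]
    for n < 0. *)
Lemma diag_odd (s q : C) l : is_sign s -> base q -> diag_term s q (2 * l + 1) = 0.
Proof.
  intros Hs Hb. assert (Hq := proj1 Hb). assert (Hb2 := base_sq q Hb). assert (HQ := base_Q4 q Hb).
  unfold diag_term. destruct (Z.lt_trichotomy l 0) as [Hl|Hl].
  { rewrite rq_neg by lia; ring. }
  destruct Hs as [-> | ->].
  - destruct Hl as [->|Hl].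
    + replace (2 * (2 * 0 + 1))%Z with (Z.of_nat 2) by lia. rewrite zp_nat.
      replace (q ^ 2 - 1 * q ^ 2) with (0 : C) by ring.
      replace ((0 : C) ^ 2) with (0 : C) by (simpl; ring). rewrite !Cmult_0_l. reflexivity.
    + rewrite !Cmult_1_l. replace (6 - 2 * (2 * l + 1))%Z with (4 * (- l + 1))%Z by ring.
      rewrite <- (zp_Q4 q (- l + 1)), (qpoch_inf_zp (q ^ 2)) by assumption. rewrite (rq_neg _ (- l)) by lia.
      ring.
  - replace (- (-1 * zp q (2 - 2 * (2 * l + 1)))) with (zp (Q4 q) (- l)).
    + unfold qpz. rewrite (qpoch_zero _ _ (Z.to_nat l)).
      * ring.
      * lia.
      * rewrite <- (zp_pow (Q4 q)), <- zp_add by (try lia; apply HQ). rewrite <- (zp_0 (Q4 q)). f_equal; ring.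
    + rewrite zp_Q4 by assumption. replace (4 * - l)%Z with (2 - 2 * (2 * l + 1))%Z by ring. ring.
Qed.

Lemma qpoch_S (a Q : C) n : qpoch a Q (S n) = qpoch a Q n * (1 - a * Q ^ n).
Proof. reflexivity. Qed.

(** Factors 1 - P^(2k) with k even form (P^4; P^4)_l; those with k odd split as (1 - P^k)(1 +
    P^k). *)
Lemma qpoch_double (P : C) l :
  qpoch (P ^ 2) (P ^ 2) (2 * l) = qpoch P (P ^ 2) l * qpoch (- P) (P ^ 2) l * qpoch ((P ^ 2) ^ 2) ((P ^ 2) ^ 2) l.
Proof.
  induction l as [|l IH]; [simpl; ring|].
  replace (2 * S l)%nat with (S (S (2 * l))) by lia. rewrite !qpoch_S, IH.
  set (Q := P ^ 2) in *. rewrite (Cpow_S Q (2 * l)), (Nat.mul_comm 2 l), Cpow_mult_r.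
  replace ((Q ^ 2) ^ l) with ((Q ^ l) ^ 2) by (rewrite <- !Cpow_mult_r; f_equal; lia).
  set (X := Q ^ l). assert (EQ : Q = P * P) by apply Cpow2.
  rewrite !Cpow2.
  replace (1 - Q * (X * X)) with ((1 - P * X) * (1 - - P * X)) by (rewrite EQ; ring). ring.
Qed.

(** [qpoch_reverse] at x = s P, a fixed point of x -> Q / x because s^2 = 1. *)
Lemma qpoch_reverse_gauss (P : C) l : base P -> forall s, is_sign s ->
  qpoch (s * P * zp (P ^ 2) (- Z.of_nat l)) (P ^ 2) l * zp P (Z.of_nat l * Z.of_nat l)
  = zp (- s) (Z.of_nat l) * qpoch (s * P) (P ^ 2) l.
Proof.
  intros Hb s Hs. assert (HP := proj1 Hb). assert (Hs0 := sign_neq0 s Hs).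
  assert (HQ : P ^ 2 <> 0) by now apply Cpow_nz.
  assert (R := qpoch_reverse (s * P) (P ^ 2) l (Cmult_neq_0 _ _ Hs0 HP) HQ).
  set (L := Z.of_nat l) in *.
  replace (P ^ 2 / (s * P)) with (s * P) in R.
  2: { transitivity ((s * s) * (P ^ 2) / (s * P)); [field; auto|]. rewrite sign_sq by assumption.
       field; auto. }
  assert (HT : (L * (L - 1) = 2 * (L * (L - 1) / 2))%Z).
  { assert (Heven : Z.even (L * (L - 1)) = true).
    { rewrite Z.even_mul, Z.even_sub. destruct (Z.even L); reflexivity. }
    apply Z.even_spec in Heven as [k Hk]. rewrite Hk, (Z.mul_comm 2 k), Z.div_mul; lia. }
  rewrite !(zp_sq P (L * _ / 2)), <- HT, (zp_sq P L) in R by assumption.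
  replace ((- (s * P)) ^ l) with (zp (- s) L * zp P L) in R.
  2: { rewrite <- zp_mult_l. unfold L. rewrite zp_nat. f_equal; ring. }
  assert (HL := zp_neq0 P L HP).
  assert (E1 : zp P (L * L) * zp P L = zp P (2 * L) * zp P (L * (L - 1))).
  { rewrite <- !zp_add by assumption. f_equal; ring. }
  set (X := qpoch (s * P * zp (P ^ 2) (- L)) (P ^ 2) l) in *.
  transitivity (X * (zp P (L * L) * zp P L) / zp P L); [field; assumption|].
  rewrite E1. transitivity ((X * zp P (2 * L) * zp P (L * (L - 1))) / zp P L); [field; assumption|].
  rewrite R; field; assumption.
Qed.

(** With y = s q^2 Q^(-l) the squared factor contains (1 - y)^2. One 1 - y completes (y Q; Q)_oo to
    (y; Q)_oo, and reversal removes the negative exponents; the other, times Q^(2l), is Q^(2l) - s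
    q^2 Q^l and produces the two series. *)
Lemma diag_even (s q : C) l : is_sign s -> base q -> diag_term s q (2 * l) =
  qpoch_inf (s * q ^ 2) (Q4 q) *
  (heine_term (s * q ^ 2) (- (Q4 q) ^ 2) l - s * q ^ 2 * heine_term (s * q ^ 2) (- Q4 q) l).
Proof.
  intros Hs Hb. assert (Hq := proj1 Hb). assert (Hb2 := base_sq q Hb). assert (HQ := base_Q4 q Hb).
  assert (Hs0 := sign_neq0 s Hs). assert (Hs2 := sign_sq s Hs).
  assert (EsQ : (s * q ^ 2) ^ 2 = Q4 q).
  { transitivity ((s * s) * Q4 q); [simpl; ring|]. rewrite Hs2; ring. }
  unfold heine_term. rewrite EsQ.
  destruct (Z.le_gt_cases 0 l) as [Hl|Hl].
  2: { unfold diag_term. rewrite (rq_neg _ (2 * l)), (rq_neg _ l) by lia. ring. }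
  destruct (Z_of_nat_complete l Hl) as [m ->]. clear Hl.
  set (P := q ^ 2) in *. set (Q := P ^ 2) in *. set (L := Z.of_nat m).
  assert (HzP : forall k, zp P k = zp q (2 * k)) by (intros; now apply zp_sq).
  assert (HzQ : forall k, zp Q k = zp q (4 * k)) by (intros; now apply zp_Q4).
  unfold diag_term. fold P Q.
  replace (Z.of_nat m) with L by reflexivity.
  set (y := s * zp q (2 - 2 * (2 * L))).
  assert (Ey : y = s * P * zp Q (- L)).
  { unfold y. rewrite HzQ. unfold P. rewrite <- (zp_nat q 2), <- Cmult_assoc, <- zp_add by assumption.
    f_equal; f_equal; simpl (Z.of_nat 2); ring. }
  assert (Hy : y <> 0) by (apply Cmult_neq_0; auto using zp_neq0).
  assert (EyQ : s * zp q (6 - 2 * (2 * L)) = y * Q).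
  { unfold y, Q, P. rewrite <- Cpow_mult_r, <- (zp_nat q (2 * 2)), <- Cmult_assoc, <- zp_add by assumption.
    f_equal; f_equal; simpl (Z.of_nat (2 * 2)); ring. }
  assert (I1 := qpoch_reverse_gauss P m Hb2 s Hs). fold Q L in I1. rewrite <- Ey in I1.
  assert (Hms : is_sign (- s)) by (destruct Hs as [-> | ->]; [right|left]; ring).
  assert (I2 := qpoch_reverse_gauss P m Hb2 (- s) Hms). fold Q L in I2.
  replace (- s * P * zp Q (- L)) with (- y) in I2 by (rewrite Ey; ring).
  replace (- - s) with s in I2 by ring. replace (- s * P) with (- (s * P)) in I2 by ring.
  assert (I3 : qpoch_inf y Q = qpoch y Q m * qpoch_inf (s * P) Q).
  { assert (SP := qpoch_inf_split P y m Hb2 Hy). fold Q in SP. rewrite SP.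
    replace (y * Q ^ m) with (s * P); [reflexivity|]. rewrite Ey. unfold L.
    rewrite <- (zp_nat Q m), <- (Cmult_assoc (s * P)), <- zp_add, Z.add_opp_diag_l, zp_0 by apply HQ. ring. }
  assert (I4 : qpoch_inf y Q = (1 - y) * qpoch_inf (y * Q) Q).
  { assert (SP := qpoch_inf_split P y 1 Hb2 Hy). fold Q in SP. rewrite SP.
    replace (y * Q ^ 1) with (y * Q) by (simpl; ring). simpl (qpoch y Q 1). ring. }
  assert (I5 : qpz (- y) Q (2 * L) = qpoch (- y) Q m * qpoch (- (s * P)) Q m).
  { unfold qpz. replace (Z.to_nat (2 * L)) with (m + m)%nat by (unfold L; lia). rewrite qpoch_add.
    f_equal. f_equal. rewrite Ey. unfold L.
    transitivity (- (s * P) * (zp Q (- Z.of_nat m) * Q ^ m)); [ring|].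
    rewrite <- (zp_nat Q m), <- zp_add, Z.add_opp_diag_l, zp_0 by apply HQ. ring. }
  assert (I6 : rq Q (2 * L) = rq (Q ^ 2) L / (qpoch (s * P) Q m * qpoch (- (s * P)) Q m)).
  { unfold L. replace (2 * Z.of_nat m)%Z with (Z.of_nat (2 * m)) by lia. rewrite !rq_nat.
    assert (D := qpoch_double (s * P) m). rewrite EsQ in D. rewrite D, !Cinv_mul. unfold Cdiv.
    rewrite Cinv_mul. ring. }
  assert (HsP : (Cmod (s * P) < 1)%R).
  { rewrite Cmod_mult. rewrite <- (zp_1 s), (Cmod_sign s 1 Hs). rewrite Rmult_1_l. apply Hb2. }
  assert (N1 : qpoch (s * P) Q m <> 0) by (apply qpoch_neq0; [assumption|apply HQ]).
  assert (N2 : qpoch (- (s * P)) Q m <> 0) by (apply qpoch_neq0; [now rewrite Cmod_opp|apply HQ]).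
  assert (I7 : P - s * zp q (2 * (2 * L)) = - s * zp q (4 * L) * (1 - y)).
  { unfold y. replace (2 * (2 * L))%Z with (4 * L)%Z by ring.
    replace (2 - 4 * L)%Z with (2 + - (4 * L))%Z by ring. rewrite zp_add, zp_opp by assumption.
    assert (H4 := zp_neq0 q (4 * L) Hq).
    replace (zp q 2) with P by (rewrite zp_pow by lia; reflexivity).
    transitivity ((s * s) * P - s * zp q (4 * L)); [rewrite Hs2; ring|]. field. assumption. }
  rewrite EyQ, I5, I6, I7. fold y.
  unfold qpz. replace (Z.to_nat L) with m by (unfold L; lia).
  replace (- Q ^ 2) with (-1 * Q ^ 2) by ring. replace (- Q) with (-1 * Q) by ring.
  rewrite !zp_mult_l, (zp_sq Q) by apply HQ. rewrite !HzQ.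
  set (Z4 := zp q (4 * L)).
  replace (zp q (4 * (2 * L))) with (Z4 * Z4) by (unfold Z4; rewrite <- zp_add by assumption; f_equal; ring).
  rewrite HzP in I1, I2.
  assert (E2 : zp q (2 * L * (2 * L)) = zp q (2 * (L * L)) * zp q (2 * (L * L))).
  { rewrite <- zp_add by assumption; f_equal; ring. }
  rewrite E2. set (g := zp q (2 * (L * L))) in *.
  set (u := qpoch y Q m) in *. set (v := qpoch (- y) Q m) in *.
  set (b := qpoch (s * P) Q m) in *. set (d := qpoch (- (s * P)) Q m) in *.
  set (X := qpoch_inf (y * Q) Q) in *. set (Y := qpoch_inf (s * P) Q) in *. set (r := rq (Q ^ 2) L).
  transitivity ((s * s) * (Z4 * Z4) * (1 - y) * ((1 - y) * X) * (g * g) * (v * d) * (r / (b * d))).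
  { field. auto. }
  rewrite <- I4, I3, Hs2.
  transitivity ((Z4 * Z4) * (1 - y) * Y * (u * g) * (v * g) * r / b); [field; auto|].
  rewrite I1, I2.
  assert (ES : zp (- s) L * zp s L = zp (-1) L).
  { rewrite <- zp_mult_l. f_equal. transitivity (- (s * s)); [ring|]. rewrite Hs2; ring. }
  assert (EZ : Z4 * Z4 * (1 - y) = Z4 * Z4 - s * P * Z4).
  { rewrite Ey, zp_opp by apply HQ. rewrite HzQ. fold Z4. field. now apply zp_neq0. }
  rewrite EZ. transitivity ((zp (- s) L * zp s L) * (Z4 * Z4 - s * P * Z4) * Y * d * r); [field; auto|].
  rewrite ES; ring.
Qed.

(** n^2 and n have the same parity, so s^(3n^2) = s^n. *)
Lemma theta_cube_sign (s q : C) : is_sign s -> base q -> theta ((s * q) ^ 3) 1 = theta (q ^ 3) s.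
Proof.
  intros Hs Hb. unfold theta. apply usum_ext; intros n. rewrite zp_1_l, Cmult_1_r.
  replace ((s * q) ^ 3) with (s * q ^ 3 * (s * s)) by (simpl; ring). rewrite sign_sq, Cmult_1_r by assumption.
  rewrite zp_mult_l, Cmult_comm. f_equal. destruct Hs as [-> | ->]; [now rewrite !zp_1_l|].
  destruct (Z.Even_or_Odd n) as [[k Hk]|[k Hk]]; subst n.
  - rewrite zp_m1_even. replace (2 * k * (2 * k))%Z with (2 * (2 * (k * k)))%Z by ring. apply zp_m1_even.
  - replace ((2 * k + 1) * (2 * k + 1))%Z with (2 * (2 * (k * k) + 2 * k) + 1)%Z by ring.
    now rewrite !zp_m1_succ, !zp_m1_even.
Qed.

(** [alternating_sum] at P = s q^2 covers both signs. The product (s q^2; Q)_oo occurs twice, once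
    from the diagonal terms and once from that identity, and completes with (Q; Q)_oo to a theta
    function. *)
Lemma smoothed_sum (s q : C) : is_sign s -> base q ->
  qpoch_inf (Q4 q) (Q4 q) ^ 2 * qpoch_inf (- Q4 q) (Q4 q) * usum (smoothed q (a_sum 1 q) (b_sum s q))
  = theta (q ^ 2) (- s) * theta ((q ^ 2) ^ 3) s.
Proof.
  intros Hs Hb. assert (Hq := proj1 Hb). assert (Hb2 := base_sq q Hb).
  assert (Hs0 := sign_neq0 s Hs). assert (Hs2 := sign_sq s Hs).
  rewrite smoothed_sum_pair by assumption.
  destruct (pair_sum_diag s q Hs Hb) as [SD ->].
  assert (EsQ : (s * q ^ 2) ^ 2 = Q4 q).
  { transitivity ((s * s) * Q4 q); [simpl; ring|]. rewrite Hs2; ring. }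
  assert (HsP : base (s * q ^ 2)).
  { split; [now apply Cmult_neq_0; [|apply Cpow_nz]|].
    rewrite Cmod_mult. rewrite <- (zp_1 s), (Cmod_sign s 1 Hs). rewrite Rmult_1_l. apply Hb2. }
  rewrite (usum_reindex (fun l => 2 * l)%Z); [|intros; lia| |assumption].
  2: { intros n Hn. destruct (Z.Even_or_Odd n) as [[k Hk]|[k Hk]]; subst n.
       - exfalso; apply (Hn k); reflexivity.
       - now apply diag_odd. }
  rewrite (usum_ext _ _ (fun l => diag_even s q l Hs Hb)).
  assert (B1 : base (- Q4 q)) by now apply base_opp, base_Q4.
  assert (B2 : base (- (Q4 q) ^ 2)) by now apply base_opp, base_sq, base_Q4.
  assert (S1 := summable_heine _ _ HsP B1). assert (S2 := summable_heine _ _ HsP B2).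
  rewrite usum_scal by (apply summable_minus; [assumption|now apply summable_scal]).
  rewrite usum_minus, usum_scal by (auto using summable_scal).
  assert (AS := alternating_sum (s * q ^ 2) HsP). rewrite EsQ in AS.
  rewrite theta_cube_sign in AS by assumption.
  rewrite theta_prod by (auto using Copp_neq0).
  replace (- (q ^ 2 * - s)) with (s * q ^ 2) by ring.
  replace (- (q ^ 2 / - s)) with (s * q ^ 2).
  2: { transitivity ((s * s) * q ^ 2 / s); [field; assumption|]. rewrite Hs2; field; assumption. }
  set (Y := qpoch_inf (s * q ^ 2) (Q4 q)) in *. set (E0 := qpoch_inf (Q4 q) (Q4 q)) in *.
  set (E1 := qpoch_inf (- Q4 q) (Q4 q)) in *. rewrite Cpow2.
  transitivity (E0 * Y * (E0 * E1 * (usum (heine_term (s * q ^ 2) (- (Q4 q) ^ 2)) - s * q ^ 2 * usum (heine_term (s * q ^ 2) (- Q4 q))))).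
  - ring.
  - rewrite AS. ring.
Qed.

(** The prefactor collects 2 from the averaging, 2 q (Q; Q)_oo from the connection formula and (Q;
    Q)_oo^2 (-Q; Q)_oo from the smoothed sums. *)
Lemma triple_sum_theta (q : C) : base q ->
  4 * q * qpoch_inf (Q4 q) (Q4 q) ^ 3 * qpoch_inf (- Q4 q) (Q4 q) * usum (triple_term q)
  = theta q 1 * theta (q ^ 2) 1 * theta ((q ^ 2) ^ 3) (-1)
    - theta q (-1) * theta (q ^ 2) (-1) * theta ((q ^ 2) ^ 3) 1.
Proof.
  intros Hb. assert (Hq := proj1 Hb).
  destruct (triple_sum_weight q Hb) as [SV ->].
  destruct (smoothing q _ _ Hb (a_sum_solves q Hb) (t_sum_solves q Hb) SV) as [SS E2].
  assert (P1 := smoothed_sum 1 q (or_introl eq_refl) Hb).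
  assert (P2 := smoothed_sum (-1) q (or_intror eq_refl) Hb).
  assert (Sb : forall s, is_sign s -> summable (smoothed q (a_sum 1 q) (b_sum s q))).
  { intros s Hs. eapply summable_ext; [intros j; now apply pair_slice|].
    apply (summable_fst (pair_term s q)). now apply summable_pair. }
  assert (S1 := Sb 1 (or_introl eq_refl)). assert (S2 := Sb (-1) (or_intror eq_refl)).
  set (E0 := qpoch_inf (Q4 q) (Q4 q)) in *. set (E1 := qpoch_inf (- Q4 q) (Q4 q)) in *.
  assert (HE0 : E0 <> 0) by now apply (qpoch_inf_QQ_neq0 (q ^ 2)), base_sq.
  (* Only now is t replaced by a and b: after smoothing each piece is summable by itself. *)
  assert (E3 : usum (smoothed q (a_sum 1 q) (t_sum q)) = / (2 * q * E0) *
    (theta q 1 * usum (smoothed q (a_sum 1 q) (b_sum (-1) q))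
     - theta q (-1) * usum (smoothed q (a_sum 1 q) (b_sum 1 q)))).
  { rewrite <- (usum_scal _ (theta q 1)), <- (usum_scal _ (theta q (-1))), <- usum_minus, <- usum_scal
      by auto using summable_scal, summable_minus.
    apply usum_ext; intros j. unfold smoothed. rewrite !t_sum_eq by assumption. fold E0.
    assert (EB : forall j, b_sum 1 q j = a_sum 1 q j) by (intros; unfold b_sum; rewrite zp_1_l; ring).
    rewrite !EB. ring. }
  transitivity (2 * q * E0 ^ 3 * E1 * (2 * usum (fun j => weight q j * (a_sum 1 q j * t_sum q j)))); [ring|].
  rewrite E2, E3.
  transitivity (theta q 1 * (E0 ^ 2 * E1 * usum (smoothed q (a_sum 1 q) (b_sum (-1) q)))
    - theta q (-1) * (E0 ^ 2 * E1 * usum (smoothed q (a_sum 1 q) (b_sum 1 q)))).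
  - field. split; assumption.
  - rewrite P1, P2. replace (- -1 : C) with (1 : C) by ring. replace (- (1) : C) with (-1 : C) by ring. ring.
Qed.

(** * The ternary theta identity *)

Lemma theta_split (a z : C) : base a -> z <> 0 ->
  theta a z = theta (a ^ 4) (z * z) + a * z * theta (a ^ 4) (a ^ 4 * (z * z)).
Proof.
  intros Hb Hz. assert (Ha := proj1 Hb). assert (S := summable_theta a z Hb Hz).
  assert (Hb4 := base_pow a 3 Hb). assert (Hz2 : z * z <> 0) by now apply Cmult_neq_0.
  assert (Hz4 : a ^ 4 * (z * z) <> 0) by (apply Cmult_neq_0; [apply Hb4|assumption]).
  set (f := fun n => zp a (n * n) * zp z n) in *.
  set (fe := fun n => if Z.even n then f n else RtoC 0).
  set (fo := fun n => if Z.even n then RtoC 0 else f n).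
  assert (Se : summable fe).
  { apply (summable_le _ f); [|assumption]. intros n; unfold fe. destruct (Z.even n); [lra|].
    rewrite Cmod_0; apply Cmod_ge_0. }
  assert (So : summable fo).
  { apply (summable_le _ f); [|assumption]. intros n; unfold fo. destruct (Z.even n); [|lra].
    rewrite Cmod_0; apply Cmod_ge_0. }
  assert (E : theta a z = usum fe + usum fo).
  { rewrite <- usum_plus by assumption. apply usum_ext; intros n; unfold fe, fo, f.
    destruct (Z.even n); ring. }
  rewrite E. f_equal.
  - rewrite (usum_reindex (fun n => 2 * n)%Z); [|intros; lia| |assumption].
    + apply usum_ext; intros n. unfold fe. rewrite Z.even_mul; simpl orb. unfold f.
      rewrite <- (zp_nat a 4), zp_mul, zp_mult_l, <- zp_add by assumption.
      f_equal; f_equal; [simpl (Z.of_nat 4); ring|ring].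
    + intros n Hn; unfold fe. destruct (Z.even n) eqn:He; [|reflexivity].
      apply Z.even_spec in He as [k ->]. exfalso; apply (Hn k); reflexivity.
  - unfold theta. rewrite <- usum_scal by now apply summable_theta.
    rewrite (usum_reindex (fun n => 2 * n + 1)%Z); [|intros; lia| |assumption].
    + apply usum_ext; intros n. unfold fo. rewrite Z.even_add, Z.even_mul; simpl (negb _).
      cbn [orb Bool.eqb Z.even].
      unfold f. rewrite !(zp_mult_l), <- (zp_nat a 4), !zp_mul, zp_succ, <- (zp_add z) by assumption.
      replace (n + n)%Z with (2 * n)%Z by ring.
      replace ((2 * n + 1) * (2 * n + 1))%Z with (Z.of_nat 4 * (n * n) + Z.of_nat 4 * n + 1)%Z by (simpl (Z.of_nat 4); ring).
      rewrite zp_succ, (zp_add a) by assumption. ring.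
    + intros n Hn; unfold fo. destruct (Z.even n) eqn:He; [reflexivity|].
      rewrite <- Z.negb_odd in He. apply Bool.negb_false_iff in He.
      apply Z.odd_spec in He as [k ->]. exfalso; apply (Hn k); reflexivity.
Qed.

Lemma theta_shift (a z : C) : base a -> z <> 0 -> theta a z = a * z * theta a (a ^ 2 * z).
Proof.
  intros Hb Hz. assert (Ha := proj1 Hb). unfold theta at 1. rewrite <- usum_shift by now apply summable_theta.
  assert (Hz2 : a ^ 2 * z <> 0) by (apply Cmult_neq_0; [now apply Cpow_nz|assumption]).
  unfold theta. rewrite <- usum_scal by now apply summable_theta. apply usum_ext; intros n.
  rewrite zp_mult_l, zp_sq, (zp_succ z) by assumption.
  replace ((n + 1) * (n + 1))%Z with (n * n + 2 * n + 1)%Z by ring.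
  rewrite zp_succ, zp_add by assumption. ring.
Qed.

Lemma theta_inv (a z : C) : base a -> z <> 0 -> theta a (/ z) = theta a z.
Proof.
  intros Hb Hz. unfold theta at 2. rewrite usum_neg by now apply summable_theta.
  apply usum_ext; intros n. replace (- n * - n)%Z with (n * n)%Z by ring. f_equal.
  rewrite zp_opp by assumption. rewrite <- (zp_1 z) at 1. rewrite <- zp_opp, zp_mul by assumption.
  rewrite <- zp_opp by assumption. f_equal; ring.
Qed.

(** In the sum of a^(n^2+n) the reflection n -> -1 - n exchanges even and odd n. *)
Lemma theta_odd (a : C) : base a -> theta a a = 2 * theta (a ^ 4) (a ^ 2).
Proof.
  intros Hb. assert (Ha := proj1 Hb). assert (Hb4 := base_pow a 3 Hb).
  rewrite theta_split by assumption. replace (a * a) with (a ^ 2) by (simpl; ring).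
  rewrite <- (theta_inv (a ^ 4) (a ^ 2)) at 1 by (auto using Cpow_nz).
  rewrite (theta_shift (a ^ 4) (/ a ^ 2)) by
    (auto; rewrite <- (zp_nat a 2), <- zp_opp by assumption; now apply zp_neq0).
  replace ((a ^ 4) ^ 2 * / a ^ 2) with (a ^ 4 * a ^ 2).
  2: { simpl; field. assumption. }
  replace (a ^ 4 * / a ^ 2) with (a ^ 2) by (simpl; field; assumption).
  assert (E : theta (a ^ 4) (a ^ 2) = a ^ 2 * theta (a ^ 4) (a ^ 4 * a ^ 2)).
  { rewrite <- (theta_inv (a ^ 4) (a ^ 2)) by (auto using Cpow_nz).
    rewrite (theta_shift (a ^ 4) (/ a ^ 2)) by
      (auto; rewrite <- (zp_nat a 2), <- zp_opp by assumption; now apply zp_neq0).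
    replace ((a ^ 4) ^ 2 * / a ^ 2) with (a ^ 4 * a ^ 2) by (simpl; field; assumption).
    f_equal. simpl; field. assumption. }
  rewrite E. ring.
Qed.

(** In terms of x + y sqrt(-3): multiply n - n' sqrt(-3) by 1 + sqrt(-3), of norm 4, and add 1. The
    cross terms of x^2 + 3 y^2 cancel, leaving 4n^2 + 2n + 12n'^2 + 6n' + 1. *)
Definition eisenstein_map (x : Z * Z) : Z * Z := ((fst x + 3 * snd x + 1)%Z, (fst x - snd x)%Z).

Lemma eisenstein_inj x y : eisenstein_map x = eisenstein_map y -> x = y.
Proof.
  destruct x as [n m], y as [n' m']; intros H.
  assert (A1 := f_equal fst H). assert (A2 := f_equal snd H).
  unfold eisenstein_map in A1, A2; cbn [fst snd] in A1, A2. f_equal; lia.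
Qed.

(* [x^2 + 3 y^2] at [(n + 3 n' + 1, n - n')] is [((4 n + 1)^2 + 3 (4 n' + 1)^2) / 4], and these points,
   those with [x - y = 1 mod 4], are half of the points with [x - y] odd. *)
Lemma usum_eisenstein (h : Z * Z -> C) : summable h ->
  (forall x y, h (x, (x + 2 * y)%Z) = 0) -> (forall x y, h ((- x)%Z, (- y)%Z) = h (x, y)) ->
  usum h = 2 * usum (fun x => h (eisenstein_map x)).
Proof.
  intros S H0 Hn.
  set (c := fun x : Z * Z => Z.eqb ((fst x - snd x) mod 4) 1).
  set (h1 := fun x => if c x then h x else RtoC 0). set (h2 := fun x => if c x then RtoC 0 else h x).
  assert (S1 : summable h1).
  { apply (summable_le _ h); [|assumption]. intros x; unfold h1. destruct (c x); [lra|].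
    rewrite Cmod_0; apply Cmod_ge_0. }
  assert (S2 : summable h2).
  { apply (summable_le _ h); [|assumption]. intros x; unfold h2. destruct (c x); [|lra].
    rewrite Cmod_0; apply Cmod_ge_0. }
  assert (E : usum h = usum h1 + usum h2).
  { rewrite <- usum_plus by assumption. apply usum_ext; intros x; unfold h1, h2. destruct (c x); ring. }
  set (ng := fun x : Z * Z => ((- fst x)%Z, (- snd x)%Z)).
  assert (E2 : usum h2 = usum h1).
  { rewrite (usum_bij ng ng h2); [| | |assumption].
    2, 3: intros [x y]; unfold ng; cbn [fst snd]; f_equal; ring.
    apply usum_ext; intros [x y]; unfold h1, h2, ng, c; cbn [fst snd].
    destruct (Z.Even_or_Odd (x - y)) as [[k Hk]|[k Hk]].
    - replace y with (x + 2 * (- k))%Z by lia.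
      replace (- (x + 2 * - k))%Z with (- x + 2 * k)%Z by ring. rewrite !H0.
      destruct (Z.eqb _ _), (Z.eqb _ _); reflexivity.
    - rewrite Hn. destruct (Z.eqb_spec ((x - y) mod 4) 1) as [A|A],
        (Z.eqb_spec ((- x - - y) mod 4) 1) as [B|B]; try reflexivity; exfalso;
      revert A B; replace (- x - - y)%Z with (- (x - y))%Z by ring; rewrite Hk;
      Z.div_mod_to_equations; lia. }
  rewrite E, E2. transitivity (2 * usum h1); [ring|]. f_equal.
  rewrite (usum_reindex eisenstein_map h1 eisenstein_inj); [| |assumption].
  - apply usum_ext; intros [n m]; unfold h1, c, eisenstein_map; cbn [fst snd].
    replace (n + 3 * m + 1 - (n - m))%Z with (1 + m * 4)%Z by ring.
    rewrite Z.mod_add by lia. reflexivity.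
  - intros [x y] Hy; unfold h1, c; cbn [fst snd].
    destruct (Z.eqb_spec ((x - y) mod 4) 1) as [A|A]; [|reflexivity].
    exfalso. set (m := ((x - y) / 4)%Z). apply (Hy ((y + m)%Z, m)).
    unfold eisenstein_map; cbn [fst snd]. assert (B := Z.div_mod (x - y) 4 ltac:(lia)).
    fold m in B. rewrite A in B. f_equal; lia.
Qed.

Lemma theta_mult_double (a b z w : C) : base a -> base b -> z <> 0 -> w <> 0 ->
  summable (fun x : Z * Z => zp a (fst x * fst x) * zp z (fst x) * (zp b (snd x * snd x) * zp w (snd x))) /\
  usum (fun x : Z * Z => zp a (fst x * fst x) * zp z (fst x) * (zp b (snd x * snd x) * zp w (snd x)))
  = theta a z * theta b w.
Proof.
  intros Ha Hb Hz Hw. assert (S1 := summable_theta a z Ha Hz). assert (S2 := summable_theta b w Hb Hw).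
  split; [exact (summable_mult _ _ S1 S2)|exact (usum_mult _ _ S1 S2)].
Qed.

Lemma zp_powZ (p : C) n k : p <> 0 -> zp (p ^ n) k = zp p (Z.of_nat n * k).
Proof. intros H. rewrite <- (zp_nat p n). now apply zp_mul. Qed.

(** The summand p^(x^2+3y^2) ((-1)^y - (-1)^x) vanishes for x - y even and has sign factor 2
    (-1)^(n+n') on the image of the lattice map; the other 2 is the central symmetry. *)
Lemma theta_diff (p : C) : base p ->
  theta p 1 * theta (p ^ 3) (-1) - theta p (-1) * theta (p ^ 3) 1
  = 4 * p * (theta (p ^ 4) (- p ^ 2) * theta (p ^ 12) (- p ^ 6)).
Proof.
  intros Hb. assert (Hp := proj1 Hb). assert (Hm := Cm1_neq0). assert (H1 := C1_nz).
  assert (Hb3 := base_pow p 2 Hb).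
  destruct (theta_mult_double p (p ^ 3) 1 (-1) Hb Hb3 H1 Hm) as [S1 E1].
  destruct (theta_mult_double p (p ^ 3) (-1) 1 Hb Hb3 Hm H1) as [S2 E2].
  destruct (theta_mult_double (p ^ 4) (p ^ 12) (- p ^ 2) (- p ^ 6) (base_pow p 3 Hb) (base_pow p 11 Hb)
    (Copp_neq0 _ (Cpow_nz _ _ Hp)) (Copp_neq0 _ (Cpow_nz _ _ Hp))) as [S3 E3].
  rewrite <- E1, <- E2, <- E3, <- usum_minus by assumption.
  assert (SD := summable_minus _ _ S1 S2). assert (SE := summable_comp _ _ eisenstein_inj SD).
  rewrite usum_eisenstein.
  - rewrite <- usum_scal by exact SE.
    rewrite <- usum_scal by assumption. apply usum_ext; intros [n m].
    unfold eisenstein_map; cbn [fst snd]. rewrite !zp_1_l.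
    replace (n + 3 * m + 1)%Z with (n + m + 2 * m + 1)%Z by ring.
    replace (n - m)%Z with (n + m + 2 * (- m))%Z by ring.
    rewrite zp_m1_succ, !(zp_add (-1)), !zp_m1_even by assumption.
    replace (- p ^ 2) with (-1 * p ^ 2) by ring. replace (- p ^ 6) with (-1 * p ^ 6) by ring.
    rewrite !(zp_mult_l (-1)), !zp_powZ by assumption.
    assert (E : zp p ((n + m + 2 * m + 1) * (n + m + 2 * m + 1)) * zp p (Z.of_nat 3 * ((n + m + 2 * - m) * (n + m + 2 * - m)))
      = zp p (Z.of_nat 4 * (n * n)) * zp p (Z.of_nat 2 * n) * (zp p (Z.of_nat 12 * (m * m)) * zp p (Z.of_nat 6 * m)) * p).
    { rewrite <- !zp_add, <- zp_succ by assumption. f_equal.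
      simpl (Z.of_nat _). ring. }
    match type of E with ?u * ?v = _ => transitivity (4 * (zp (-1) n * zp (-1) m) * (u * v)); [ring|] end.
    rewrite E. ring.
  - now apply summable_minus.
  - intros x y; cbn [fst snd]. rewrite !zp_1_l, (zp_add (-1)), zp_m1_even by assumption. ring.
  - intros x y; cbn [fst snd]. rewrite !zp_1_l, !zp_m1_opp.
    replace (- x * - x)%Z with (x * x)%Z by ring. replace (- y * - y)%Z with (y * y)%Z by ring. reflexivity.
Qed.

(** The same map with p^4 for p: 1 - (-1)^(x+y) vanishes for x - y even and is 2 on the image. *)
Lemma theta_sum_aux (p : C) : base p ->
  theta (p ^ 4) 1 * theta (p ^ 12) 1 - theta (p ^ 4) (-1) * theta (p ^ 12) (-1)
  = 4 * p ^ 4 * (theta (p ^ 16) (p ^ 8) * theta (p ^ 48) (p ^ 24)).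
Proof.
  intros Hb. assert (Hp := proj1 Hb). assert (Hm := Cm1_neq0). assert (H1 := C1_nz).
  assert (Hb3 := base_pow p 3 Hb). assert (Hb11 := base_pow p 11 Hb).
  destruct (theta_mult_double (p ^ 4) (p ^ 12) 1 1 Hb3 Hb11 H1 H1) as [S1 E1].
  destruct (theta_mult_double (p ^ 4) (p ^ 12) (-1) (-1) Hb3 Hb11 Hm Hm) as [S2 E2].
  destruct (theta_mult_double (p ^ 16) (p ^ 48) (p ^ 8) (p ^ 24) (base_pow p 15 Hb) (base_pow p 47 Hb)
    (Cpow_nz _ _ Hp) (Cpow_nz _ _ Hp)) as [S3 E3].
  rewrite <- E1, <- E2, <- E3, <- usum_minus by assumption.
  assert (SD := summable_minus _ _ S1 S2). assert (SE := summable_comp _ _ eisenstein_inj SD).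
  rewrite usum_eisenstein.
  - rewrite <- usum_scal by exact SE.
    rewrite <- usum_scal by assumption. apply usum_ext; intros [n m].
    unfold eisenstein_map; cbn [fst snd]. rewrite !zp_1_l.
    replace (n + 3 * m + 1)%Z with (n + m + 2 * m + 1)%Z by ring.
    replace (n - m)%Z with (n + m + 2 * (- m))%Z by ring.
    rewrite zp_m1_succ, !(zp_add (-1)), !zp_m1_even by assumption.
    rewrite !zp_powZ by assumption.
    assert (E : zp p (Z.of_nat 4 * ((n + m + 2 * m + 1) * (n + m + 2 * m + 1))) * zp p (Z.of_nat 12 * ((n + m + 2 * - m) * (n + m + 2 * - m)))
      = zp p (Z.of_nat 16 * (n * n)) * zp p (Z.of_nat 8 * n) * (zp p (Z.of_nat 48 * (m * m)) * zp p (Z.of_nat 24 * m)) * zp p (Z.of_nat 4)).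
    { rewrite <- !zp_add by assumption. f_equal.
      simpl (Z.of_nat _). ring. }
    assert (En : forall k, zp (-1) k * zp (-1) k = 1).
    { intros k. rewrite <- zp_add by assumption. replace (k + k)%Z with (2 * k)%Z by ring. apply zp_m1_even. }
    match type of E with ?u * ?v = _ => transitivity (2 * (1 + (zp (-1) n * zp (-1) n) * (zp (-1) m * zp (-1) m)) * (u * v)); [ring|] end.
    rewrite E, !En, zp_nat. ring.
  - now apply summable_minus.
  - intros x y; cbn [fst snd]. rewrite !zp_1_l, (zp_add (-1)), zp_m1_even by assumption.
    assert (En : forall k, zp (-1) k * zp (-1) k = 1).
    { intros k. rewrite <- zp_add by assumption. replace (k + k)%Z with (2 * k)%Z by ring. apply zp_m1_even. }
    set (u := zp (p ^ 4) (x * x)). set (v := zp (p ^ 12) _).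
    transitivity (u * v * (1 - zp (-1) x * zp (-1) x)); [ring|]. rewrite En; ring.
  - intros x y; cbn [fst snd]. rewrite !zp_1_l, !zp_m1_opp.
    replace (- x * - x)%Z with (x * x)%Z by ring. replace (- y * - y)%Z with (y * y)%Z by ring. reflexivity.
Qed.

(** Splitting into even and odd parts, the thetas are A + 2pB, A - 2pB and C + 2p^3 D, C - 2p^3 D.
    The mixed terms cancel and 2 (A C - 4 p^4 B D) remains, which [theta_sum_aux] evaluates. *)
Lemma theta_sum (p : C) : base p ->
  theta p 1 * theta (p ^ 3) (-1) + theta p (-1) * theta (p ^ 3) 1
  = 2 * (theta (p ^ 4) (-1) * theta (p ^ 12) (-1)).
Proof.
  intros Hb. assert (Hp := proj1 Hb). assert (Hm := Cm1_neq0). assert (H1 := C1_nz).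
  assert (A := theta_sum_aux p Hb).
  assert (Sp : forall a z, base a -> z * z = 1 -> theta a z = theta (a ^ 4) 1 + 2 * a * z * theta (a ^ 16) (a ^ 8)).
  { intros a z Ha Hz. assert (Hz0 : z <> 0) by (intros ->; rewrite Cmult_0_l in Hz; now apply H1).
    rewrite theta_split, Hz, Cmult_1_r, theta_odd by (auto; now apply (base_pow a 3)).
    rewrite <- !Cpow_mult_r. simpl (4 * _)%nat. ring. }
  assert (Hb3 := base_pow p 2 Hb).
  rewrite (Sp p 1), (Sp p (-1)), (Sp (p ^ 3) 1), (Sp (p ^ 3) (-1)) by (auto; ring).
  rewrite <- !Cpow_mult_r. simpl (3 * _)%nat.
  transitivity (2 * (theta (p ^ 4) 1 * theta (p ^ 12) 1 - 4 * p ^ 4 * (theta (p ^ 16) (p ^ 8) * theta (p ^ 48) (p ^ 24)))).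
  - simpl (p ^ 4). simpl (p ^ 3). ring.
  - rewrite <- A. ring.
Qed.

(** * Product dissections *)

Fixpoint cprod (f : nat -> C) (m : nat) : C :=
  match m with O => 1 | S m => cprod f m * f m end.

Lemma cprod_mult (f g : nat -> C) m : cprod (fun i => f i * g i) m = cprod f m * cprod g m.
Proof. induction m as [|m IH]; simpl; [ring|]. rewrite IH; ring. Qed.

Lemma cprod_ext (f g : nat -> C) m : (forall i, f i = g i) -> cprod f m = cprod g m.
Proof. intros H; induction m as [|m IH]; simpl; [reflexivity|]. now rewrite IH, H. Qed.

Lemma qpoch_cprod (x Q : C) m : qpoch x Q m = cprod (fun i => 1 - x * Q ^ i) m.
Proof. induction m as [|m IH]; simpl; [reflexivity|]. now rewrite IH. Qed.

(** Factors are grouped by the residue of their index modulo m. *)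
Lemma qpoch_dissect (x Q : C) m n :
  qpoch x Q (m * n) = cprod (fun i => qpoch (x * Q ^ i) (Q ^ m) n) m.
Proof.
  induction n as [|n IH].
  - rewrite Nat.mul_0_r. simpl. induction m as [|m IHm]; simpl; [reflexivity|].
    rewrite <- IHm; ring.
  - rewrite Nat.mul_succ_r, qpoch_add, IH, (qpoch_cprod _ Q m), <- cprod_mult.
    apply cprod_ext; intros i. rewrite (qpoch_S _ _ n), <- Cpow_mult_r. f_equal. ring.
Qed.

Lemma clim_cprod (f : nat -> nat -> C) (l : nat -> C) m :
  (forall i, (i < m)%nat -> clim (f i) (l i)) -> clim (fun n => cprod (fun i => f i n) m) (cprod l m).
Proof.
  intros H; induction m as [|m IH]; simpl; [apply clim_const|].
  apply clim_mult; [apply IH; intros; apply H; lia|apply H; lia].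
Qed.

Lemma qpoch_inf_dissect (P x : C) m : base P -> x <> 0 -> (0 < m)%nat ->
  qpoch_inf x (P ^ 2) = cprod (fun i => qpoch_inf (x * (P ^ 2) ^ i) ((P ^ 2) ^ m)) m.
Proof.
  intros Hb Hx Hm. assert (HP := proj1 Hb).
  apply (clim_unique (fun n => qpoch x (P ^ 2) (m * n))).
  - apply (clim_subseq (qpoch x (P ^ 2)) (fun n => m * n)%nat); [intros; nia|]. now apply qpoch_lim.
  - apply (clim_ext (fun n => cprod (fun i => qpoch (x * (P ^ 2) ^ i) ((P ^ 2) ^ m) n) m)).
    + intros n; now rewrite qpoch_dissect.
    + apply (clim_cprod (fun i n => qpoch (x * (P ^ 2) ^ i) ((P ^ 2) ^ m) n)). intros i _.
      replace ((P ^ 2) ^ m) with ((P ^ m) ^ 2) by (rewrite <- !Cpow_mult_r; f_equal; lia).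
      apply qpoch_lim.
      * destruct m as [|m]; [lia|]. now apply base_pow.
      * apply Cmult_neq_0; [assumption|]. now repeat apply Cpow_nz.
Qed.

Lemma qpoch_opp (x Q : C) n : qpoch x Q n * qpoch (- x) Q n = qpoch (x ^ 2) (Q ^ 2) n.
Proof.
  induction n as [|n IH]; [simpl; ring|].
  rewrite !qpoch_S, <- IH. rewrite <- (Cpow_mult_r Q 2 n), (Nat.mul_comm 2 n), (Cpow_mult_r Q n 2), !Cpow2.
  ring.
Qed.

Lemma qpoch_inf_opp (P x : C) : base P -> x <> 0 ->
  qpoch_inf x (P ^ 2) * qpoch_inf (- x) (P ^ 2) = qpoch_inf (x ^ 2) ((P ^ 2) ^ 2).
Proof.
  intros Hb Hx. apply (clim_unique (qpoch (x ^ 2) ((P ^ 2) ^ 2))).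
  - apply (clim_ext (fun n => qpoch x (P ^ 2) n * qpoch (- x) (P ^ 2) n)); [intros; apply qpoch_opp|].
    apply clim_mult; apply qpoch_lim; auto using Copp_neq0.
  - apply qpoch_lim; [now apply base_sq|now apply Cpow_nz].
Qed.

(** The exponent of the base is even by construction, so the results on a base P^2 apply with P =
    q^b. *)
Definition pe (s q : C) (a b : nat) : C := qpoch_inf (s * q ^ a) (q ^ (2 * b)).

Lemma pe_dissect (s q : C) a b m : base q -> is_sign s -> (0 < b)%nat -> (0 < m)%nat ->
  pe s q a b = cprod (fun i => pe s q (a + 2 * b * i) (b * m)) m.
Proof.
  intros Hb Hs Hb0 Hm. unfold pe. rewrite (Nat.mul_comm 2 b), Cpow_mult_r.
  rewrite (qpoch_inf_dissect (q ^ b) _ m).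
  - apply cprod_ext; intros i. rewrite <- !Cpow_mult_r, <- Cmult_assoc, <- Cpow_add_r.
    f_equal; [f_equal; f_equal; ring|f_equal; ring].
  - destruct b as [|b]; [lia|]. now apply base_pow.
  - apply Cmult_neq_0; [now apply sign_neq0|apply Cpow_nz, Hb].
  - assumption.
Qed.

Lemma pe_opp (q : C) a b : base q -> (0 < b)%nat -> pe 1 q a b * pe (-1) q a b = pe 1 q (2 * a) (2 * b).
Proof.
  intros Hb Hb0. unfold pe. rewrite (Nat.mul_comm 2 b), Cpow_mult_r.
  replace (-1 * q ^ a) with (- (1 * q ^ a)) by ring. rewrite qpoch_inf_opp.
  - rewrite <- !Cpow_mult_r, !Cmult_1_l, <- Cpow_mult_r. f_equal; f_equal; ring.
  - destruct b as [|b]; [lia|]. now apply base_pow.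
  - apply Cmult_neq_0; [apply C1_nz|apply Cpow_nz, Hb].
Qed.

Lemma pe_neq0 (s q : C) a b : base q -> is_sign s -> (0 < a)%nat -> (0 < b)%nat -> pe s q a b <> 0.
Proof.
  intros Hb Hs Ha Hb0. unfold pe. rewrite (Nat.mul_comm 2 b), Cpow_mult_r.
  assert (Hqb : base (q ^ b)) by (destruct b as [|b]; [lia|now apply base_pow]).
  apply qpoch_inf_neq0; [assumption| |].
  - apply Cmult_neq_0; [now apply sign_neq0|apply Cpow_nz, Hb].
  - intros n; apply qpoch_neq0; [|now apply base_sq].
    rewrite Cmod_mult. rewrite <- (zp_1 s), (Cmod_sign s 1 Hs), Rmult_1_l.
    destruct a as [|a]; [lia|]. now apply base_pow.
Qed.

Lemma theta_pe (s q : C) a b : base q -> is_sign s -> (b <= a)%nat -> (0 < a)%nat ->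
  theta (q ^ a) (s * q ^ b) = pe (- s) q (a + b) a * pe (- s) q (a - b) a * pe 1 q (2 * a) a.
Proof.
  intros Hb Hs Hab Ha. assert (Hq := proj1 Hb). assert (Hs0 := sign_neq0 s Hs).
  assert (Hqa : base (q ^ a)) by (destruct a as [|a]; [lia|now apply base_pow]).
  rewrite theta_prod by (auto; apply Cmult_neq_0; auto using Cpow_nz).
  unfold pe. rewrite (Nat.mul_comm 2 a), Cpow_mult_r, Cmult_1_l.
  replace (- (q ^ a * (s * q ^ b))) with (- s * q ^ (a + b)) by (rewrite Cpow_add_r; ring).
  replace (- (q ^ a / (s * q ^ b))) with (- s * q ^ (a - b)); [reflexivity|].
  replace a with (a - b + b)%nat at 2 by lia. rewrite Cpow_add_r.
  assert (Hqb := Cpow_nz q b Hq).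
  transitivity (- ((s * s) * q ^ (a - b) / s)); [field; assumption|].
  rewrite sign_sq by assumption. field. auto.
Qed.

Lemma sign_1 : is_sign 1.
Proof. now left. Qed.

Lemma sign_m1 : is_sign (-1).
Proof. now right. Qed.

Ltac dissect q s a b m :=
  let H := fresh "D" in
  assert (H := pe_dissect s q a b m ltac:(assumption) ltac:(first [apply sign_1|apply sign_m1])
    ltac:(lia) ltac:(lia));
  cbn [cprod Nat.add Nat.mul] in H; rewrite ?Cmult_1_l in H.

Lemma eq_by_factor (c x y : C) : c <> 0 -> x * c = y * c -> x = y.
Proof.
  intros Hc H. transitivity (x * c / c); [field; assumption|]. rewrite H; field; assumption.
Qed.

(** Euler's identity (-x; x)_oo (x; x^2)_oo = 1 is used at x = Q^2 and x = Q^6 ([I1], [I3]); the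
    dissection of (-Q^2; Q^2)_oo modulo 3 supplies the theta function on the right, and the 2 is the
    first factor of (-1; Q^2)_oo. *)
Lemma even_theta_product (Q : C) : base Q ->
  theta Q Q * (theta (Q ^ 2) (-1) * theta (Q ^ 6) (-1)) = 2 * pe 1 Q 2 1 ^ 2 * theta (Q ^ 3) Q.
Proof.
  intros Hb.
  assert (T1 := theta_pe 1 Q 1 1 Hb sign_1 ltac:(lia) ltac:(lia)).
  assert (T2 := theta_pe (-1) Q 2 0 Hb sign_m1 ltac:(lia) ltac:(lia)).
  assert (T3 := theta_pe (-1) Q 6 0 Hb sign_m1 ltac:(lia) ltac:(lia)).
  assert (T4 := theta_pe 1 Q 3 1 Hb sign_1 ltac:(lia) ltac:(lia)).
  cbn [Nat.add Nat.sub Nat.mul] in T1, T2, T3, T4.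
  replace (1 * Q ^ 1) with Q in T1, T4 by (simpl; ring). replace (Q ^ 1) with Q in T1 by (simpl; ring).
  replace (-1 * Q ^ 0) with (-1 : C) in T2, T3 by (simpl; ring).
  replace (- -1 : C) with (1 : C) in T2, T3 by ring. replace (- (1) : C) with (-1 : C) in T1, T4 by ring.
  rewrite T1, T2, T3, T4. clear T1 T2 T3 T4.
  assert (B0 : pe (-1) Q 0 1 = 2 * pe (-1) Q 2 1).
  { unfold pe. rewrite (qpoch_inf_split Q _ 1); [|assumption|apply Cmult_neq_0; [apply Cm1_neq0|apply C1_nz]].
    simpl (qpoch _ _ 1). replace (-1 * Q ^ 0 * (Q ^ 2) ^ 1) with (-1 * Q ^ 2) by (simpl; ring).
    simpl (2 * 1)%nat. simpl (Q ^ 0). ring. }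
  dissect Q (1 : C) 2%nat 1%nat 2%nat. dissect Q (1 : C) 6%nat 3%nat 2%nat.
  dissect Q (-1 : C) 2%nat 1%nat 3%nat.
  assert (O1 := pe_opp Q 2 1 Hb ltac:(lia)). assert (O3 := pe_opp Q 6 3 Hb ltac:(lia)).
  cbn [Nat.mul Nat.add] in O1, O3.
  assert (N1 := pe_neq0 1 Q 12 6 Hb sign_1 ltac:(lia) ltac:(lia)).
  assert (N2 := pe_neq0 (-1) Q 6 3 Hb sign_m1 ltac:(lia) ltac:(lia)).
  assert (N3 := pe_neq0 1 Q 6 3 Hb sign_1 ltac:(lia) ltac:(lia)).
  assert (N4 := pe_neq0 1 Q 4 2 Hb sign_1 ltac:(lia) ltac:(lia)).
  assert (I1 : pe (-1) Q 2 1 * pe 1 Q 2 2 = 1).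
  { apply (eq_by_factor (pe 1 Q 4 2)); [assumption|]. rewrite <- O1 at 2. rewrite D. ring. }
  assert (I3 : pe (-1) Q 6 3 * pe 1 Q 6 6 = 1).
  { apply (eq_by_factor (pe 1 Q 12 6)); [assumption|]. rewrite <- O3 at 2. rewrite D0. ring. }
  apply (eq_by_factor (pe (-1) Q 6 3)); [assumption|].
  rewrite B0.
  transitivity (2 * (pe (-1) Q 2 1 * pe 1 Q 2 2) ^ 2 * pe 1 Q 2 1 * pe 1 Q 4 2 *
    (pe 1 Q 6 6 * pe 1 Q 12 6) * (pe (-1) Q 6 3 * pe 1 Q 6 6)); [ring|].
  rewrite I1, I3, <- D0, <- O1.
  transitivity (2 * pe 1 Q 2 1 ^ 2 * (pe (-1) Q 2 3 * pe (-1) Q 4 3 * pe (-1) Q 6 3) * pe 1 Q 6 3).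
  - rewrite <- D1. ring.
  - ring.
Qed.

(** Here (-Q; Q^2)_oo is dissected modulo 3; its middle class (-Q^3; Q^6)_oo cancels and the outer
    ones form the theta function on the right. *)
Lemma odd_theta_product (Q : C) : base Q ->
  theta Q 1 * (theta (Q ^ 2) (- Q) * theta (Q ^ 6) (- Q ^ 3)) = pe 1 Q 2 1 ^ 2 * theta (Q ^ 3) (Q ^ 2).
Proof.
  intros Hb.
  assert (T1 := theta_pe 1 Q 1 0 Hb sign_1 ltac:(lia) ltac:(lia)).
  assert (T2 := theta_pe (-1) Q 2 1 Hb sign_m1 ltac:(lia) ltac:(lia)).
  assert (T3 := theta_pe (-1) Q 6 3 Hb sign_m1 ltac:(lia) ltac:(lia)).
  assert (T4 := theta_pe 1 Q 3 2 Hb sign_1 ltac:(lia) ltac:(lia)).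
  cbn [Nat.add Nat.sub Nat.mul] in T1, T2, T3, T4.
  replace (1 * Q ^ 0) with (1 : C) in T1 by (simpl; ring). replace (Q ^ 1) with Q in T1 by (simpl; ring).
  replace (-1 * Q ^ 1) with (- Q) in T2 by (simpl; ring). replace (-1 * Q ^ 3) with (- Q ^ 3) in T3 by ring.
  rewrite Cmult_1_l in T4.
  replace (- -1 : C) with (1 : C) in T2, T3 by ring. replace (- (1) : C) with (-1 : C) in T1, T4 by ring.
  rewrite T1, T2, T3, T4. clear T1 T2 T3 T4.
  dissect Q (1 : C) 1%nat 1%nat 2%nat. dissect Q (1 : C) 3%nat 3%nat 2%nat.
  dissect Q (-1 : C) 1%nat 1%nat 3%nat.
  dissect Q (1 : C) 2%nat 1%nat 2%nat. dissect Q (1 : C) 6%nat 3%nat 2%nat.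
  assert (O1 := pe_opp Q 1 1 Hb ltac:(lia)). assert (O3 := pe_opp Q 3 3 Hb ltac:(lia)).
  cbn [Nat.mul Nat.add] in O1, O3.
  assert (N2 := pe_neq0 (-1) Q 3 3 Hb sign_m1 ltac:(lia) ltac:(lia)).
  apply (eq_by_factor (pe (-1) Q 3 3)); [assumption|].
  transitivity (pe (-1) Q 1 1 * pe 1 Q 2 1 * ((pe 1 Q 1 2 * pe 1 Q 3 2) * pe (-1) Q 1 1 * pe 1 Q 4 2) *
    ((pe 1 Q 3 6 * pe 1 Q 9 6) * pe (-1) Q 3 3 * pe 1 Q 12 6)); [ring|].
  rewrite <- D, <- D0, O1, O3, <- D2, <- D3, D1. ring.
Qed.

(** The even part common to theta q 1 and theta q (-1) multiplies the difference in [theta_diff],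
    the odd part the sum in [theta_sum], both at p = q^2. Up to the factor 4 q (Q^2; Q^2)_oo^2 the
    results are the odd and the even part of theta (q^3) (q^2), respectively. *)
Lemma triple_sum_product (q : C) : base q ->
  usum (triple_term q) = pe (-1) q 4 2 / pe 1 q 4 2 * theta (q ^ 3) (q ^ 2).
Proof.
  intros Hb. assert (Hq := proj1 Hb). assert (Hb2 := base_sq q Hb). assert (HbQ := base_Q4 q Hb).
  assert (H0 := triple_sum_theta q Hb).
  assert (EQ : Q4 q = q ^ 4) by (rewrite <- Cpow_mult_r; reflexivity).
  rewrite EQ in *.
  assert (E0 : qpoch_inf (q ^ 4) (q ^ 4) = pe 1 q 4 2) by (unfold pe; now rewrite Cmult_1_l).
  assert (E1 : qpoch_inf (- q ^ 4) (q ^ 4) = pe (-1) q 4 2).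
  { unfold pe. f_equal; ring. }
  rewrite E0, E1 in H0. clear E0 E1.
  assert (TD := theta_diff (q ^ 2) Hb2). assert (TS := theta_sum (q ^ 2) Hb2).
  rewrite <- (Cpow_mult_r q 2 2), <- (Cpow_mult_r q 2 3), <- (Cpow_mult_r q 2 4), <- (Cpow_mult_r q 2 6),
    <- (Cpow_mult_r q 2 12) in TD.
  rewrite <- (Cpow_mult_r q 2 3), <- (Cpow_mult_r q 2 4), <- (Cpow_mult_r q 2 12) in TS.
  rewrite <- (Cpow_mult_r q 2 3) in H0.
  cbn [Nat.mul Nat.add] in TD, TS, H0.
  set (Q := q ^ 4) in *.
  assert (PE := even_theta_product Q HbQ). assert (PO := odd_theta_product Q HbQ).
  assert (F : forall n, q ^ (4 * n) = Q ^ n) by (intros; unfold Q; now rewrite Cpow_mult_r).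
  assert (F2 := F 2%nat). assert (F3 := F 3%nat). assert (F6 := F 6%nat).
  cbn [Nat.mul Nat.add] in F2, F3, F6.
  rewrite F2, F6, ?F3 in TS. rewrite F2, F6, ?F3 in TD.
  assert (Em : - Q = - q ^ 4) by reflexivity.
  assert (S1 := theta_split q 1 Hb C1_nz). assert (S2 := theta_split q (-1) Hb Cm1_neq0).
  replace (1 * 1 : C) with (1 : C) in S1 by ring. replace (-1 * -1 : C) with (1 : C) in S2 by ring.
  fold Q in S1, S2. rewrite (Cmult_1_r Q) in S1, S2.
  assert (S3 := theta_split (q ^ 3) (q ^ 2) (base_pow q 2 Hb) (Cpow_nz _ _ Hq)).
  replace ((q ^ 3) ^ 4) with (Q ^ 3) in S3 by (unfold Q; rewrite <- !Cpow_mult_r; reflexivity).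
  replace (q ^ 2 * q ^ 2) with Q in S3 by (unfold Q; rewrite <- Cpow_add_r; reflexivity).
  assert (S4 : theta (Q ^ 3) (Q ^ 2) = Q * theta (Q ^ 3) (Q ^ 3 * Q)).
  { assert (HQ0 := proj1 HbQ). assert (HQi : / Q ^ 2 <> 0).
    { rewrite <- (zp_nat Q 2), <- zp_opp by assumption; now apply zp_neq0. }
    rewrite <- theta_inv by (try apply (base_pow Q 2 HbQ); now apply Cpow_nz).
    rewrite (theta_shift (Q ^ 3) (/ Q ^ 2)) by (try apply (base_pow Q 2 HbQ); assumption).
    replace ((Q ^ 3) ^ 2 * / Q ^ 2) with (Q ^ 3 * Q) by (simpl; field; assumption).
    f_equal. simpl; field; assumption. }
  assert (N0 := pe_neq0 1 q 4 2 Hb sign_1 ltac:(lia) ltac:(lia)).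
  assert (N1 := pe_neq0 (-1) q 4 2 Hb sign_m1 ltac:(lia) ltac:(lia)).
  assert (O1 := pe_opp q 4 2 Hb ltac:(lia)). cbn [Nat.mul Nat.add] in O1.
  assert (O2 : pe 1 q 8 4 = pe 1 Q 2 1).
  { unfold pe. cbn [Nat.mul Nat.add]. now rewrite F2. }
  rewrite O2 in O1.
  set (e0 := pe 1 q 4 2) in *. set (e1 := pe (-1) q 4 2) in *. set (e2 := pe 1 Q 2 1) in *.
  set (T := usum (triple_term q)) in *.
  assert (R : theta q 1 * theta (q ^ 2) 1 * theta (q ^ 6) (-1) - theta q (-1) * theta (q ^ 2) (-1) * theta (q ^ 6) 1
    = 4 * q * e2 ^ 2 * theta (q ^ 3) (q ^ 2)).
  { rewrite S1, S2, S3.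
    transitivity (theta Q 1 * (theta (q ^ 2) 1 * theta (q ^ 6) (-1) - theta (q ^ 2) (-1) * theta (q ^ 6) 1) +
      q * theta Q Q * (theta (q ^ 2) 1 * theta (q ^ 6) (-1) + theta (q ^ 2) (-1) * theta (q ^ 6) 1)); [ring|].
    rewrite TD, TS.
    transitivity (4 * q ^ 2 * (theta Q 1 * (theta (Q ^ 2) (- Q) * theta (Q ^ 6) (- Q ^ 3))) +
      2 * q * (theta Q Q * (theta (Q ^ 2) (-1) * theta (Q ^ 6) (-1)))); [ring|].
    rewrite PE, PO, S4. fold e2.
    replace (q ^ 3 * q ^ 2 * theta (Q ^ 3) (Q ^ 3 * Q)) with (q * Q * theta (Q ^ 3) (Q ^ 3 * Q)) by (unfold Q; ring).
    ring. }
  rewrite R, <- O1 in H0.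
  apply (eq_by_factor (4 * q * e0 ^ 3 * e1)).
  { repeat apply Cmult_neq_0; auto using Cpow_nz, C1_nz. intros E; apply RtoC_inj in E; lra. }
  transitivity (4 * q * e0 ^ 3 * e1 * T); [ring|]. rewrite H0. field. assumption.
Qed.

Lemma triple_sum_product24 (q : C) : base q ->
  let p a := pe 1 q a 12 in
  usum (triple_term q) *
    (p 1%nat * p 5%nat * p 7%nat * p 11%nat * p 13%nat * p 17%nat * p 19%nat * p 23%nat
     * (p 4%nat * p 20%nat) ^ 2 * (p 8%nat * p 12%nat * p 16%nat))
  = p 2%nat * p 6%nat * p 10%nat * p 14%nat * p 18%nat * p 22%nat.
Proof.
  intros Hb p. assert (Hq := proj1 Hb). rewrite triple_sum_product by assumption.
  assert (T := theta_pe 1 q 3 2 Hb sign_1 ltac:(lia) ltac:(lia)).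
  cbn [Nat.add Nat.sub Nat.mul] in T. rewrite Cmult_1_l in T.
  replace (- (1) : C) with (-1 : C) in T by ring. rewrite T.
  assert (O1 := pe_opp q 1 3 Hb ltac:(lia)). assert (O5 := pe_opp q 5 3 Hb ltac:(lia)).
  assert (O4 := pe_opp q 4 2 Hb ltac:(lia)).
  cbn [Nat.mul Nat.add] in O1, O5, O4.
  dissect q (1 : C) 1%nat 3%nat 4%nat. dissect q (1 : C) 5%nat 3%nat 4%nat.
  dissect q (1 : C) 2%nat 6%nat 2%nat. dissect q (1 : C) 10%nat 6%nat 2%nat.
  dissect q (1 : C) 6%nat 3%nat 4%nat. dissect q (1 : C) 4%nat 2%nat 6%nat.
  dissect q (1 : C) 8%nat 4%nat 3%nat.
  assert (N1 := pe_neq0 1 q 1 3 Hb sign_1 ltac:(lia) ltac:(lia)).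
  assert (N5 := pe_neq0 1 q 5 3 Hb sign_1 ltac:(lia) ltac:(lia)).
  assert (N4 := pe_neq0 1 q 4 2 Hb sign_1 ltac:(lia) ltac:(lia)).
  fold (p 1%nat) (p 7%nat) (p 13%nat) (p 19%nat) (p 5%nat) (p 11%nat) (p 17%nat) (p 23%nat)
    (p 2%nat) (p 14%nat) (p 10%nat) (p 22%nat) (p 6%nat) (p 12%nat) (p 18%nat) (p 24%nat)
    (p 4%nat) (p 8%nat) (p 16%nat) (p 20%nat) in *.
  set (m1 := pe (-1) q 1 3) in *. set (m5 := pe (-1) q 5 3) in *. set (m4 := pe (-1) q 4 2) in *.
  set (f1 := pe 1 q 1 3) in *. set (f5 := pe 1 q 5 3) in *. set (f4 := pe 1 q 4 2) in *.
  set (g2 := pe 1 q 2 6) in *. set (g10 := pe 1 q 10 6) in *. set (g6 := pe 1 q 6 3) in *.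
  set (g8 := pe 1 q 8 4) in *.
  assert (N24 : p 24%nat <> 0) by (unfold p; apply pe_neq0; auto using sign_1; lia).
  assert (N12 : p 12%nat <> 0) by (unfold p; apply pe_neq0; auto using sign_1; lia).
  assert (N8 : p 8%nat <> 0) by (unfold p; apply pe_neq0; auto using sign_1; lia).
  assert (N16 : p 16%nat <> 0) by (unfold p; apply pe_neq0; auto using sign_1; lia).
  (* Multiplying and dividing by [f1], [f5] and [f4] lets (x)_oo (-x)_oo = (x^2)_oo remove the minus
     signs; dissection then reaches modulus 24. *)
  transitivity ((f4 * m4) * (f1 * m1) * (f5 * m5) * g6 / (f1 * f5 * f4 ^ 2) *
    ((p 1%nat * p 7%nat * p 13%nat * p 19%nat) * (p 5%nat * p 11%nat * p 17%nat * p 23%nat) *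
     (p 4%nat * p 8%nat * p 12%nat * p 16%nat * p 20%nat * p 24%nat) ^ 2
     / (p 8%nat * p 12%nat * p 16%nat * p 24%nat ^ 2))).
  { field. repeat split; auto. }
  rewrite <- D, <- D0, <- D4, O1, O5, O4, D1, D2, D3, D5. field. repeat split; auto.
Qed.

(** * Power series on the unit disc *)

Definition ev (a : nat -> C) (q : C) : C := usum (fun n => a n * q ^ n).
Definition dps (a : nat -> C) : Prop :=
  forall q : C, (Cmod q < 1)%R -> summable (fun n => a n * q ^ n).
Definition conv (a b : nat -> C) (n : nat) : C := lsum (fun k => a k * b (n - k)%nat) (seq 0 (S n)).

Lemma usum_finite (f : nat -> C) n : (forall k, (n < k)%nat -> f k = 0) ->
  usum f = lsum f (seq 0 (S n)).
Proof.
  intros H. apply usum_eq. intros eps; exists (seq 0 (S n)); intros G NG IG.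
  destruct (incl_split _ G (seq_NoDup _ _) NG IG) as [K [HP HN]].
  change (Cmod (lsum f G - lsum f (seq 0 (S n))) < eps)%R.
  rewrite (lsum_perm _ _ _ HP), lsum_app, (lsum_zero f K).
  - match goal with |- (Cmod ?x < _)%R => replace x with (0 : C) by ring end.
    rewrite Cmod_0; apply eps.
  - intros x Hx. apply H. destruct (Nat.lt_ge_cases n x) as [|Hle]; [assumption|].
    exfalso. assert (Hs : In x (seq 0 (S n))) by (apply in_seq; lia).
    clear - HN Hx Hs. induction (seq 0 (S n)) as [|y l IH]; [destruct Hs|].
    inversion HN; subst. destruct Hs as [<-|Hs]; [|auto].
    apply H1, in_or_app; now right.
Qed.

Definition cauchy_family (a b : nat -> C) (q : C) (x : nat * nat) : C :=
  if Nat.leb (snd x) (fst x) then a (snd x) * q ^ snd x * (b (fst x - snd x)%nat * q ^ (fst x - snd x)) else 0.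

(** Pairs (k, l) are reindexed as (k + l, k): summed by degree they give the convolution, summed as
    pairs the product. *)
Lemma cauchy_product (a b : nat -> C) q : dps a -> dps b -> (Cmod q < 1)%R ->
  summable (fun n => conv a b n * q ^ n) /\ ev (conv a b) q = ev a q * ev b q.
Proof.
  intros Ha Hb Hq. specialize (Ha q Hq). specialize (Hb q Hq).
  set (g := fun x : nat * nat => ((fst x + snd x)%nat, fst x)).
  assert (Hg : forall x y, g x = g y -> x = y).
  { intros [i j] [i' j'] H. unfold g in H; cbn [fst snd] in H. injection H as H1 H2. f_equal; lia. }
  assert (H0 : forall y, (forall x, g x <> y) -> cauchy_family a b q y = 0).
  { intros [n k] Hy. unfold cauchy_family; cbn [fst snd]. destruct (Nat.leb_spec k n); [|reflexivity].
    exfalso; apply (Hy (k, (n - k)%nat)). unfold g; cbn [fst snd]. f_equal; lia. }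
  assert (Hc : forall x, cauchy_family a b q (g x) = a (fst x) * q ^ fst x * (b (snd x) * q ^ snd x)).
  { intros [i j]. unfold cauchy_family, g; cbn [fst snd].
    destruct (Nat.leb_spec i (i + j)); [|lia]. now replace (i + j - i)%nat with j by lia. }
  assert (S1 := summable_mult _ _ Ha Hb).
  assert (S2 : summable (fun x => cauchy_family a b q (g x))).
  { apply (summable_ext _ _ (fun x => eq_sym (Hc x))), S1. }
  assert (S3 := summable_reindex g _ Hg H0 S2).
  assert (Ein : forall n, usum (fun k => cauchy_family a b q (n, k)) = conv a b n * q ^ n).
  { intros n. rewrite (usum_finite _ n).
    - unfold conv. rewrite Cmult_comm, <- lsum_scal. apply lsum_ext. intros k Hk. apply in_seq in Hk.
      unfold cauchy_family; cbn [fst snd]. destruct (Nat.leb_spec k n); [|lia].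
      replace n with (k + (n - k))%nat at 3 by lia. rewrite Cpow_add_r. ring.
    - intros k Hk. unfold cauchy_family; cbn [fst snd]. destruct (Nat.leb_spec k n); [lia|reflexivity]. }
  split.
  - apply (summable_ext _ _ Ein). exact (summable_fst _ S3).
  - unfold ev. rewrite <- (usum_ext _ _ Ein), <- (usum_fst (cauchy_family a b q)) by assumption.
    rewrite (usum_reindex g _ Hg H0 S3), (usum_ext _ _ Hc). exact (usum_mult _ _ Ha Hb).
Qed.

Lemma dps_conv a b : dps a -> dps b -> dps (conv a b).
Proof. intros Ha Hb q Hq. now apply cauchy_product. Qed.

Lemma ev_conv a b q : dps a -> dps b -> (Cmod q < 1)%R -> ev (conv a b) q = ev a q * ev b q.
Proof. intros. now apply cauchy_product. Qed.

Lemma dps_minus a b : dps a -> dps b -> dps (fun n => a n - b n).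
Proof.
  intros Ha Hb q Hq. apply (summable_ext (fun n => a n * q ^ n - b n * q ^ n)); [intros; ring|].
  apply summable_minus; auto.
Qed.

Lemma half_pow_lt1 j : (Cmod ((/ 2) ^ S j) < 1)%R.
Proof.
  apply Cmod_pow_lt1. rewrite Cmod_inv by apply C2_neq0. rewrite Cmod_R, Rabs_pos_eq; lra.
Qed.

(** Once the lower coefficients vanish, division by q^n leaves a series with constant term a n that
    is zero at every q = 2^(-j-1); letting j -> oo isolates a n. *)
Lemma ev_zero_coef (a : nat -> C) : dps a -> (forall q, (Cmod q < 1)%R -> ev a q = 0) ->
  forall n, a n = 0.
Proof.
  intros Ha H n. induction n as [n IH] using (well_founded_induction Wf_nat.lt_wf).
  assert (Hh : / 2 <> (0 : C)).
  { intros E. apply C1_nz. rewrite <- (Cinv_r 2 C2_neq0), E; ring. }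
  assert (Hh1 : (Cmod (/ 2) < 1)%R) by (generalize (half_pow_lt1 0); simpl; now rewrite Cmult_1_r).
  assert (Hs : forall q, (Cmod q < 1)%R -> q <> 0 ->
    summable (fun k => a (n + k)%nat * q ^ k) /\ usum (fun k => a (n + k)%nat * q ^ k) = 0).
  { intros q Hq Hq0. assert (S := Ha q Hq).
    assert (Hinj : forall x y, (n + x = n + y)%nat -> x = y) by (intros; lia).
    assert (S' := summable_comp (fun k => n + k)%nat _ Hinj S).
    assert (Hqn := Cpow_nz q n Hq0).
    assert (S'' : summable (fun k => a (n + k)%nat * q ^ k)).
    { apply (summable_ext (fun k => / q ^ n * (a (n + k)%nat * q ^ (n + k)))).
      - intros k; rewrite Cpow_add_r; field; assumption.
      - now apply summable_scal. }
    split; [assumption|].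
    assert (E : ev a q = q ^ n * usum (fun k => a (n + k)%nat * q ^ k)).
    { unfold ev. rewrite (usum_reindex (fun k => n + k)%nat _ Hinj); [| |assumption].
      - rewrite <- usum_scal by assumption. apply usum_ext; intros k. rewrite Cpow_add_r; ring.
      - intros y Hy. rewrite IH; [ring|]. destruct (Nat.lt_ge_cases y n); [assumption|].
        exfalso; apply (Hy (y - n)%nat); lia. }
    rewrite H in E by assumption. set (u := usum _) in *.
    transitivity (q ^ n * u / q ^ n); [field; assumption|]. rewrite <- E; field; assumption. }
  destruct (Hs (/ 2) Hh1 Hh) as [S0 _]. destruct S0 as [M HM].
  apply (clim_unique (fun j => usum (fun k => a (n + k)%nat * ((/ 2) ^ S j) ^ k))).
  - replace (a n) with (usum (fun k : nat => if Nat.eqb k 0 then a n else RtoC 0)).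
    2: { rewrite (usum_single _ 0%nat); [reflexivity|]. intros k Hk.
         destruct (Nat.eqb_spec k 0); [contradiction|reflexivity]. }
    apply (usum_dominated _ _ (fun k => Cmod (a (n + k)%nat * (/ 2) ^ k)) M); [|exact HM|].
    + intros j k. rewrite !Cmod_mult. apply Rmult_le_compat_l; [apply Cmod_ge_0|].
      rewrite !Cmod_pow. apply pow_incr. split; [apply pow_le, Cmod_ge_0|].
      simpl. assert (Cmod (/ 2) ^ j <= 1)%R by (rewrite <- (pow1 j); apply pow_incr; generalize (Cmod_ge_0 (/ 2)); lra).
      generalize (Cmod_ge_0 (/ 2)); nra.
    + intros k. destruct (Nat.eqb_spec k 0) as [->|Hk].
      * apply (clim_ext (fun _ => a n)); [|apply clim_const]. intros j. rewrite Nat.add_0_r. simpl; ring.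
      * apply (clim_ext (fun j => (a (n + k)%nat * (/ 2) ^ k) * ((/ 2) ^ k) ^ j)).
        -- intros j. rewrite <- !Cpow_mult_r, <- Cmult_assoc, <- Cpow_add_r. f_equal; f_equal; lia.
        -- apply clim_scal_0, clim_pow_0. destruct k as [|k]; [lia|]. apply half_pow_lt1.
  - apply (clim_ext (fun _ => 0)); [|apply clim_const]. intros j. symmetry.
    apply (Hs ((/ 2) ^ S j)); [apply half_pow_lt1|now apply Cpow_nz].
Qed.

Lemma ev_inj (a b : nat -> C) : dps a -> dps b -> (forall q, (Cmod q < 1)%R -> ev a q = ev b q) ->
  forall n, a n = b n.
Proof.
  intros Ha Hb H n.
  assert (E : a n - b n = 0).
  { apply (ev_zero_coef (fun n => a n - b n)); [now apply dps_minus|].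
    intros q Hq. unfold ev. rewrite (usum_ext _ (fun n => a n * q ^ n - b n * q ^ n)) by (intros; ring).
    rewrite usum_minus by auto. fold (ev a q) (ev b q). rewrite H by assumption; ring. }
  transitivity (a n - b n + b n); [ring|]. rewrite E; ring.
Qed.

(** With constant term 1, the coefficient of degree n + 1 of the square is 2 a(n+1) plus terms in
    lower coefficients. *)
Lemma conv_sq_inj (a b : nat -> C) : a O = 1 -> b O = 1 -> (forall n, conv a a n = conv b b n) ->
  forall n, a n = b n.
Proof.
  intros Ha Hb H n. induction n as [n IH] using (well_founded_induction Wf_nat.lt_wf).
  destruct n as [|n]; [congruence|].
  specialize (H (S n)). unfold conv in H.
  assert (Hd : forall c : nat -> C, lsum (fun k => c k * c (S n - k)%nat) (seq 0 (S (S n))) =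
    c O * c (S n) + lsum (fun k => c k * c (S n - k)%nat) (seq 1 n) + c (S n) * c O).
  { intros c. rewrite seq_S, lsum_app. change (seq 0 (S n)) with (0%nat :: seq 1 n).
    unfold lsum at 1 2; simpl. rewrite Nat.sub_diag. unfold lsum. ring. }
  rewrite !Hd, Ha, Hb in H.
  rewrite (lsum_ext (fun k => a k * a (S n - k)%nat) (fun k => b k * b (S n - k)%nat)) in H.
  - set (L := lsum _ _) in H.
    transitivity ((1 * a (S n) + L + a (S n) * 1 - L) / 2); [field|]. rewrite H. field.
  - intros k Hk. apply in_seq in Hk. rewrite !IH by lia. reflexivity.
Qed.

(** * Agreement with [is_pseries] and uniqueness of half powers *)

Lemma sum_n_lsum (f : nat -> C) n : sum_n f n = lsum f (seq 0 (S n)).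
Proof.
  induction n as [|n IH].
  - rewrite sum_O. unfold lsum; simpl. ring.
  - rewrite sum_Sn, IH, (seq_S (S n)), lsum_app. unfold lsum at 3; simpl.
    change (plus (lsum f (seq 0 (S n))) (f (S n)) = lsum f (seq 0 (S n)) + (f (S n) + 0)).
    rewrite Cplus_0_r. reflexivity.
Qed.

Lemma pow_n_Cpow (q : C) n : pow_n q n = q ^ n.
Proof. induction n as [|n IH]; [reflexivity|]. simpl. now rewrite IH. Qed.

Lemma pseries_clim (a : nat -> C) (q l : C) :
  is_pseries a q l <-> clim (fun n => lsum (fun k => a k * q ^ k) (seq 0 (S n))) l.
Proof.
  assert (E : forall n, sum_n (fun k => scal (pow_n q k) (a k)) n = lsum (fun k => a k * q ^ k) (seq 0 (S n))).
  { intros n. rewrite sum_n_lsum. apply lsum_ext; intros k _. rewrite pow_n_Cpow. apply Cmult_comm. }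
  unfold is_pseries, is_series. split.
  - intros H e He.
    assert (Hs : (0 < sqrt 2)%R) by (apply sqrt_lt_R0; lra).
    assert (He' : (0 < e / sqrt 2)%R) by now apply Rdiv_lt_0_compat.
    destruct (H (fun y => ball l (mkposreal _ He') y)) as [N HN]; [now exists (mkposreal _ He')|].
    exists N; intros n Hn. specialize (HN n Hn). rewrite E in HN.
    apply C_NormedModule_mixin_compat2 in HN. simpl in HN.
    replace (sqrt 2 * (e / sqrt 2))%R with e in HN by (field; lra). exact HN.
  - intros H P [eps HP]. destruct (H eps (cond_pos eps)) as [N HN]. exists N; intros n Hn.
    apply HP. rewrite E. apply C_NormedModule_mixin_compat1. now apply HN.
Qed.

Lemma is_sum_clim (f : nat -> C) s : is_sum f s -> clim (fun n => lsum f (seq 0 (S n))) s.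
Proof.
  intros H e He. destruct (H (mkposreal e He)) as [F HF]. exists (list_max F). intros n Hn.
  apply HF; [apply seq_NoDup|]. intros x Hx. apply in_seq.
  assert (HL := proj1 (list_max_le F (list_max F)) (le_n _)). rewrite Forall_forall in HL.
  specialize (HL x Hx). lia.
Qed.

Lemma dps_is_pseries (a : nat -> C) q : dps a -> (Cmod q < 1)%R -> is_pseries a q (ev a q).
Proof. intros Ha Hq. apply pseries_clim, is_sum_clim, summable_is_sum; auto. Qed.

(** With r halfway between |q| and 1, boundedness of a n r^n gives a geometric majorant of ratio
    |q|/r. *)
Lemma dps_bound (a : nat -> C) : (forall r : R, (0 < r < 1)%R -> exists M, forall n, (Cmod (a n) * r ^ n <= M)%R) ->
  dps a.
Proof.
  intros H q Hq. assert (H0 := Cmod_ge_0 q).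
  set (r := ((1 + Cmod q) / 2)%R). assert (Hr : (Cmod q < r < 1)%R) by (unfold r; lra).
  destruct (H r) as [M HM]; [lra|].
  assert (HM0 : (0 <= M)%R).
  { eapply Rle_trans; [|apply (HM 0%nat)]. simpl. rewrite Rmult_1_r; apply Cmod_ge_0. }
  apply (summable_le _ (fun n => M * (q / r) ^ n)).
  - intros n. rewrite !Cmod_mult, !Cmod_pow, Cmod_div, !Cmod_R, !Rabs_pos_eq by (try lra; intros E; apply RtoC_inj in E; lra).
    unfold Rdiv. rewrite Rpow_mult_distr, pow_inv.
    assert (Hrn : (0 < r ^ n)%R) by (apply pow_lt; lra).
    apply Rle_trans with ((Cmod (a n) * r ^ n) * (Cmod q ^ n * / r ^ n))%R; [right; field; lra|].
    apply Rmult_le_compat_r; [|apply HM].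
    apply Rmult_le_pos; [now apply pow_le|left; now apply Rinv_0_lt_compat].
  - apply summable_scal, summable_geom.
    rewrite Cmod_div, Cmod_R, Rabs_pos_eq by (try lra; intros E; apply RtoC_inj in E; lra).
    apply Rmult_lt_reg_r with r; [lra|]. unfold Rdiv. rewrite Rmult_assoc, Rinv_l; lra.
Qed.

Lemma clim_bounded u l : clim u l -> exists M, forall n, (Cmod (u n) <= M)%R.
Proof.
  intros H. destruct (H 1%R) as [N HN]; [lra|].
  assert (HB : forall N, exists M, forall n, (n < N)%nat -> (Cmod (u n) <= M)%R).
  { clear. induction N as [|N [M HM]]; [exists 0%R; intros; lia|].
    exists (Rmax M (Cmod (u N))). intros n Hn. destruct (Nat.eq_dec n N) as [->|Hne]; [apply Rmax_r|].
    eapply Rle_trans; [apply HM; lia|apply Rmax_l]. }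
  destruct (HB N) as [M HM]. exists (Rmax M (Cmod l + 1)). intros n.
  destruct (Nat.lt_ge_cases n N) as [Hn|Hn].
  - eapply Rle_trans; [now apply HM|apply Rmax_l].
  - eapply Rle_trans; [|apply Rmax_r]. specialize (HN n Hn).
    replace (u n) with ((u n - l) + l) by ring. eapply Rle_trans; [apply Cmod_triangle|]; lra.
Qed.

(** Convergence at a radius r < 1 makes a n r^n a difference of bounded partial sums; letting r
    vary, convergence in the disc is absolute. *)
Lemma pseries_dps (a : nat -> C) (g : C -> C) : (forall q, (Cmod q < 1)%R -> is_pseries a q (g q)) ->
  dps a /\ forall q, (Cmod q < 1)%R -> g q = ev a q.
Proof.
  intros H. assert (Ha : dps a).
  { apply dps_bound. intros r Hr.
    assert (Hr1 : (Cmod r < 1)%R) by (rewrite Cmod_R, Rabs_pos_eq; lra).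
    assert (HL := proj1 (pseries_clim a r (g r)) (H r Hr1)).
    destruct (clim_bounded _ _ HL) as [M HM]. exists (M + M)%R.
    assert (HM0 : (0 <= M)%R) by (eapply Rle_trans; [apply Cmod_ge_0|apply (HM 0%nat)]).
    intros n. replace (Cmod (a n) * r ^ n)%R with (Cmod (a n * r ^ n)).
    2: { rewrite Cmod_mult, Cmod_pow, Cmod_R, Rabs_pos_eq; lra. }
    destruct n as [|n].
    - specialize (HM 0%nat). unfold lsum in HM; simpl in HM. rewrite Cplus_0_r in HM. simpl. lra.
    - assert (E : a (S n) * r ^ S n = lsum (fun k => a k * r ^ k) (seq 0 (S (S n))) - lsum (fun k => a k * r ^ k) (seq 0 (S n))).
      { rewrite (seq_S (S n)), lsum_app.
        match goal with |- _ = _ + lsum ?f (?m :: nil) - _ =>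
          replace (lsum f (m :: nil)) with (f m) by (unfold lsum; simpl; ring) end.
        rewrite Nat.add_0_l. ring. }
      rewrite E. eapply Rle_trans; [apply Cmod_triangle|]. rewrite Cmod_opp.
      apply Rplus_le_compat; apply HM. }
  split; [assumption|]. intros q Hq.
  apply (clim_unique (fun n => lsum (fun k => a k * q ^ k) (seq 0 (S n)))).
  - apply pseries_clim. now apply H.
  - apply pseries_clim. now apply dps_is_pseries.
Qed.

Lemma half_power_unique (f : C -> C) n g g' : is_half_power f n g -> is_half_power f n g' ->
  forall q, (Cmod q < 1)%R -> g q = g' q.
Proof.
  intros [a [Ha0 Ha]] [b [Hb0 Hb]] q Hq.
  destruct (pseries_dps a g) as [Da Ea]; [intros; now apply Ha|].
  destruct (pseries_dps b g') as [Db Eb]; [intros; now apply Hb|].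
  rewrite Ea, Eb by assumption.
  assert (E : forall n, a n = b n).
  { apply conv_sq_inj; auto. apply ev_inj; try now apply dps_conv.
    intros x Hx. rewrite !ev_conv by assumption. rewrite <- Ea, <- Eb, <- !Cpow2 by assumption.
    destruct (Ha x Hx) as [_ ->], (Hb x Hx) as [_ ->]. reflexivity. }
  unfold ev. apply usum_ext; intros k; now rewrite E.
Qed.

Lemma half_power_eq (f : C -> C) n g : is_half_power f n g ->
  forall q, (Cmod q < 1)%R -> half_power f n q = g q.
Proof.
  intros H. apply (half_power_unique f n); [|assumption].
  unfold half_power. apply epsilon_spec. now exists g.
Qed.

(** * Square roots of infinite products *)

(* [a(0) = 1] and [q a'(q) = c(q) a(q)] as power series. *)
Definition log_sol (c a : nat -> C) : Prop :=
  a O = 1 /\ forall n, INR n * a n = conv c a n.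

(** Coefficient n depends on all earlier ones; carrying the table of coefficients up to n keeps the
    recursion structural. *)
Fixpoint sol_table (c : nat -> C) (n : nat) : nat -> C :=
  match n with
  | O => fun _ => 1
  | S m => fun k =>
      if Nat.leb k m then sol_table c m k
      else / INR (S m) * lsum (fun i => c (S i) * sol_table c m (m - i)%nat) (seq 0 (S m))
  end.
Definition sol (c : nat -> C) (n : nat) : C := sol_table c n n.

Lemma sol_table_stable c n k : (k <= n)%nat -> sol_table c n k = sol c k.
Proof.
  induction n as [|n IH]; intros Hk.
  - now replace k with 0%nat by lia.
  - destruct (Nat.eq_dec k (S n)) as [->|Hne]; [reflexivity|].
    cbn [sol_table]. destruct (Nat.leb_spec k n); [auto|lia].
Qed.

Lemma sol_S c m : sol c (S m) = / INR (S m) * lsum (fun i => c (S i) * sol c (m - i)) (seq 0 (S m)).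
Proof.
  unfold sol at 1. cbn [sol_table]. destruct (Nat.leb_spec (S m) m); [lia|]. f_equal.
  apply lsum_ext. intros i Hi. rewrite sol_table_stable by lia. reflexivity.
Qed.

Lemma INR_S_neq0 m : RtoC (INR (S m)) <> 0.
Proof. intros E. apply RtoC_inj in E. generalize (pos_INR m). rewrite S_INR in E. lra. Qed.

Lemma conv_S (c a : nat -> C) m : c O = 0 ->
  conv c a (S m) = lsum (fun i => c (S i) * a (m - i)%nat) (seq 0 (S m)).
Proof.
  intros H. unfold conv. change (seq 0 (S (S m))) with (0%nat :: seq 1 (S m)).
  rewrite <- seq_shift.
  match goal with |- lsum ?f (?x :: ?l) = _ => change (lsum f (x :: l)) with (f x + lsum f l) end.
  rewrite lsum_map, H. cbn [Nat.sub]. rewrite Cmult_0_l, Cplus_0_l. reflexivity.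
Qed.

Lemma log_sol_sol (c : nat -> C) : c O = 0 -> log_sol c (sol c).
Proof.
  intros H. split; [reflexivity|]. intros [|m].
  - unfold conv, lsum; simpl. rewrite H. ring.
  - rewrite (conv_S _ _ _ H), sol_S. field. apply INR_S_neq0.
Qed.

Lemma log_sol_unique (c a b : nat -> C) : c O = 0 -> log_sol c a -> log_sol c b -> forall n, a n = b n.
Proof.
  intros H [Ha0 Ha] [Hb0 Hb] n. induction n as [n IH] using (well_founded_induction Wf_nat.lt_wf).
  destruct n as [|m]; [congruence|].
  assert (E : INR (S m) * a (S m) = INR (S m) * b (S m)).
  { rewrite Ha, Hb, !conv_S by assumption. apply lsum_ext. intros i Hi. rewrite IH by lia. reflexivity. }
  assert (N := INR_S_neq0 m).
  transitivity (INR (S m) * a (S m) / INR (S m)); [field; assumption|]. rewrite E; field; assumption.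
Qed.

Lemma sol_local (c c' : nat -> C) n : (forall k, (k <= n)%nat -> c k = c' k) -> sol c n = sol c' n.
Proof.
  induction n as [n IH] using (well_founded_induction Wf_nat.lt_wf). intros H.
  destruct n as [|m]; [reflexivity|]. rewrite !sol_S. f_equal. apply lsum_ext. intros i Hi.
  apply in_seq in Hi. rewrite H, IH by (try lia; intros; apply H; lia). reflexivity.
Qed.

Lemma conv_assoc a b c : dps a -> dps b -> dps c -> forall n, conv (conv a b) c n = conv a (conv b c) n.
Proof.
  intros. apply ev_inj; try (repeat apply dps_conv; assumption).
  intros q Hq. rewrite !ev_conv by (auto using dps_conv). ring.
Qed.

Lemma conv_comm a b : dps a -> dps b -> forall n, conv a b n = conv b a n.
Proof.
  intros. apply ev_inj; try (repeat apply dps_conv; assumption).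
  intros q Hq. rewrite !ev_conv by assumption. ring.
Qed.

Lemma conv_ext a a' b b' : (forall n, a n = a' n) -> (forall n, b n = b' n) ->
  forall n, conv a b n = conv a' b' n.
Proof. intros Ha Hb n. apply lsum_ext; intros; now rewrite Ha, Hb. Qed.

(** Leibniz rule: n = k + (n - k) distributes the derivation over the product, so logarithmic
    derivatives add. *)
Lemma log_sol_conv c c' a b : dps c -> dps c' -> dps a -> dps b -> log_sol c a -> log_sol c' b ->
  log_sol (fun n => c n + c' n) (conv a b).
Proof.
  intros Dc Dc' Da Db [Ha0 Ha] [Hb0 Hb]. split.
  - unfold conv, lsum; simpl. rewrite Ha0, Hb0; ring.
  - intros n.
    transitivity (conv (conv c a) b n + conv a (conv c' b) n).
    + unfold conv at 1 2 4. rewrite <- lsum_scal, <- lsum_plus. apply lsum_ext. intros k Hk.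
      apply in_seq in Hk. rewrite <- Ha, <- Hb. replace n with (k + (n - k))%nat at 1 by lia.
      rewrite plus_INR, RtoC_plus. ring.
    + rewrite conv_assoc by assumption.
      rewrite (conv_ext a a (conv c' b) (conv b c')) by (auto; intros; now apply conv_comm).
      rewrite <- (conv_assoc a b c') by assumption.
      rewrite (conv_comm (conv a b) c') by (auto using dps_conv).
      unfold conv at 1 3 5. rewrite <- lsum_plus. apply lsum_ext; intros; ring.
Qed.

(** Bernoulli gives k d <= (1 + d)^k for d = (1 - r)/2, and (1 + d)^2 r = 1 - 3 d^2 - 2 d^3 <= 1. *)
Lemma square_geom_bound r : (0 < r < 1)%R -> exists M, forall k, (INR k ^ 2 * r ^ k <= M)%R.
Proof.
  intros Hr. set (d := ((1 - r) / 2)%R). assert (Hd : (0 < d)%R) by (unfold d; lra).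
  exists (/ (d * d))%R. intros k.
  assert (H1 : (INR k * d <= (1 + d) ^ k)%R) by (generalize (poly k d Hd); lra).
  assert (H0 : (0 <= INR k * d)%R) by (apply Rmult_le_pos; [apply pos_INR|lra]).
  assert (Hrk : (0 <= r ^ k)%R) by (apply pow_le; lra).
  assert (H2 : ((INR k * d) * (INR k * d) * r ^ k <= 1)%R).
  { apply Rle_trans with ((1 + d) ^ k * (1 + d) ^ k * r ^ k)%R.
    - apply Rmult_le_compat_r; [assumption|]. apply Rmult_le_compat; assumption.
    - rewrite <- !Rpow_mult_distr. apply Rle_trans with (1 ^ k)%R; [|rewrite pow1; lra]. apply pow_incr.
      split.
      + repeat apply Rmult_le_pos; lra.
      + replace r with (1 - 2 * d)%R by (unfold d; field).
        generalize (pow_lt d 2 Hd) (pow_lt d 3 Hd); clearbody d; intros; lra. }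
  apply Rmult_le_reg_r with (d * d)%R; [nra|]. rewrite Rinv_l by nra.
  replace (INR k ^ 2 * r ^ k * (d * d))%R with ((INR k * d) * (INR k * d) * r ^ k)%R by ring. assumption.
Qed.

(** Crude but uniform: for a product of factors 1 - q^(d i) with i < d i, degree k of the
    logarithmic derivative collects at most k terms of size at most k. *)
Definition quad_bounded (c : nat -> C) : Prop := forall k, (Cmod (c k) <= INR k ^ 2)%R.

Lemma dps_quad c : quad_bounded c -> dps c.
Proof.
  intros H. apply dps_bound. intros r Hr. destruct (square_geom_bound r Hr) as [M HM].
  exists M; intros n. eapply Rle_trans; [|apply HM]. apply Rmult_le_compat_r; [apply pow_le; lra|apply H].
Qed.

(** M does not depend on c, as dominated convergence along partial products requires. With T
    bounding the sums of k^2 r^k, the recursion at degree n costs a factor T/n: the bound grows by 1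
    + T for n <= n0 and no longer once n > n0 > T. *)
Lemma sol_bound r : (0 < r < 1)%R -> exists M, forall c, quad_bounded c ->
  forall n, (Cmod (sol c n) * r ^ n <= M)%R.
Proof.
  intros Hr.
  assert (HS : exists T, forall n, (rsum (fun i => INR (S i) ^ 2 * r ^ S i) (seq 0 n) <= T)%R).
  { assert (D : dps (fun k => RtoC (INR k ^ 2))).
    { apply dps_quad. intros k. rewrite Cmod_R, Rabs_pos_eq; [lra|]. apply pow_le, pos_INR. }
    destruct (D r) as [M HM]; [rewrite Cmod_R, Rabs_pos_eq; lra|].
    exists M; intros n. specialize (HM (map S (seq 0 n))).
    rewrite rsum_map in HM. eapply Rle_trans; [|apply HM].
    - apply rsum_le; intros i _. rewrite Cmod_mult, Cmod_pow, !Cmod_R, !Rabs_pos_eq; try lra.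
      apply pow_le, pos_INR.
    - rewrite seq_shift. apply seq_NoDup. }
  destruct HS as [T HS].
  assert (HS0 : (0 <= T)%R) by (eapply Rle_trans; [|apply (HS 0%nat)]; unfold rsum; simpl; lra).
  destruct (INR_unbounded T) as [n0 Hn0].
  exists ((1 + T) ^ n0)%R. intros c Hc.
  assert (H : forall n, (Cmod (sol c n) * r ^ n <= (1 + T) ^ Nat.min n n0)%R).
  2: { intros n; eapply Rle_trans; [apply H|]. apply Rle_pow; [lra|lia]. }
  intros n. induction n as [n IH] using (well_founded_induction Wf_nat.lt_wf).
  destruct n as [|m].
  - unfold sol; simpl. rewrite Cmod_1; lra.
  - rewrite sol_S, Cmod_mult, Cmod_inv, Cmod_R, Rabs_pos_eq by (apply INR_S_neq0 || apply pos_INR).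
    set (L := lsum _ _). set (B := ((1 + T) ^ Nat.min m n0)%R).
    assert (HB : (0 < B)%R) by (apply pow_lt; lra).
    assert (HL : (Cmod L * r ^ S m <= T * B)%R).
    { apply Rle_trans with (rsum (fun i => (B * (INR (S i) ^ 2 * r ^ S i))%R) (seq 0 (S m))).
      2: { rewrite rsum_scal, Rmult_comm. apply Rmult_le_compat_r; [lra|apply HS]. }
      rewrite Rmult_comm. eapply Rle_trans; [apply Rmult_le_compat_l; [apply pow_le; lra|apply Cmod_lsum]|].
      rewrite <- rsum_scal. apply rsum_le. intros i Hi. apply in_seq in Hi. rewrite Cmod_mult.
      replace (S m) with (S i + (m - i))%nat by lia. rewrite pow_add.
      assert (A1 := Hc (S i)). assert (A2 := IH (m - i)%nat ltac:(lia)).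
      assert (A3 : (Cmod (sol c (m - i)) * r ^ (m - i) <= B)%R).
      { eapply Rle_trans; [exact A2|]. apply Rle_pow; [lra|lia]. }
      replace (r ^ S i * r ^ (m - i) * (Cmod (c (S i)) * Cmod (sol c (m - i))))%R with
        ((Cmod (sol c (m - i)) * r ^ (m - i)) * (Cmod (c (S i)) * r ^ S i))%R by ring.
      apply Rmult_le_compat; try (apply Rmult_le_pos; [apply Cmod_ge_0|apply pow_le; lra]); [exact A3|].
      apply Rmult_le_compat_r; [apply pow_le; lra|exact A1]. }
    assert (Hm : (1 <= INR (S m))%R) by (rewrite S_INR; generalize (pos_INR m); lra).
    apply Rmult_le_reg_l with (INR (S m)); [lra|].
    replace (INR (S m) * (/ INR (S m) * Cmod L * r ^ S m))%R with
      (Cmod L * r ^ S m)%R by (field; lra).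
    eapply Rle_trans; [exact HL|].
    destruct (Nat.le_gt_cases (S m) n0) as [Hle|Hgt].
    + replace (Nat.min (S m) n0) with (S m) by lia.
      unfold B. replace (Nat.min m n0) with m by lia. simpl ((1 + T) ^ S m)%R.
      assert (0 < (1 + T) ^ m)%R by (apply pow_lt; lra).
      apply Rle_trans with (1 * ((1 + T) * (1 + T) ^ m))%R; [nra|].
      apply Rmult_le_compat_r; [nra|lra].
    + replace (Nat.min (S m) n0) with n0 by lia.
      unfold B. replace (Nat.min m n0) with n0 by lia.
      apply Rmult_le_compat_r; [apply pow_le; lra|].
      apply Rle_trans with (INR n0); [lra|]. apply le_INR; lia.
Qed.

Lemma dps_sol c : quad_bounded c -> dps (sol c).
Proof.
  intros Hc. apply dps_bound. intros r Hr. destruct (sol_bound r Hr) as [M HM]. exists M; now apply HM.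
Qed.

(** * Logarithmic derivatives of products of factors 1 - q^d *)

Definition one_minus_X (d n : nat) : C := if Nat.eqb n 0 then 1 else if Nat.eqb n d then - (1) else 0.
(* The coefficients of [q d/dq log (1 - q^d)]. *)
Definition log_coef (d n : nat) : C :=
  if Nat.eqb n 0 then 0 else if Nat.eqb (n mod d) 0 then - INR d else 0.

Lemma lsum_two (f : nat -> C) d n : (0 < d)%nat -> (forall k, k <> O -> k <> d -> f k = 0) ->
  lsum f (seq 0 (S n)) = f O + (if Nat.leb d n then f d else 0).
Proof.
  intros Hd H. induction n as [|n IH].
  - destruct (Nat.leb_spec d 0); [lia|]. unfold lsum; simpl; ring.
  - rewrite seq_S, lsum_app, IH.
    match goal with |- _ + lsum ?f (?m :: nil) = _ =>
      replace (lsum f (m :: nil)) with (f m) by (unfold lsum; simpl; ring) end.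
    rewrite Nat.add_0_l. destruct (Nat.leb_spec d n), (Nat.leb_spec d (S n)); try lia.
    + rewrite (H (S n)) by lia. ring.
    + replace d with (S n) by lia. ring.
    + rewrite (H (S n)) by lia. ring.
Qed.

Lemma dps_finite (a : nat -> C) d : (forall n, (d < n)%nat -> a n = 0) -> dps a.
Proof.
  intros H q _.
  assert (HK : exists M, forall n, (n <= d)%nat -> (Cmod (a n * q ^ n) <= M)%R).
  { clear H. induction d as [|d [M HM]].
    - exists (Cmod (a 0%nat * q ^ 0)). intros n Hn. replace n with 0%nat by lia. lra.
    - exists (Rmax M (Cmod (a (S d) * q ^ S d))). intros n Hn. destruct (Nat.eq_dec n (S d)) as [->|Hne].
      + apply Rmax_r.
      + eapply Rle_trans; [apply HM; lia|apply Rmax_l]. }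
  destruct HK as [M HM].
  apply (summable_le _ (fun n => (M * 2 ^ d) * (/ 2) ^ n)).
  - assert (HM0 : (0 <= M)%R) by (eapply Rle_trans; [apply Cmod_ge_0|apply (HM 0%nat); lia]).
    intros n. destruct (Nat.le_gt_cases n d) as [Hn|Hn].
    + eapply Rle_trans; [now apply HM|].
      rewrite !Cmod_mult, !Cmod_pow, Cmod_inv, !Cmod_R, !Rabs_pos_eq by (lra || apply C2_neq0).
      replace d with (n + (d - n))%nat by lia. rewrite pow_add, pow_inv.
      assert (P1 : (0 < 2 ^ n)%R) by (apply pow_lt; lra).
      assert (P2 : (1 <= 2 ^ (d - n))%R) by (apply pow_R1_Rle; lra).
      replace (M * (2 ^ n * 2 ^ (d - n)) * / 2 ^ n)%R with (M * 2 ^ (d - n))%R by (field; lra). nra.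
    + rewrite H by assumption. rewrite Cmult_0_l, Cmod_0. apply Cmod_ge_0.
  - apply summable_scal, summable_geom. generalize (half_pow_lt1 0); simpl. now rewrite Cmult_1_r.
Qed.

Lemma dps_one_minus_X d : dps (one_minus_X d).
Proof.
  apply (dps_finite _ d). intros n Hn. unfold one_minus_X.
  destruct (Nat.eqb_spec n 0), (Nat.eqb_spec n d); try lia. reflexivity.
Qed.

Lemma ev_one_minus_X d q : (0 < d)%nat -> ev (one_minus_X d) q = 1 - q ^ d.
Proof.
  intros Hd. unfold ev. rewrite (usum_finite _ d).
  - rewrite (lsum_two _ d) by (auto; intros k H1 H2; unfold one_minus_X;
      destruct (Nat.eqb_spec k 0), (Nat.eqb_spec k d); try lia; ring).
    rewrite Nat.leb_refl. unfold one_minus_X. destruct (Nat.eqb_spec d 0); [lia|].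
    rewrite (Nat.eqb_refl d). simpl. ring.
  - intros k Hk. unfold one_minus_X. destruct (Nat.eqb_spec k 0), (Nat.eqb_spec k d); try lia. ring.
Qed.

Lemma Cmod_log_coef d k : (Cmod (log_coef d k) <= if Nat.ltb k d then 0 else INR k)%R.
Proof.
  unfold log_coef. destruct (Nat.eqb_spec k 0) as [->|Hk].
  - rewrite Cmod_0. destruct (Nat.ltb_spec 0 d); simpl; lra.
  - destruct (Nat.eqb_spec (k mod d) 0) as [E|E].
    + destruct (Nat.ltb_spec k d) as [Hl|Hl].
      * rewrite Nat.mod_small in E by assumption. lia.
      * rewrite Cmod_opp, Cmod_R, Rabs_pos_eq by apply pos_INR. apply le_INR; assumption.
    + rewrite Cmod_0. destruct (Nat.ltb k d); [lra|apply pos_INR].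
Qed.

Lemma quad_log_coef d : (0 < d)%nat -> quad_bounded (log_coef d).
Proof.
  intros Hd k. eapply Rle_trans; [apply Cmod_log_coef|]. destruct (Nat.ltb_spec k d).
  - apply pow_le, pos_INR.
  - assert (1 <= INR k)%R by (apply (le_INR 1); lia). simpl. nra.
Qed.

(** Multiplication by 1 - q^d subtracts coefficients at distance d; by periodicity they cancel
    except in degree d, where -d is left. *)
Lemma log_sol_one_minus_X d : (0 < d)%nat -> log_sol (log_coef d) (one_minus_X d).
Proof.
  intros Hd. split; [reflexivity|]. intros n.
  rewrite conv_comm by (auto using dps_one_minus_X, dps_quad, quad_log_coef).
  unfold conv. rewrite (lsum_two _ d) by (auto; intros k H1 H2; unfold one_minus_X;
      destruct (Nat.eqb_spec k 0), (Nat.eqb_spec k d); try lia; ring).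
  rewrite Nat.sub_0_r. replace (one_minus_X d 0) with (1 : C) by reflexivity.
  replace (one_minus_X d d) with (- (1) : C).
  2: { unfold one_minus_X. destruct (Nat.eqb_spec d 0); [lia|]. now rewrite (Nat.eqb_refl d). }
  destruct (Nat.leb_spec d n) as [Hle|Hlt].
  - destruct (Nat.eq_dec n d) as [->|Hne].
    + rewrite Nat.sub_diag. unfold one_minus_X, log_coef. destruct (Nat.eqb_spec d 0); [lia|].
      rewrite (Nat.eqb_refl d), Nat.Div0.mod_same. simpl (Nat.eqb 0 0). cbv iota. ring.
    + assert (E : log_coef d (n - d) = log_coef d n).
      { unfold log_coef. destruct (Nat.eqb_spec n 0), (Nat.eqb_spec (n - d) 0); try lia.
        replace n with (n - d + 1 * d)%nat at 2 by lia. now rewrite Nat.Div0.mod_add. }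
      rewrite E. unfold one_minus_X. destruct (Nat.eqb_spec n 0), (Nat.eqb_spec n d); try lia. ring.
  - unfold one_minus_X, log_coef. destruct (Nat.eqb_spec n 0) as [->|Hn].
    + simpl. ring.
    + destruct (Nat.eqb_spec n d); [lia|]. rewrite Nat.mod_small by assumption.
      destruct (Nat.eqb_spec n 0); [lia|]. ring.
Qed.

Definition log_coefs (d : nat -> nat) (N k : nat) : C := lsum (fun i => log_coef (d i) k) (seq 0 N).

(** As d i > i, factors with i >= k do not reach degree k, so the diagonal value is already the
    limit. *)
Lemma log_coefs_tail d N k : (forall i, (i < d i)%nat) -> (k <= N)%nat -> log_coefs d N k = log_coefs d k k.
Proof.
  intros Hd Hk. unfold log_coefs. replace N with (k + (N - k))%nat by lia.
  rewrite seq_app, lsum_app, (lsum_zero _ (seq (0 + k) (N - k))); [ring|].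
  intros i Hi. apply in_seq in Hi. unfold log_coef. destruct (Nat.eqb_spec k 0); [reflexivity|].
  specialize (Hd i). rewrite Nat.mod_small by lia. destruct (Nat.eqb_spec k 0); [lia|reflexivity].
Qed.

Lemma quad_log_coefs d N : (forall i, (i < d i)%nat) -> quad_bounded (log_coefs d N).
Proof.
  intros Hd k. unfold log_coefs. eapply Rle_trans; [apply Cmod_lsum|].
  assert (H : (rsum (fun i => Cmod (log_coef (d i) k)) (seq 0 N) <= INR (Nat.min N k) * INR k)%R).
  { induction N as [|N IH].
    - unfold rsum; simpl. lra.
    - rewrite seq_S, rsum_app, Nat.add_0_l.
      replace (rsum (fun i => Cmod (log_coef (d i) k)) (N :: nil)) with (Cmod (log_coef (d N) k)) by (unfold rsum; simpl; ring).
      assert (A := Cmod_log_coef (d N) k). specialize (Hd N).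
      destruct (Nat.le_gt_cases k N).
      + destruct (Nat.ltb_spec k (d N)); [|lia]. replace (Nat.min (S N) k) with (Nat.min N k) by lia. lra.
      + replace (Nat.min (S N) k) with (S (Nat.min N k)) by lia. rewrite S_INR.
        assert (P := pos_INR k). destruct (Nat.ltb k (d N)); lra. }
  eapply Rle_trans; [exact H|]. simpl. rewrite Rmult_1_r.
  apply Rmult_le_compat_r; [apply pos_INR|]. apply le_INR; lia.
Qed.

(** One more factor adds its logarithmic coefficients; the solution is then multiplied by that
    factor, by uniqueness. *)
Lemma sol_log_coefs d N : (forall i, (i < d i)%nat) -> dps (sol (log_coefs d N)) /\
  forall q, (Cmod q < 1)%R -> ev (sol (log_coefs d N)) q = cprod (fun i => 1 - q ^ d i) N.
Proof.
  intros Hd. split; [now apply dps_sol, quad_log_coefs|]. intros q Hq.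
  assert (C0 : forall N, log_coefs d N 0 = 0).
  { intros M. unfold log_coefs. apply lsum_zero. intros; reflexivity. }
  induction N as [|N IH].
  - cbn [cprod]. unfold ev. rewrite (usum_single _ 0%nat); [unfold sol; simpl; ring|].
    intros k Hk. destruct k as [|k]; [lia|]. rewrite sol_S.
    rewrite (lsum_zero _ (seq 0 (S k))); [ring|]. intros i _. unfold log_coefs, lsum; simpl; ring.
  - cbn [cprod]. rewrite <- IH, <- ev_one_minus_X by (specialize (Hd N); lia).
    assert (D1 := dps_sol _ (quad_log_coefs d N Hd)). assert (D2 := dps_one_minus_X (d N)).
    rewrite <- ev_conv by assumption. unfold ev. apply usum_ext; intros n. f_equal. revert n.
    apply (log_sol_unique (log_coefs d (S N))); [apply C0|apply log_sol_sol, C0|].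
    replace (log_coefs d (S N)) with (fun n => log_coefs d N n + log_coef (d N) n).
    + assert (HdN : (0 < d N)%nat) by (specialize (Hd N); lia).
      apply log_sol_conv; auto using dps_quad, quad_log_coefs, quad_log_coef, log_sol_one_minus_X.
      apply log_sol_sol, C0.
    + extensionality n. unfold log_coefs. rewrite seq_S, lsum_app, Nat.add_0_l. f_equal.
      unfold lsum; simpl; ring.
Qed.

(** Coefficients of the partial products stabilise in each degree, and [sol_bound] majorises them by
    one geometric series. *)
Lemma infinite_product_series d : (forall i, (i < d i)%nat) ->
  forall q, (Cmod q < 1)%R ->
  clim (cprod (fun i => 1 - q ^ d i)) (ev (sol (fun k => log_coefs d k k)) q).
Proof.
  intros Hd q Hq. assert (H0 := Cmod_ge_0 q).
  apply (clim_ext (fun N => ev (sol (log_coefs d N)) q)).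
  { intros N; now apply sol_log_coefs. }
  set (r := ((1 + Cmod q) / 2)%R). assert (Hr : (Cmod q < r < 1)%R) by (unfold r; lra).
  destruct (sol_bound r) as [M HM]; [lra|].
  assert (SG : summable (fun n => M * (q / r) ^ n)).
  { apply summable_scal, summable_geom.
    rewrite Cmod_div, Cmod_R, Rabs_pos_eq by (try lra; intros E; apply RtoC_inj in E; lra).
    apply Rmult_lt_reg_r with r; [lra|]. unfold Rdiv. rewrite Rmult_assoc, Rinv_l; lra. }
  destruct SG as [M' HM'].
  apply (usum_dominated _ _ (fun n => Cmod (M * (q / r) ^ n)) M'); [|exact HM'|].
  - intros N n. assert (A := HM _ (quad_log_coefs d N Hd) n).
    assert (Hrn : (0 < r ^ n)%R) by (apply pow_lt; lra).
    assert (HM0 : (0 <= M)%R).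
    { eapply Rle_trans; [|exact A]. apply Rmult_le_pos; [apply Cmod_ge_0|lra]. }
    rewrite !Cmod_mult, !Cmod_pow, Cmod_div, !Cmod_R, !Rabs_pos_eq by (try lra; intros E; apply RtoC_inj in E; lra).
    unfold Rdiv. rewrite Rpow_mult_distr, pow_inv.
    apply Rle_trans with ((Cmod (sol (log_coefs d N) n) * r ^ n) * (Cmod q ^ n * / r ^ n))%R; [right; field; lra|].
    apply Rmult_le_compat_r; [|exact A].
    apply Rmult_le_pos; [now apply pow_le|left; now apply Rinv_0_lt_compat].
  - intros n e He. exists n. intros N HN.
    rewrite (sol_local (log_coefs d N) (fun k => log_coefs d k k)).
    + match goal with |- (Cmod ?x < _)%R => replace x with (0 : C) by ring end. now rewrite Cmod_0.
    + intros k Hk. apply log_coefs_tail; [assumption|lia].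
Qed.

(** Logarithmic derivative of (q^s; q^m)_oo; degree k sees only the first k factors, hence the
    repeated k. *)
Definition eta_log (s m k : nat) : C := log_coefs (fun i => (s + m * i)%nat) k k.

Lemma quad_eta_log s m : (0 < s)%nat -> (0 < m)%nat -> quad_bounded (eta_log s m).
Proof.
  intros Hs Hm k. unfold eta_log. apply quad_log_coefs. intros i; nia.
Qed.

Lemma eta_series s m q : (0 < s)%nat -> (0 < m)%nat -> (Cmod q < 1)%R ->
  qpoch_inf (q ^ s) (q ^ m) = ev (sol (eta_log s m)) q.
Proof.
  intros Hs Hm Hq. apply qpoch_inf_eq.
  apply (clim_ext (cprod (fun i => 1 - q ^ (s + m * i)))).
  - intros n. rewrite qpoch_cprod. apply cprod_ext; intros i. now rewrite Cpow_add_r, Cpow_mult_r.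
  - apply (infinite_product_series (fun i => (s + m * i)%nat)); [intros; nia|assumption].
Qed.

Lemma eta_log_0 s m : eta_log s m 0 = 0.
Proof. reflexivity. Qed.

(** Halving the logarithmic derivative takes the square root, since convolving the solution with
    itself adds the two halves. *)
Definition eta_root (s m : nat) : nat -> C := sol (fun k => / 2 * eta_log s m k).

Lemma quad_half c : quad_bounded c -> quad_bounded (fun k => / 2 * c k).
Proof.
  intros H k. rewrite Cmod_mult, Cmod_inv, Cmod_R, Rabs_pos_eq by (lra || apply C2_neq0).
  specialize (H k). generalize (Cmod_ge_0 (c k)); lra.
Qed.

Lemma dps_eta_root s m : (0 < s)%nat -> (0 < m)%nat -> dps (eta_root s m).
Proof. intros. now apply dps_sol, quad_half, quad_eta_log. Qed.

Lemma eta_root_sq s m q : (0 < s)%nat -> (0 < m)%nat -> (Cmod q < 1)%R ->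
  ev (eta_root s m) q ^ 2 = qpoch_inf (q ^ s) (q ^ m).
Proof.
  intros Hs Hm Hq. rewrite eta_series by assumption.
  assert (D := dps_eta_root s m Hs Hm). assert (Dc := dps_quad _ (quad_half _ (quad_eta_log s m Hs Hm))).
  rewrite Cpow2, <- ev_conv by assumption. unfold ev. apply usum_ext; intros n. f_equal. revert n.
  assert (E0 : / 2 * eta_log s m 0 = 0) by (rewrite eta_log_0; ring).
  apply (log_sol_unique (eta_log s m)); [apply eta_log_0| |apply log_sol_sol, eta_log_0].
  replace (eta_log s m) with (fun k => / 2 * eta_log s m k + / 2 * eta_log s m k).
  - apply log_sol_conv; auto; now apply log_sol_sol.
  - extensionality k. field.
Qed.

Lemma conv_0 a b : conv a b 0 = a O * b O.
Proof. unfold conv, lsum; simpl; ring. Qed.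

Lemma half_power_J q : (Cmod q < 1)%R ->
  half_power (J 24) 9 q = ev (eta_root 24 24) q * J 24 q ^ 4.
Proof.
  revert q. apply half_power_eq.
  assert (Dj : dps (sol (eta_log 24 24))) by (apply dps_sol, quad_eta_log; lia).
  assert (Dr : dps (eta_root 24 24)) by (apply dps_eta_root; lia).
  set (j := sol (eta_log 24 24)) in *.
  exists (conv (eta_root 24 24) (conv (conv j j) (conv j j))). split.
  - rewrite !conv_0. unfold j, eta_root, sol; simpl. ring.
  - intros q Hq.
    assert (Ej : J 24 q = ev j q) by (unfold J; apply eta_series; auto; lia).
    assert (Er := eta_root_sq 24 24 q ltac:(lia) ltac:(lia) Hq).
    fold (J 24 q) in Er. split.
    + replace (ev (eta_root 24 24) q * J 24 q ^ 4) with (ev (conv (eta_root 24 24) (conv (conv j j) (conv j j))) q).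
      * apply dps_is_pseries; auto using dps_conv.
      * rewrite !ev_conv by auto using dps_conv. rewrite Ej. simpl. ring.
    + transitivity (ev (eta_root 24 24) q ^ 2 * J 24 q ^ 8); [ring|]. rewrite Er. ring.
Qed.

(** As 24 - 12 = 12, the product (q^12; q^24)_oo occurs squared in J_{12,24}; only the root of J_24
    is needed, the same one as in J_24^(9/2). *)
Lemma half_power_Jt q : (Cmod q < 1)%R ->
  half_power (Jt 12 24) 1 q = ev (eta_root 24 24) q * qpoch_inf (q ^ 12) (q ^ 24).
Proof.
  revert q. apply half_power_eq.
  assert (Dj : dps (sol (eta_log 12 24))) by (apply dps_sol, quad_eta_log; lia).
  assert (Dr : dps (eta_root 24 24)) by (apply dps_eta_root; lia).
  exists (conv (eta_root 24 24) (sol (eta_log 12 24))). split.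
  - rewrite conv_0. unfold eta_root, sol; simpl. ring.
  - intros q Hq.
    assert (Ej := eta_series 12 24 q ltac:(lia) ltac:(lia) Hq).
    assert (Er := eta_root_sq 24 24 q ltac:(lia) ltac:(lia) Hq). split.
    + rewrite Ej, <- ev_conv by assumption. apply dps_is_pseries; auto using dps_conv.
    + unfold Jt. cbn [Nat.sub]. rewrite <- Er. ring.
Qed.

Lemma half_power_ratio q : (Cmod q < 1)%R -> J 24 q <> 0 -> qpoch_inf (q ^ 12) (q ^ 24) <> 0 ->
  half_power (J 24) 9 q / half_power (Jt 12 24) 1 q = J 24 q ^ 4 / qpoch_inf (q ^ 12) (q ^ 24)
  /\ half_power (Jt 12 24) 1 q <> 0.
Proof.
  intros Hq HJ H12. rewrite half_power_J, half_power_Jt by assumption.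
  assert (Hr : ev (eta_root 24 24) q <> 0).
  { intros E. assert (Er := eta_root_sq 24 24 q ltac:(lia) ltac:(lia) Hq). rewrite E in Er.
    apply HJ. unfold J. rewrite <- Er. simpl; ring. }
  split; [field; auto|now apply Cmult_neq_0].
Qed.

(** * The series over natural numbers and the product side *)

Lemma Cpow_0_l n : (0 < n)%nat -> (0 : C) ^ n = 0.
Proof. intros H. destruct n; [lia|]. simpl; ring. Qed.

Lemma qpoch_inf_0 (Q : C) : qpoch_inf 0 Q = 1.
Proof.
  apply qpoch_inf_eq, (clim_ext (fun _ => 1)); [|apply clim_const].
  induction n as [|n IH]; [reflexivity|]. cbn [qpoch]. rewrite <- IH. ring.
Qed.

Definition summand (q : C) (t : nat * nat * nat) : C :=
  let '(i, j, k) := t in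
  q ^ (i ^ 2 + 3 * j ^ 2 + 4 * k ^ 2 + 4 * j * k + 2 * j + 4 * k - 2 * i * j)
  / (qpoch (q ^ 4) (q ^ 4) i * qpoch (q ^ 4) (q ^ 4) j * qpoch (q ^ 4) (q ^ 4) k).

Lemma is_sum_ext {I} (f g : I -> C) s : (forall x, f x = g x) -> is_sum f s -> is_sum g s.
Proof. intros H. replace g with f by (now extensionality x). trivial. Qed.

(** The exponent is (i - j)^2 + 2 j^2 plus nonnegative terms including 4 k^2, hence positive away
    from the origin. *)
Lemma summand_0 t : t <> (0, 0, 0)%nat -> summand 0 t = 0.
Proof.
  destruct t as [[i j] k]. intros H. unfold summand. rewrite (Cpow_0_l (_ - _)).
  - unfold Cdiv; ring.
  - assert (i <> 0 \/ j <> 0 \/ k <> 0)%nat.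
    { destruct (Nat.eq_dec i 0), (Nat.eq_dec j 0), (Nat.eq_dec k 0); auto. subst; now contradiction H. }
    assert (0 < (Z.of_nat i - Z.of_nat j) * (Z.of_nat i - Z.of_nat j) + 2 * (Z.of_nat j * Z.of_nat j)
      + 4 * (Z.of_nat k * Z.of_nat k) + 4 * (Z.of_nat j * Z.of_nat k) + 2 * Z.of_nat j + 4 * Z.of_nat k)%Z by nia.
    cbn [Nat.pow]. lia.
Qed.

Lemma is_sum_0 : is_sum (summand 0) 1.
Proof.
  replace (1 : C) with (summand 0 (0, 0, 0)%nat) by (unfold summand; simpl; field).
  apply is_sum_single, summand_0.
Qed.

(** The truncated subtraction is exact because i^2 + 3 j^2 >= 2 i j. *)
Lemma triple_term_nat q i j k : triple_term q (Z.of_nat j, (Z.of_nat i, Z.of_nat k)) = summand q (i, j, k).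
Proof.
  unfold triple_term, summand; cbn [fst snd]. rewrite !rq_nat.
  replace (Q4 q) with (q ^ 4) by ring.
  match goal with |- zp q ?z * _ = q ^ ?n / _ =>
    replace z with (Z.of_nat n) by (cbn [Nat.pow]; nia) end.
  rewrite zp_nat. unfold Cdiv. rewrite !Cinv_mul. ring.
Qed.

Lemma is_sum_summand q : base q -> is_sum (summand q) (usum (triple_term q)).
Proof.
  intros Hb. set (g := fun t : nat * nat * nat =>
    (Z.of_nat (snd (fst t)), (Z.of_nat (fst (fst t)), Z.of_nat (snd t)))).
  assert (Hg : forall x y, g x = g y -> x = y).
  { intros [[i j] k] [[i' j'] k'] H. unfold g in H; cbn [fst snd] in H.
    injection H; intros; repeat f_equal; lia. }
  apply (is_sum_ext (fun x => triple_term q (g x))).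
  - intros [[i j] k]. apply triple_term_nat.
  - rewrite (usum_reindex g); auto using summable_triple.
    + apply summable_is_sum, summable_comp; auto using summable_triple.
    + intros [j [i k]] H. unfold triple_term; cbn [fst snd].
      destruct (Z.le_gt_cases 0 i) as [Hi|Hi]; [|rewrite (rq_neg _ i) by assumption; ring].
      destruct (Z.le_gt_cases 0 j) as [Hj|Hj]; [|rewrite (rq_neg _ j) by assumption; ring].
      destruct (Z.le_gt_cases 0 k) as [Hk|Hk]; [|rewrite (rq_neg _ k) by assumption; ring].
      exfalso. apply (H (Z.to_nat i, Z.to_nat j, Z.to_nat k)). unfold g; cbn [fst snd].
      now rewrite !Z2Nat.id.
Qed.

Theorem theorem1p2 :
  forall q : C, (Cmod q < 1)%R ->
    is_sum
      (fun t : nat * nat * nat =>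
         let '(i, j, k) := t in
         q ^ (i ^ 2 + 3 * j ^ 2 + 4 * k ^ 2 + 4 * j * k + 2 * j + 4 * k
              - 2 * i * j)
         / (qpoch (q ^ 4) (q ^ 4) i * qpoch (q ^ 4) (q ^ 4) j
            * qpoch (q ^ 4) (q ^ 4) k))
      (Jt 2 24 q * half_power (J 24) 9 q * Jt 6 24 q * Jt 10 24 q
       / (Jt 1 24 q * Jt 4 24 q ^ 2 * Jt 5 24 q * Jt 7 24 q * Jt 8 24 q
          * Jt 11 24 q * half_power (Jt 12 24) 1 q)).
Proof.
  intros q Hq. change (is_sum (summand q)
    (Jt 2 24 q * half_power (J 24) 9 q * Jt 6 24 q * Jt 10 24 q
       / (Jt 1 24 q * Jt 4 24 q ^ 2 * Jt 5 24 q * Jt 7 24 q * Jt 8 24 q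
          * Jt 11 24 q * half_power (Jt 12 24) 1 q))).
  assert (N : forall a, (0 < a)%nat -> qpoch_inf (q ^ a) (q ^ 24) <> 0).
  { intros a Ha. destruct (Ceq_dec q 0) as [->|H0].
    - rewrite Cpow_0_l, qpoch_inf_0 by assumption. apply C1_nz.
    - generalize (pe_neq0 1 q a 12 (conj H0 Hq) sign_1 Ha ltac:(lia)). unfold pe. now rewrite Cmult_1_l. }
  destruct (half_power_ratio q Hq) as [HR HN]; [apply N; lia|apply N; lia|].
  set (h := half_power (J 24) 9 q) in *. set (h' := half_power (Jt 12 24) 1 q) in *.
  (* Only the quotient of the half powers matters: the common square root cancels, leaving J_24^4 /
     (q^12; q^24)_oo. *)
  replace h with (h' * (h / h')) by (field; assumption). rewrite HR.
  unfold Jt, J. cbn [Nat.sub].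
  (* The argument with integer powers requires q <> 0. At q = 0 all products are 1 and only the term
     at the origin survives. *)
  destruct (Ceq_dec q 0) as [->|H0].
  - rewrite !Cpow_0_l, !qpoch_inf_0 by lia.
    match goal with |- is_sum _ ?x => replace x with (1 : C) by (field; auto) end. exact is_sum_0.
  - assert (Hb : base q) by now split. assert (T := triple_sum_product24 q Hb). cbv zeta in T.
    unfold pe in T. cbn [Nat.mul Nat.add] in T. rewrite !Cmult_1_l in T.
    match goal with |- is_sum _ ?x => replace x with (usum (triple_term q)) end; [now apply is_sum_summand|].
    assert (N1 := N 1%nat ltac:(lia)). assert (N4 := N 4%nat ltac:(lia)). assert (N5 := N 5%nat ltac:(lia)).
    assert (N7 := N 7%nat ltac:(lia)). assert (N8 := N 8%nat ltac:(lia)). assert (N11 := N 11%nat ltac:(lia)).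
    assert (N12 := N 12%nat ltac:(lia)). assert (N13 := N 13%nat ltac:(lia)).
    assert (N16 := N 16%nat ltac:(lia)).
    assert (N17 := N 17%nat ltac:(lia)). assert (N19 := N 19%nat ltac:(lia)).
    assert (N20 := N 20%nat ltac:(lia)).
    assert (N23 := N 23%nat ltac:(lia)). assert (N24 := N 24%nat ltac:(lia)).
    set (Q := q ^ 24) in *.
    set (p1 := qpoch_inf (q ^ 1) Q) in *.
    set (p2 := qpoch_inf (q ^ 2) Q) in *.
    set (p4 := qpoch_inf (q ^ 4) Q) in *.
    set (p5 := qpoch_inf (q ^ 5) Q) in *.
    set (p6 := qpoch_inf (q ^ 6) Q) in *.
    set (p7 := qpoch_inf (q ^ 7) Q) in *.
    set (p8 := qpoch_inf (q ^ 8) Q) in *.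
    set (p10 := qpoch_inf (q ^ 10) Q) in *.
    set (p11 := qpoch_inf (q ^ 11) Q) in *.
    set (p12 := qpoch_inf (q ^ 12) Q) in *.
    set (p13 := qpoch_inf (q ^ 13) Q) in *.
    set (p14 := qpoch_inf (q ^ 14) Q) in *.
    set (p16 := qpoch_inf (q ^ 16) Q) in *.
    set (p17 := qpoch_inf (q ^ 17) Q) in *.
    set (p18 := qpoch_inf (q ^ 18) Q) in *.
    set (p19 := qpoch_inf (q ^ 19) Q) in *.
    set (p20 := qpoch_inf (q ^ 20) Q) in *.
    set (p22 := qpoch_inf (q ^ 22) Q) in *.
    set (p23 := qpoch_inf (q ^ 23) Q) in *.
    match type of T with _ * ?d = ?n => transitivity (n / d) end.
    + rewrite <- T. field. repeat split; assumption.
    + field. repeat split; assumption.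
Qed.
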